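(* Let $\mathbb{X}$ be a complex Banach space and let $g\in BUC(\mathbb{R}^+,\mathbb{X})$. Then: (1) If $\xi_0$ is an isolated point of $sp(g)$, then $i\xi_0$ is either a removable singularity of $\hat g(\lambda)$ or a pole of $\hat g(\lambda)$ of order at most $1$. (2) If $sp(g)=\emptyset$, then $g\in C_0(\mathbb{R}^+,\mathbb{X})$. (3) $sp(g)$ is a closed subset of $\mathbb{R}$. (4) For $p\in[0,2\pi)$, $g$ is an asymptotic Bloch $1$-periodic function of type $p$, i.e. $\lim_{t\to\infty}\big(g(t+1)-e^{ip}g(t)\big)=0$, if and only if $sp(g)\subset p+2\pi\mathbb{Z}$.
   Context: $\mathbb{R}^+=[0,\infty)$. $BUC(\mathbb{R}^+,\mathbb{X})$ is the Banach space of bounded uniformly continuous functions $\mathbb{R}^+\to\mathbb{X}$ with the sup-norm; $C_0(\mathbb{R}^+,\mathbb{X})$ is its closed subspace of functions tending to $0$ at infinity; $\mathbb{Y}=BUC(\mathbb{R}^+,\mathbb{X})/C_0(\mathbb{R}^+,\mathbb{X})$ with the quotient norm, and $\tilde g$ is the class of $g$ in $\mathbb{Y}$. Let $\mathcal{D}=d/dt$ in $BUC(\mathbb{R}^+,\mathbb{X})$ with domain $D(\mathcal D)=\{f: f'\text{ exists and } f'\in BUC(\mathbb{R}^+,\mathbb{X})\}$. Let $\tilde{\mathcal D}$ be the operator in $\mathbb{Y}$ with domain $\{\tilde f:\ \exists u\in\tilde f,\ u\in D(\mathcal D)\}$ and $\tilde{\mathcal D}\tilde f=\widetilde{\mathcal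 D u}$ for such $u$ (this is well defined). For $\operatorname{Re}\lambda\ne0$ put $\hat g(\lambda)=(\lambda-\tilde{\mathcal D})^{-1}\tilde g$. The spectrum $sp(g)$ is the set of $\xi_0\in\mathbb{R}$ such that $\hat g$ has no analytic extension to any neighborhood of $i\xi_0$. *)

(* Defs.v *)
From Stdlib Require Import Reals Lra.
From Stdlib Require Import FunctionalExtensionality PropExtensionality.
From Stdlib Require Import ProofIrrelevance ClassicalEpsilon.
From Coquelicot Require Import Coquelicot.

Set Implicit Arguments.
Unset Strict Implicit.
Open Scope R_scope.

Lemma plus_plus_swap (G : AbelianGroup) (a b c d : G) :
  plus (plus a b) (plus c d) = plus (plus a c) (plus b d).
Proof.
  etransitivity; [symmetry; apply plus_assoc|].
  etransitivity; [|apply plus_assoc].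
  apply (f_equal (plus a)).
  etransitivity; [apply plus_assoc|].
  etransitivity; [|symmetry; apply plus_assoc].
  apply (f_equal (fun x => plus x d)), plus_comm.
Qed.

Lemma minus_plus_plus (G : AbelianGroup) (a b c d : G) :
  minus (plus a b) (plus c d) = plus (minus a c) (minus b d).
Proof.
  etransitivity; [apply (f_equal (plus (plus a b))), opp_plus|].
  apply plus_plus_swap.
Qed.

Lemma minus_minus_l (G : AbelianGroup) (a b : G) : minus (minus a b) a = opp b.
Proof.
  etransitivity; [apply (f_equal (fun x => plus x (opp a))), plus_comm|].
  etransitivity; [symmetry; apply plus_assoc|].
  etransitivity; [apply f_equal, plus_opp_r|apply plus_zero_r].
Qed.

Lemma minus_minus (G : AbelianGroup) (a b : G) : minus a (minus a b) = b.
Proof.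
  rewrite <- opp_minus.
  etransitivity; [apply f_equal, minus_minus_l|apply opp_opp].
Qed.

Section NormedFromNorm.

Variables (K : AbsRing) (V : ModuleSpace K) (nrm : V -> R).
Hypothesis nrm_triangle : forall x y : V, nrm (plus x y) <= nrm x + nrm y.
Hypothesis nrm_scal : forall (l : K) (x : V), nrm (scal l x) <= abs l * nrm x.
Hypothesis nrm_eq0 : forall x : V, nrm x = 0 -> x = zero.

Definition nrm_ball (x : V) (e : R) (y : V) : Prop := nrm (minus y x) < e.

Lemma nrm_zero : nrm zero <= 0.
Proof.
  pose proof (nrm_scal zero zero) as H.
  rewrite scal_zero_r in H.
  assert (H0 : abs (zero : K) = 0) by apply abs_zero.
  rewrite H0 in H; lra.
Qed.

Lemma nrm_opp (x : V) : nrm (opp x) <= nrm x.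
Proof.
  rewrite <- scal_opp_one.
  eapply Rle_trans; [apply nrm_scal|].
  right; rewrite <- (Rmult_1_l (nrm x)) at 2; f_equal; apply abs_opp_one.
Qed.

Lemma nrm_ball_center (x : V) (e : posreal) : nrm_ball x e x.
Proof.
  unfold nrm_ball; rewrite minus_eq_zero.
  eapply Rle_lt_trans; [apply nrm_zero|apply cond_pos].
Qed.

Lemma nrm_ball_sym (x y : V) (e : R) : nrm_ball x e y -> nrm_ball y e x.
Proof.
  unfold nrm_ball; intros H.
  rewrite <- opp_minus.
  eapply Rle_lt_trans; [apply nrm_opp|exact H].
Qed.

Lemma nrm_ball_triangle (x y z : V) (e1 e2 : R) :
  nrm_ball x e1 y -> nrm_ball y e2 z -> nrm_ball x (e1 + e2) z.
Proof.
  unfold nrm_ball; intros H1 H2.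
  rewrite (minus_trans y z x).
  eapply Rle_lt_trans; [apply nrm_triangle|].
  rewrite Rplus_comm; apply Rplus_lt_compat; assumption.
Qed.

Definition nrm_UniformSpace_mixin : UniformSpace.mixin_of V :=
  @UniformSpace.Mixin V zero nrm_ball nrm_ball_center nrm_ball_sym
    nrm_ball_triangle.

Definition nrm_NormedModuleAux : NormedModuleAux K :=
  NormedModuleAux.Pack K V
    (NormedModuleAux.Class K V (ModuleSpace.class K V) nrm_UniformSpace_mixin)
    V.

Lemma nrm_ball_norm (x y : nrm_NormedModuleAux) (e : posreal) :
  ball x e y -> nrm (minus y x) < 1 * e.
Proof. rewrite Rmult_1_l; exact (fun h => h). Qed.

Definition NormedModule_of_norm : NormedModule K :=
  NormedModule.Pack K V
    (NormedModule.Class K V (NormedModuleAux.class K nrm_NormedModuleAux)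
      (@NormedModule.Mixin K nrm_NormedModuleAux nrm 1 nrm_triangle nrm_scal
        (fun x y e (h : nrm (minus y x) < e) => h) nrm_ball_norm nrm_eq0))
    V.

End NormedFromNorm.

(* Traces on [0, oo) of the filters of neighbourhoods of +oo and of punctured
   neighbourhoods of [t]. *)
Definition at_infty (P : nonnegreal -> Prop) : Prop :=
  exists M : R, forall t : nonnegreal, M < t -> P t.

Definition nn_locally' (t : nonnegreal) (P : nonnegreal -> Prop) : Prop :=
  locally' (nonneg t) (fun r => forall s : nonnegreal, nonneg s = r -> P s).

Section BUC.

Variable X : NormedModule C_AbsRing.

(* [nonnegreal] plays the role of the half-line [0, oo). *)
Record BUC : Type := mkBUC {
  buc_fun :> nonnegreal -> X;
  buc_bounded : exists M : R, forall t, norm (buc_fun t) <= M;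
  buc_ucont : forall eps : posreal, exists delta : posreal,
    forall s t : nonnegreal, Rabs (s - t) < delta ->
      norm (minus (buc_fun s) (buc_fun t)) < eps }.

Lemma BUC_ext (f h : BUC) : (forall t, f t = h t) -> f = h.
Proof.
  destruct f as [f bf uf], h as [h bh uh]; simpl; intros H.
  assert (E : f = h) by (apply functional_extensionality; exact H).
  subst h; f_equal; apply proof_irrelevance.
Qed.

Definition BUC_zero : BUC.
Proof.
  exists (fun _ => zero).
  - exists 0; intros _; right; apply (norm_zero (V := X)).
  - intros eps; exists eps; intros s t _.
    rewrite minus_eq_zero.
    eapply Rle_lt_trans; [right; apply (norm_zero (V := X))|apply cond_pos].
Defined.

Definition BUC_plus (f h : BUC) : BUC.
Proof.
  exists (fun t => plus (f t) (h t)).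
  - destruct (buc_bounded f) as [M HM], (buc_bounded h) as [N HN].
    exists (M + N); intros t.
    eapply Rle_trans; [apply norm_triangle|].
    specialize (HM t); specialize (HN t); lra.
  - intros eps.
    destruct (buc_ucont f (pos_div_2 eps)) as [d Hd].
    destruct (buc_ucont h (pos_div_2 eps)) as [e He].
    exists (mkposreal _ (Rmin_stable_in_posreal d e)); simpl; intros s t Hst.
    specialize (Hd s t (Rlt_le_trans _ _ _ Hst (Rmin_l _ _))).
    specialize (He s t (Rlt_le_trans _ _ _ Hst (Rmin_r _ _))).
    simpl in Hd, He.
    rewrite minus_plus_plus.
    eapply Rle_lt_trans; [apply norm_triangle|].
    rewrite <- (Rplus_half_diag eps); apply Rplus_lt_compat; assumption.
Defined.

Definition BUC_scal (l : C) (f : BUC) : BUC.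
Proof.
  exists (fun t => scal l (f t)).
  - destruct (buc_bounded f) as [M HM].
    exists (Cmod l * M); intros t.
    eapply Rle_trans; [apply (norm_scal (K := C_AbsRing))|].
    apply Rmult_le_compat_l; [apply Cmod_ge_0|apply HM].
  - intros eps.
    assert (Hl : 0 < Cmod l + 1) by (pose proof (Cmod_ge_0 l); lra).
    destruct (buc_ucont f (mkposreal _ (Rdiv_lt_0_compat _ _ (cond_pos eps) Hl)))
      as [d Hd].
    exists d; intros s t Hst; specialize (Hd s t Hst); simpl in Hd.
    eapply Rle_lt_trans;
      [right; apply f_equal; symmetry; apply (scal_minus_distr_l (V := X))|].
    eapply Rle_lt_trans; [apply (norm_scal (K := C_AbsRing))|].
    apply (Rmult_lt_compat_l _ _ _ Hl) in Hd.
    replace ((Cmod l + 1) * (eps / (Cmod l + 1))) with (pos eps) in Hd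
      by (field; lra).
    refine (Rle_lt_trans _ _ _ _ Hd).
    apply Rmult_le_compat_r; [apply norm_ge_0|].
    change (Cmod l <= Cmod l + 1); lra.
Defined.

Definition BUC_opp (f : BUC) : BUC := BUC_scal (opp one) f.

Lemma BUC_plus_comm (f h : BUC) : BUC_plus f h = BUC_plus h f.
Proof. apply BUC_ext; intros t; apply plus_comm. Qed.
Lemma BUC_plus_assoc (f h k : BUC) :
  BUC_plus f (BUC_plus h k) = BUC_plus (BUC_plus f h) k.
Proof. apply BUC_ext; intros t; apply plus_assoc. Qed.
Lemma BUC_plus_zero_r (f : BUC) : BUC_plus f BUC_zero = f.
Proof. apply BUC_ext; intros t; apply plus_zero_r. Qed.
Lemma BUC_plus_opp_r (f : BUC) : BUC_plus f (BUC_opp f) = BUC_zero.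
Proof.
  apply BUC_ext; intros t; simpl.
  rewrite (scal_opp_one (K := C_Ring)); apply (plus_opp_r (G := X)).
Qed.
Lemma BUC_scal_assoc (x y : C) (f : BUC) :
  BUC_scal x (BUC_scal y f) = BUC_scal (mult x y) f.
Proof. apply BUC_ext; intros t; apply (scal_assoc (V := X)). Qed.
Lemma BUC_scal_one (f : BUC) : BUC_scal one f = f.
Proof. apply BUC_ext; intros t; apply (scal_one (V := X)). Qed.
Lemma BUC_scal_distr_l (x : C) (f h : BUC) :
  BUC_scal x (BUC_plus f h) = BUC_plus (BUC_scal x f) (BUC_scal x h).
Proof. apply BUC_ext; intros t; apply (scal_distr_l (V := X)). Qed.
Lemma BUC_scal_distr_r (x y : C) (f : BUC) :
  BUC_scal (plus x y) f = BUC_plus (BUC_scal x f) (BUC_scal y f).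
Proof. apply BUC_ext; intros t; apply (scal_distr_r (V := X)). Qed.

Definition BUC_AbelianMonoid_mixin :=
  AbelianMonoid.Mixin BUC BUC_plus BUC_zero BUC_plus_comm BUC_plus_assoc
    BUC_plus_zero_r.
Definition BUC_AbelianGroup_mixin :=
  AbelianGroup.Mixin (AbelianMonoid.Pack BUC BUC_AbelianMonoid_mixin BUC)
    BUC_opp BUC_plus_opp_r.
Definition BUC_AbelianGroup : AbelianGroup :=
  AbelianGroup.Pack BUC (AbelianGroup.Class BUC _ BUC_AbelianGroup_mixin) BUC.
Definition BUC_ModuleSpace_mixin :=
  ModuleSpace.Mixin C_Ring BUC_AbelianGroup BUC_scal BUC_scal_assoc BUC_scal_one
    BUC_scal_distr_l BUC_scal_distr_r.
Definition BUC_ModuleSpace : ModuleSpace C_AbsRing :=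
  ModuleSpace.Pack C_Ring BUC
    (ModuleSpace.Class C_Ring BUC _ BUC_ModuleSpace_mixin) BUC.

Definition sup_norm (f : BUC) : R :=
  real (Lub_Rbar (fun r => exists t, r = norm (f t))).

Lemma sup_norm_ub (f : BUC) (t : nonnegreal) : norm (f t) <= sup_norm f.
Proof.
  unfold sup_norm.
  destruct (Lub_Rbar_correct (fun r => exists t, r = norm (f t))) as [Hu Hl].
  destruct (buc_bounded f) as [M HM].
  assert (H1 : Rbar_le (norm (f t)) (Lub_Rbar (fun r => exists t, r = norm (f t))))
    by (apply Hu; exists t; reflexivity).
  assert (H2 : Rbar_le (Lub_Rbar (fun r => exists t, r = norm (f t))) M)
    by (apply Hl; intros r [s ->]; apply HM).
  destruct (Lub_Rbar _); simpl in *; tauto.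
Qed.

Lemma sup_norm_le (f : BUC) (M : R) :
  (forall t, norm (f t) <= M) -> sup_norm f <= M.
Proof.
  intros HM; pose proof (sup_norm_ub f (mknonnegreal 0 (Rle_refl 0))) as H0.
  unfold sup_norm in *.
  destruct (Lub_Rbar_correct (fun r => exists t, r = norm (f t))) as [Hu Hl].
  assert (H2 : Rbar_le (Lub_Rbar (fun r => exists t, r = norm (f t))) M)
    by (apply Hl; intros r [s ->]; apply HM).
  assert (H1 : Rbar_le (norm (f (mknonnegreal 0 (Rle_refl 0))))
      (Lub_Rbar (fun r => exists t, r = norm (f t))))
    by (apply Hu; eexists; reflexivity).
  destruct (Lub_Rbar _); simpl in *; tauto.
Qed.

Lemma sup_norm_triangle (f h : BUC_ModuleSpace) :
  sup_norm (plus f h) <= sup_norm f + sup_norm h.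
Proof.
  apply sup_norm_le; intros t.
  eapply Rle_trans; [apply norm_triangle|].
  apply Rplus_le_compat; apply sup_norm_ub.
Qed.

Lemma sup_norm_scal (l : C_AbsRing) (f : BUC_ModuleSpace) :
  sup_norm (scal l f) <= abs l * sup_norm f.
Proof.
  apply sup_norm_le; intros t.
  eapply Rle_trans; [apply (norm_scal (K := C_AbsRing))|].
  apply Rmult_le_compat_l; [apply abs_ge_0|apply sup_norm_ub].
Qed.

Lemma sup_norm_eq0 (f : BUC_ModuleSpace) : sup_norm f = 0 -> f = zero.
Proof.
  intros H; apply BUC_ext; intros t; apply norm_eq_zero.
  pose proof (sup_norm_ub f t); pose proof (norm_ge_0 (buc_fun f t)); lra.
Qed.

Definition BUC_NormedModule : NormedModule C_AbsRing :=
  NormedModule_of_norm sup_norm_triangle sup_norm_scal sup_norm_eq0.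

Definition C0 (f : BUC) : Prop := filterlim f at_infty (locally (zero : X)).

Lemma C0_eps (f : BUC) :
  C0 f <-> forall eps : posreal, at_infty (fun t => norm (f t) < eps).
Proof.
  split.
  - intros H eps; apply (H (fun x => norm x < eps)).
    apply locally_le_locally_norm; exists eps; intros y Hy.
    refine (Rle_lt_trans _ _ _ _ Hy).
    right; apply f_equal; symmetry; apply (minus_zero_r (G := X)).
  - intros H P HP; apply locally_norm_le_locally in HP.
    destruct HP as [eps HP], (H eps) as [M HM].
    exists M; intros t Ht; apply HP.
    refine (Rle_lt_trans _ _ _ _ (HM t Ht)).
    right; apply f_equal, (minus_zero_r (G := X)).
Qed.

End BUC.

Section Quotient.

Variables (K : AbsRing) (V : NormedModule K).

Record closed_submodule : Type := mkClosedSubmodule {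
  csm_in :> V -> Prop;
  csm_zero : csm_in zero;
  csm_plus : forall x y, csm_in x -> csm_in y -> csm_in (plus x y);
  csm_scal : forall (l : K) x, csm_in x -> csm_in (scal l x);
  csm_closed : closed csm_in }.

Variable W : closed_submodule.

Definition coset (v : V) : V -> Prop := fun u => W (minus u v).

Definition quot : Type := { S : V -> Prop | exists v : V, S = coset v }.

Definition qclass (v : V) : quot :=
  exist _ (coset v) (ex_intro _ v eq_refl).

Definition qrepr (y : quot) : V :=
  proj1_sig (constructive_indefinite_description _ (proj2_sig y)).

Lemma qreprK (y : quot) : qclass (qrepr y) = y.
Proof.
  unfold qrepr; destruct (constructive_indefinite_description _ _) as [v Hv].
  destruct y as [S HS]; simpl in *; subst S.
  unfold qclass; f_equal; apply proof_irrelevance.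
Qed.

Lemma csm_opp (x : V) : W x -> W (opp x).
Proof.
  intros H; apply (csm_scal (opp one)) in H.
  rewrite (scal_opp_one (V := V)) in H; exact H.
Qed.

Lemma qclass_eq (u v : V) : qclass u = qclass v <-> W (minus u v).
Proof.
  split.
  - intros H; assert (E : coset u = coset v) by exact (f_equal (@proj1_sig _ _) H).
    change (coset v u); rewrite <- E; unfold coset.
    rewrite minus_eq_zero; apply csm_zero.
  - intros H.
    assert (E : coset u = coset v).
    { apply functional_extensionality; intros z; apply propositional_extensionality.
      unfold coset; split; intros Hz.
      - rewrite (minus_trans u z v); apply csm_plus; assumption.
      - rewrite (minus_trans v z u); apply csm_plus; [assumption|].
        rewrite <- opp_minus; apply csm_opp, H. }
    unfold qclass; generalize (ex_intro (fun w => coset u = coset w) u eq_refl).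
    rewrite E; intros p; f_equal; apply proof_irrelevance.
Qed.

Definition quot_zero : quot := qclass zero.
Definition quot_plus (x y : quot) : quot := qclass (plus (qrepr x) (qrepr y)).
Definition quot_scal (l : K) (x : quot) : quot := qclass (scal l (qrepr x)).
Definition quot_opp (x : quot) : quot := quot_scal (opp one) x.

Lemma qrepr_class (v : V) : W (minus (qrepr (qclass v)) v).
Proof. apply qclass_eq, qreprK. Qed.

Lemma quot_plusE (u v : V) : quot_plus (qclass u) (qclass v) = qclass (plus u v).
Proof.
  apply qclass_eq.
  rewrite minus_plus_plus; apply csm_plus; apply qrepr_class.
Qed.

Lemma quot_scalE (l : K) (u : V) : quot_scal l (qclass u) = qclass (scal l u).
Proof.
  apply qclass_eq; rewrite <- (scal_minus_distr_l (V := V)).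
  apply csm_scal, qrepr_class.
Qed.

Lemma quot_ind (P : quot -> Prop) : (forall v, P (qclass v)) -> forall y, P y.
Proof. intros H y; rewrite <- (qreprK y); apply H. Qed.

Lemma quot_plus_comm (x y : quot) : quot_plus x y = quot_plus y x.
Proof. apply (f_equal qclass), plus_comm. Qed.
Lemma quot_plus_assoc (x y z : quot) :
  quot_plus x (quot_plus y z) = quot_plus (quot_plus x y) z.
Proof.
  revert x; apply quot_ind; intros u; revert y; apply quot_ind; intros v.
  revert z; apply quot_ind; intros w.
  rewrite !quot_plusE; apply (f_equal qclass), plus_assoc.
Qed.
Lemma quot_plus_zero_r (x : quot) : quot_plus x quot_zero = x.
Proof.
  revert x; apply quot_ind; intros u.
  unfold quot_zero; rewrite quot_plusE; apply (f_equal qclass), plus_zero_r.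
Qed.
Lemma quot_plus_opp_r (x : quot) : quot_plus x (quot_opp x) = quot_zero.
Proof.
  revert x; apply quot_ind; intros u; unfold quot_opp.
  rewrite quot_scalE, quot_plusE, (scal_opp_one (V := V)).
  apply (f_equal qclass), (plus_opp_r (G := V)).
Qed.
Lemma quot_scal_assoc (l m : K) (x : quot) :
  quot_scal l (quot_scal m x) = quot_scal (mult l m) x.
Proof.
  revert x; apply quot_ind; intros u; rewrite !quot_scalE.
  apply (f_equal qclass), (scal_assoc (V := V)).
Qed.
Lemma quot_scal_one (x : quot) : quot_scal one x = x.
Proof.
  revert x; apply quot_ind; intros u; rewrite quot_scalE.
  apply (f_equal qclass), (scal_one (V := V)).
Qed.
Lemma quot_scal_distr_l (l : K) (x y : quot) :
  quot_scal l (quot_plus x y) = quot_plus (quot_scal l x) (quot_scal l y).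
Proof.
  revert x; apply quot_ind; intros u; revert y; apply quot_ind; intros v.
  rewrite quot_plusE, !quot_scalE, quot_plusE.
  apply (f_equal qclass), (scal_distr_l (V := V)).
Qed.
Lemma quot_scal_distr_r (l m : K) (x : quot) :
  quot_scal (plus l m) x = quot_plus (quot_scal l x) (quot_scal m x).
Proof.
  revert x; apply quot_ind; intros u.
  rewrite !quot_scalE, quot_plusE.
  apply (f_equal qclass), (scal_distr_r (V := V)).
Qed.

Definition quot_AbelianMonoid_mixin :=
  AbelianMonoid.Mixin quot quot_plus quot_zero quot_plus_comm quot_plus_assoc
    quot_plus_zero_r.
Definition quot_AbelianGroup_mixin :=
  AbelianGroup.Mixin (AbelianMonoid.Pack quot quot_AbelianMonoid_mixin quot)
    quot_opp quot_plus_opp_r.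
Definition quot_AbelianGroup : AbelianGroup :=
  AbelianGroup.Pack quot (AbelianGroup.Class quot _ quot_AbelianGroup_mixin) quot.
Definition quot_ModuleSpace_mixin :=
  ModuleSpace.Mixin K quot_AbelianGroup quot_scal quot_scal_assoc quot_scal_one
    quot_scal_distr_l quot_scal_distr_r.
Definition quot_ModuleSpace : ModuleSpace K :=
  ModuleSpace.Pack K quot (ModuleSpace.Class K quot _ quot_ModuleSpace_mixin) quot.

Definition quot_norm (y : quot) : R :=
  real (Glb_Rbar (fun r => exists v, qclass v = y /\ r = norm v)).

Lemma quot_norm_glb (y : quot) :
  is_glb_Rbar (fun r => exists v, qclass v = y /\ r = norm v) (quot_norm y).
Proof.
  unfold quot_norm.
  pose proof (Glb_Rbar_correct (fun r => exists v, qclass v = y /\ r = norm v)) as H.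
  assert (H0 : Rbar_le 0 (Glb_Rbar (fun r => exists v, qclass v = y /\ r = norm v))).
  { apply H; intros r [v [_ ->]]; apply norm_ge_0. }
  assert (H1 : Rbar_le (Glb_Rbar (fun r => exists v, qclass v = y /\ r = norm v))
      (norm (qrepr y))).
  { apply H; exists (qrepr y); split; [apply qreprK|reflexivity]. }
  destruct (Glb_Rbar _); simpl in *; tauto.
Qed.

Lemma quot_norm_le (v : V) : quot_norm (qclass v) <= norm v.
Proof. apply (proj1 (quot_norm_glb (qclass v))); exists v; auto. Qed.

Lemma quot_norm_ge0 (y : quot) : 0 <= quot_norm y.
Proof.
  apply (proj2 (quot_norm_glb y) (Finite 0)); intros r [v [_ ->]]; apply norm_ge_0.
Qed.

Lemma quot_norm_approx (y : quot) (eps : R) :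
  0 < eps -> exists v, qclass v = y /\ norm v < quot_norm y + eps.
Proof.
  intros He; apply NNPP; intros Hn.
  assert (Rbar_le (Finite (quot_norm y + eps)) (quot_norm y)).
  { apply (proj2 (quot_norm_glb y)); intros r [v [Hv ->]]; simpl.
    apply Rnot_lt_le; intros Hlt; apply Hn; exists v; auto. }
  simpl in *; lra.
Qed.

Lemma quot_norm_triangle (x y : quot_ModuleSpace) :
  quot_norm (plus x y) <= quot_norm x + quot_norm y.
Proof.
  apply le_epsilon; intros eps He.
  assert (He2 : 0 < eps / 2) by lra.
  destruct (quot_norm_approx x He2) as [u [Hu Hu']].
  destruct (quot_norm_approx y He2) as [v [Hv Hv']].
  change (plus x y) with (quot_plus x y).
  rewrite <- Hu, <- Hv at 1; rewrite quot_plusE.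
  pose proof (quot_norm_le (plus u v)); pose proof (norm_triangle u v); lra.
Qed.

Lemma quot_norm_scal (l : K) (x : quot_ModuleSpace) :
  quot_norm (scal l x) <= abs l * quot_norm x.
Proof.
  apply le_epsilon; intros eps He.
  pose proof (abs_ge_0 l) as Hl.
  assert (Hl1 : 0 < abs l + 1) by lra.
  destruct (quot_norm_approx x (Rdiv_lt_0_compat _ _ He Hl1)) as [u [Hu Hu']].
  change (scal l x) with (quot_scal l x).
  rewrite <- Hu at 1; rewrite quot_scalE.
  pose proof (quot_norm_le (scal l u)); pose proof (norm_scal l u).
  assert (abs l * norm u <= abs l * (quot_norm x + eps / (abs l + 1)))
    by (apply Rmult_le_compat_l; lra).
  assert (abs l * (eps / (abs l + 1)) <= eps).
  { assert (0 < eps / (abs l + 1)) by (apply Rdiv_lt_0_compat; lra).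
    replace eps with ((abs l + 1) * (eps / (abs l + 1))) at 2 by (field; lra).
    apply Rmult_le_compat_r; lra. }
  rewrite Rmult_plus_distr_l in *; lra.
Qed.

Lemma quot_norm_eq0 (x : quot_ModuleSpace) : quot_norm x = 0 -> x = zero.
Proof.
  rewrite <- (qreprK x); set (v := qrepr x); intros H.
  change (qclass v = qclass zero); apply qclass_eq; rewrite (minus_zero_r (G := V)).
  apply (csm_closed (c := W)); intros Hloc.
  apply locally_norm_le_locally in Hloc; destruct Hloc as [eps Heps].
  destruct (quot_norm_approx (qclass v) (cond_pos eps)) as [u [Hu Hu']].
  apply (Heps (minus v u)).
  - unfold ball_norm.
    rewrite minus_minus_l, norm_opp; rewrite H in Hu'; lra.
  - apply qclass_eq; symmetry; exact Hu.
Qed.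

Definition quot_NormedModule : NormedModule K :=
  NormedModule_of_norm quot_norm_triangle quot_norm_scal quot_norm_eq0.

End Quotient.

Section Spectrum.

Variable X : NormedModule C_AbsRing.

Lemma C0_zero : C0 (BUC_zero X).
Proof.
  apply C0_eps; intros eps; exists 0; intros t _; simpl.
  eapply Rle_lt_trans; [right; apply (norm_zero (V := X))|apply cond_pos].
Qed.

Lemma C0_plus (f h : BUC X) : C0 f -> C0 h -> C0 (BUC_plus f h).
Proof.
  intros Hf Hh; apply C0_eps; intros eps.
  destruct (proj1 (C0_eps f) Hf (pos_div_2 eps)) as [M HM].
  destruct (proj1 (C0_eps h) Hh (pos_div_2 eps)) as [N HN].
  exists (Rmax M N); intros t Ht; simpl in *.
  specialize (HM t (Rle_lt_trans _ _ _ (Rmax_l M N) Ht)).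
  specialize (HN t (Rle_lt_trans _ _ _ (Rmax_r M N) Ht)).
  eapply Rle_lt_trans; [apply norm_triangle|]; lra.
Qed.

Lemma C0_scal (l : C) (f : BUC X) : C0 f -> C0 (BUC_scal l f).
Proof.
  intros Hf; apply C0_eps; intros eps.
  assert (Hl : 0 < Cmod l + 1) by (pose proof (Cmod_ge_0 l); lra).
  destruct (proj1 (C0_eps f) Hf
    (mkposreal _ (Rdiv_lt_0_compat _ _ (cond_pos eps) Hl))) as [M HM].
  exists M; intros t Ht; specialize (HM t Ht); simpl in *.
  eapply Rle_lt_trans; [apply (norm_scal (K := C_AbsRing))|].
  apply (Rmult_lt_compat_l _ _ _ Hl) in HM.
  replace ((Cmod l + 1) * (eps / (Cmod l + 1))) with (pos eps) in HM
    by (field; lra).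
  refine (Rle_lt_trans _ _ _ _ HM).
  apply Rmult_le_compat_r; [apply norm_ge_0|].
  change (Cmod l <= Cmod l + 1); lra.
Qed.

Lemma C0_closed : closed (T := BUC_NormedModule X) (@C0 X).
Proof.
  intros f Hf; apply C0_eps; intros eps.
  apply NNPP; intros Hn; apply Hf.
  exists (pos_div_2 eps); intros h Hh HC; apply Hn.
  destruct (proj1 (C0_eps h) HC (pos_div_2 eps)) as [M HM].
  exists M; intros t Ht; specialize (HM t Ht).
  change (sup_norm (minus (G := BUC_NormedModule X) h f) < eps / 2) in Hh.
  pose proof (sup_norm_ub (minus (G := BUC_NormedModule X) h f) t) as Hs.
  change (norm (plus (h t) (scal (opp one : C_AbsRing) (f t)))
    <= sup_norm (minus (G := BUC_NormedModule X) h f)) in Hs.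
  rewrite (scal_opp_one (K := C_Ring)) in Hs.
  change (norm (minus (h t) (f t))
    <= sup_norm (minus (G := BUC_NormedModule X) h f)) in Hs.
  rewrite <- (minus_minus (h t) (f t)).
  unfold minus at 1; eapply Rle_lt_trans; [apply norm_triangle|].
  rewrite norm_opp; simpl in HM; lra.
Qed.

Definition C0_submodule : closed_submodule (BUC_NormedModule X) :=
  @mkClosedSubmodule C_AbsRing (BUC_NormedModule X) (@C0 X)
    C0_zero C0_plus C0_scal C0_closed.

Definition Y : NormedModule C_AbsRing := quot_NormedModule C0_submodule.

Definition tilde (f : BUC X) : Y := qclass C0_submodule f.

(* [f' t = h t] for every [t >= 0], as a real derivative (one-sided at [0]);
   hence [f] is in the domain of d/dt iff [exists h, is_D f h]. *)
Definition is_D (f h : BUC X) : Prop :=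
  forall t : nonnegreal,
    filterlim
      (fun s : nonnegreal => scal (RtoC (/ (s - t))) (minus (f s) (f t)))
      (nn_locally' t)
      (locally (h t)).

Definition is_Dtilde (y z : Y) : Prop :=
  exists u v : BUC X, tilde u = y /\ is_D u v /\ tilde v = z.

(* For [Re l <> 0] the operator [l - Dtilde] is a bijection from its domain
   onto [Y], so that the element chosen here is the unique one. *)
Definition resolvent (l : C) (y : Y) : Y :=
  epsilon (inhabits zero)
    (fun x => exists z, is_Dtilde x z /\ minus (scal l x) z = y).

(* Only meaningful off the imaginary axis. *)
Definition hat (g : BUC X) (l : C) : Y := resolvent l (tilde g).

End Spectrum.

Definition analytic_at (V : NormedModule C_AbsRing) (f : C -> V) (z0 : C) : Prop :=
  exists a : nat -> V,
    locally z0 (fun z => is_pseries (K := C_AbsRing) a (Cminus z z0) (f z)).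

Definition iaxis (xi : R) : C := (0, xi).

Definition extends_hat (X : NormedModule C_AbsRing) (g : BUC X)
    (U : C -> Prop) (G : C -> Y X) : Prop :=
  (forall z, U z -> analytic_at G z) /\
  (forall z, U z -> Re z <> 0 -> G z = hat g z).

Definition sp (X : NormedModule C_AbsRing) (g : BUC X) (xi0 : R) : Prop :=
  ~ exists (U : C -> Prop) (G : C -> Y X),
      open U /\ U (iaxis xi0) /\ extends_hat g U G.

Definition isolated_point (S : R -> Prop) (x : R) : Prop :=
  S x /\ locally' x (fun y => ~ S y).

Section Singularities.

Variables (V : NormedModule C_AbsRing) (f : C -> V) (z0 : C).

Definition removable_singularity : Prop :=
  exists h : C -> V, analytic_at h z0 /\ locally' z0 (fun z => f z = h z).

Definition pole_of_order (n : nat) : Prop :=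
  (1 <= n)%nat /\
  exists h : C -> V, analytic_at h z0 /\ h z0 <> zero /\
    locally' z0
      (fun z => f z = scal (pow_n (Cinv (Cminus z z0) : C_AbsRing) n) (h z)).

End Singularities.

Definition nn_add1 (t : nonnegreal) : nonnegreal :=
  mknonnegreal (t + 1) (Rplus_le_le_0_compat _ _ (cond_nonneg t) Rle_0_1).

(* [(cos p, sin p)] is [e^{ip}]. *)
Definition asymptotic_bloch1 (X : NormedModule C_AbsRing) (g : BUC X) (p : R) : Prop :=
  filterlim
    (fun t => minus (g (nn_add1 t)) (scal ((cos p, sin p) : C_AbsRing) (g t)))
    at_infty (locally (zero : X)).

(* Main.v *)
(* On [Y] the operator [Dtilde] generates a group of isometries (the translations),
   whence [|hat g (l)| <= |g| / |Re l|].  If [hat g] is holomorphic in a punctured disc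
   around [c = i xi], let [Q_n] be its Laurent coefficients.  Testing the bound on
   circles of radius [s] against the weight [zeta^2 + s^2 = 2 zeta Re zeta] gives
   [Q_{-2} = 0] and [s |Q_0| <= 2 |g|].  Integrating the resolvent equation over a
   circle gives [(c - Dtilde) Q_n = - Q_{n-1}] for [n <> 0] and
   [(c - Dtilde) Q_0 = g - Q_{-1}]; so [Q_{-1}] is an eigenvector, the terms of order
   [n >= 0] sum up to a solution of the resolvent equation for [g - Q_{-1}], and by
   uniqueness of its solution off the axis [hat g] has at most a simple pole at [c].
   If there is no singularity at all, [s] can be taken arbitrarily large, which forces
   [g = 0] in [Y].  For the Bloch characterization, [A = T(1) - e^{ip}] annihilates the
   residues at [i (p + 2 pi k)], so [A g] has no singularity if [sp g] is contained in
   [p + 2 pi Z]; conversely, on the kernel of [A] the operator [i xi - Dtilde] has an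
   explicit bounded inverse for [e^{i xi} <> e^{ip}]. *)

Require Import Defs.
From Stdlib Require Import Reals ZArith Lra Lia List.
From Stdlib Require Import ClassicalEpsilon FunctionalExtensionality.
From Stdlib Require Import PropExtensionality ProofIrrelevance.
From Coquelicot Require Import Coquelicot.
Open Scope R_scope.

(** * Linear combinations over the complex numbers *)

(** The operator Dtilde is never handled with its domain. Through the bounded operator [R1] = (1 -
    Dtilde)^{-1} the equation (l - Dtilde) x = y becomes x = R1 (y + (1 - l) x), which is stable
    under limits, sums and integrals. Holomorphy at c is likewise replaced by [Reg]: a chain x_n =
    (c - Dtilde)^{-n-1} g with geometric bounds, whose Neumann series solves the equation near c.
    Every bounded operator commuting with Dtilde maps such chains to such chains. Only Laurent
    coefficients are computed, and Cauchy's integral formula is avoided: independence of the radius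
    comes from Goursat's theorem on a rectangle in the coordinate log zeta. Since [sp] leaves the
    extension free on the axis, a canonical continuation is fixed there by the right limits of hat g
    (z + a) as a decreases to 0. *)

Section LinearCombination.

Variable V : ModuleSpace C_Ring.

(** Syntax for proof by reflection of identities in a complex module. Scalars remain arbitrary terms
    of [C], so that the resulting goals about coefficients can be left to [ring] or [field]. *)
Inductive vexpr : Type :=
| VVar (n : nat)
| VZero
| VPlus (a b : vexpr)
| VOpp (a : vexpr)
| VScal (c : C) (a : vexpr).

Fixpoint vdenote (l : list V) (e : vexpr) : V :=
  match e with
  | VVar n => nth n l zero
  | VZero => zero
  | VPlus a b => plus (vdenote l a) (vdenote l b)
  | VOpp a => opp (vdenote l a)
  | VScal c a => scal c (vdenote l a)
  end.

Fixpoint vcoef (e : vexpr) (i : nat) : C :=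
  match e with
  | VVar n => if Nat.eqb n i then RtoC 1 else RtoC 0
  | VZero => RtoC 0
  | VPlus a b => Cplus (vcoef a i) (vcoef b i)
  | VOpp a => Copp (vcoef a i)
  | VScal c a => Cmult c (vcoef a i)
  end.

Fixpoint lincomb (f : nat -> C) (l : list V) : V :=
  match l with
  | nil => zero
  | v :: l' => plus (scal (f 0%nat) v) (lincomb (fun n => f (S n)) l')
  end.

(** Recursion on the list of atoms makes this compute to a finite conjunction, one scalar equation
    per atom. *)
Fixpoint coef_eq (f h : nat -> C) (l : list V) : Prop :=
  match l with
  | nil => True
  | _ :: l' => f 0%nat = h 0%nat /\ coef_eq (fun n => f (S n)) (fun n => h (S n)) l'
  end.

Lemma lincomb_ext (l : list V) (f h : nat -> C) :
  coef_eq f h l -> lincomb f l = lincomb h l.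
Proof.
  revert f h; induction l as [|v l IH]; intros f h; simpl; auto.
  intros [H1 H2]; rewrite H1; f_equal; auto.
Qed.

Lemma lincomb_zero (l : list V) : lincomb (fun _ => RtoC 0) l = zero.
Proof.
  induction l as [|v l IH]; simpl; auto.
  rewrite IH, plus_zero_r; apply (scal_zero_l v).
Qed.

Lemma lincomb_plus (l : list V) (f h : nat -> C) :
  lincomb (fun n => Cplus (f n) (h n)) l = plus (lincomb f l) (lincomb h l).
Proof.
  revert f h; induction l as [|v l IH]; intros f h; simpl.
  - rewrite plus_zero_r; reflexivity.
  - rewrite IH, (scal_distr_r (f 0%nat) (h 0%nat) v : scal (Cplus _ _) v = _).
    rewrite <- !plus_assoc; f_equal; rewrite !plus_assoc; f_equal; apply plus_comm.
Qed.

Lemma lincomb_scal (l : list V) (c : C) (f : nat -> C) :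
  lincomb (fun n => Cmult c (f n)) l = scal c (lincomb f l).
Proof.
  revert f; induction l as [|v l IH]; intros f; simpl.
  - rewrite scal_zero_r; reflexivity.
  - rewrite IH, scal_distr_l, scal_assoc; reflexivity.
Qed.

Lemma lincomb_opp (l : list V) (f : nat -> C) :
  lincomb (fun n => Copp (f n)) l = opp (lincomb f l).
Proof.
  rewrite <- (scal_opp_one (lincomb f l)), <- lincomb_scal.
  apply lincomb_ext.
  assert (H : forall n, Copp (f n) = Cmult (opp one : C_Ring) (f n)).
  { intros n; change (opp one : C_Ring) with (Copp (RtoC 1)); ring. }
  revert f H; induction l as [|v l IH]; intros f H; simpl; auto.
Qed.

Lemma vdenote_lincomb (l : list V) (e : vexpr) :
  vdenote l e = lincomb (vcoef e) l.
Proof.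
  induction e as [n| |a IHa b IHb|a IHa|c a IHa]; simpl.
  - revert n; induction l as [|v l IH]; intros [|n]; simpl; auto.
    + rewrite lincomb_zero, plus_zero_r; symmetry; apply (scal_one v).
    + rewrite IH, (scal_zero_l v : scal (RtoC 0) v = _), plus_zero_l.
      reflexivity.
  - symmetry; apply lincomb_zero.
  - rewrite IHa, IHb, lincomb_plus; reflexivity.
  - rewrite IHa, lincomb_opp; reflexivity.
  - rewrite IHa, lincomb_scal; reflexivity.
Qed.

Lemma vdenote_eq (l : list V) (e1 e2 : vexpr) :
  coef_eq (vcoef e1) (vcoef e2) l -> vdenote l e1 = vdenote l e2.
Proof. intros H; rewrite !vdenote_lincomb; apply lincomb_ext, H. Qed.

End LinearCombination.

(** Atoms are compared by unification rather than syntactically, so that convertible forms of one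
    vector share an index. The dummy [match] runs [unify] while a term is being computed and
    backtracks on failure. *)
Ltac vmem x l :=
  match l with
  | nil => constr:(false)
  | ?y :: ?l' => match constr:(Set) with
                 | _ => let _ := match constr:(Set) with _ => unify x y end in constr:(true)
                 | _ => vmem x l'
                 end
  end.
Ltac vatoms t l :=
  lazymatch t with
  | @plus _ ?a ?b => let l1 := vatoms a l in vatoms b l1
  | @minus _ ?a ?b => let l1 := vatoms a l in vatoms b l1
  | @opp _ ?a => vatoms a l
  | @scal _ _ _ ?a => vatoms a l
  | @zero _ => l
  | _ => lazymatch vmem t l with true => l | false => constr:(cons t l) end
  end.
Ltac vindex x l :=
  match l with
  | ?y :: ?l' => match constr:(Set) with
                 | _ => let _ := match constr:(Set) with _ => unify x y end in constr:(O)
                 | _ => let n := vindex x l' in constr:(S n)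
                 end
  end.
Ltac vreify t l :=
  lazymatch t with
  | @plus _ ?a ?b => let x := vreify a l in let y := vreify b l in constr:(VPlus x y)
  | @minus _ ?a ?b =>
      let x := vreify a l in let y := vreify b l in constr:(VPlus x (VOpp y))
  | @opp _ ?a => let x := vreify a l in constr:(VOpp x)
  | @scal _ _ ?c ?a => let x := vreify a l in constr:(VScal c x)
  | @zero _ => constr:(VZero)
  | _ => let n := vindex t l in constr:(VVar n)
  end.
(** Coefficients may mention the ring operations of an abstract structure; they are restored to the
    operations of [C] that [ring] and [field] recognize. *)
Ltac cunfold :=
  repeat match goal with
  | |- context [@plus ?G ?a ?b] => change (@plus G a b) with (Cplus a b)
  | |- context [@minus ?G ?a ?b] => change (@minus G a b) with (Cminus a b)
  | |- context [@opp ?G ?a] => change (@opp G a) with (Copp a)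
  | |- context [@mult ?G ?a ?b] => change (@mult G a b) with (Cmult a b)
  | |- context [@scal ?K ?G ?a ?b] => change (@scal K G a b) with (Cmult a b)
  | |- context [@one ?G] => change (@one G) with (RtoC 1)
  | |- context [@zero ?G] => change (@zero G) with (RtoC 0)
  end.
(* Reduces an equation between linear combinations of vectors to the equality
   of the coefficients of each atom. *)
Ltac vreduce V :=
  match goal with
  | |- ?a = ?b =>
      let l0 := constr:(@nil (ModuleSpace.sort C_Ring V)) in
      let l1 := vatoms a l0 in let l := vatoms b l1 in
      let ea := vreify a l in let eb := vreify b l in
      change (vdenote V l ea = vdenote V l eb); apply (vdenote_eq V l);
      cbv [coef_eq vcoef Nat.eqb]; repeat split; cunfold
  end.
Ltac vring V := vreduce V; ring.

(** * Norm estimates and neighbourhoods in complex normed modules *)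

Section Basics.

Variable V : NormedModule C_AbsRing.

(** The axioms give only one inequality; the other follows by applying it to the inverse scalar. *)
Lemma norm_scalC (a : C) (x : V) : norm (scal a x) = Cmod a * norm x.
Proof.
  apply Rle_antisym; [apply (norm_scal (K := C_AbsRing))|].
  destruct (Ceq_dec a 0) as [->|Ha].
  - rewrite Cmod_0, Rmult_0_l; apply norm_ge_0.
  - assert (E : scal (Cinv a) (scal a x) = x).
    { vreduce V; field; exact Ha. }
    assert (H : norm x <= Cmod (/ a) * norm (scal a x)).
    { rewrite <- E at 1; apply (norm_scal (K := C_AbsRing)). }
    rewrite Cmod_inv in H by exact Ha.
    assert (0 < Cmod a) by (apply Cmod_gt_0; exact Ha).
    apply (Rmult_le_compat_l (Cmod a)) in H; [|lra].
    rewrite <- Rmult_assoc, Rinv_r, Rmult_1_l in H; lra.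
Qed.

Lemma norm_eq_le (x y : V) (M : R) : x = y -> norm y <= M -> norm x <= M.
Proof. intros ->; auto. Qed.

Lemma norm_eq_lt (x y : V) (M : R) : x = y -> norm y < M -> norm x < M.
Proof. intros ->; auto. Qed.

Lemma norm_zero_eq (x : V) : x = zero -> norm x = 0.
Proof. intros ->; apply (norm_zero (V := V)). Qed.

Lemma norm_plus_le (x y : V) (M N : R) :
  norm x <= M -> norm y <= N -> norm (plus x y) <= M + N.
Proof.
  intros H1 H2; eapply Rle_trans; [apply norm_triangle|]; lra.
Qed.

Lemma norm_scal_le (a : C) (x : V) (M N : R) :
  Cmod a <= M -> norm x <= N -> norm (scal a x) <= M * N.
Proof.
  intros H1 H2; rewrite norm_scalC.
  apply Rmult_le_compat; auto using Cmod_ge_0; apply norm_ge_0.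
Qed.

Lemma norm_minus_sym (x y : V) : norm (minus x y) = norm (minus y x).
Proof. rewrite <- norm_opp, opp_minus; reflexivity. Qed.

Lemma norm_minus_triangle (x y z : V) :
  norm (minus x z) <= norm (minus x y) + norm (minus y z).
Proof.
  replace (minus x z) with (plus (minus x y) (minus y z)) by (vring V).
  apply norm_triangle.
Qed.

Lemma norm_minus_le (x y : V) : norm (minus x y) <= norm x + norm y.
Proof.
  unfold minus; eapply Rle_trans; [apply norm_triangle|]; rewrite norm_opp; lra.
Qed.

Lemma norm_le_minus (x y : V) : norm x <= norm (minus x y) + norm y.
Proof.
  replace x with (plus (minus x y) y) at 1 by (vring V); apply norm_triangle.
Qed.

Lemma norm_small_zero (x : V) : (forall e, 0 < e -> norm x <= e) -> x = zero.
Proof.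
  intros H; apply norm_eq_zero, Rle_antisym; [|apply norm_ge_0].
  apply le_epsilon; intros e He; specialize (H e He); lra.
Qed.

Lemma minus_zero_eq (x y : V) : minus x y = zero -> x = y.
Proof.
  intros H; replace x with (plus (minus x y) y) by (vring V).
  rewrite H; apply plus_zero_l.
Qed.

Lemma locally_norm_iff (x : V) (P : V -> Prop) :
  locally x P <-> exists e, 0 < e /\ forall y, norm (minus y x) < e -> P y.
Proof.
  split.
  - intros H; apply locally_norm_le_locally in H; destruct H as [e He].
    exists e; split; [apply cond_pos|exact He].
  - intros [e [He H]]; apply locally_le_locally_norm.
    exists (mkposreal e He); exact H.
Qed.

Lemma filterlim_norm_iff (T : Type) (F : (T -> Prop) -> Prop) {FF : Filter F}
    (f : T -> V) (l : V) :
  filterlim f F (locally l) <->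
  forall e, 0 < e -> F (fun t => norm (minus (f t) l) < e).
Proof.
  rewrite filterlim_locally_ball_norm; split.
  - intros H e He; exact (H (mkposreal e He)).
  - intros H e; exact (H e (cond_pos e)).
Qed.

Lemma locally_Cmod (z : C) (P : C -> Prop) :
  locally z P <-> exists e, 0 < e /\ forall w, Cmod (w - z) < e -> P w.
Proof.
  split.
  - intros H; apply locally_C in H; destruct H as [e He].
    exists e; split; [apply cond_pos|]; intros w Hw; apply He, Hw.
  - intros [e [He H]]; apply locally_C; exists (mkposreal e He); exact H.
Qed.

End Basics.

(** * Restriction of scalars from the complex to the real numbers *)

Section RestrictScalars.

Variable V : NormedModule C_AbsRing.

Definition rscal (r : R) (v : V) : V := scal (RtoC r) v.

Lemma rscal_assoc (x y : R) (u : V) : rscal x (rscal y u) = rscal (Rmult x y) u.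
Proof. unfold rscal; rewrite RtoC_mult; apply (scal_assoc (V := V)). Qed.
Lemma rscal_one (u : V) : rscal 1 u = u.
Proof. apply (scal_one (V := V)). Qed.
Lemma rscal_distr_l (x : R) (u v : V) :
  rscal x (plus u v) = plus (rscal x u) (rscal x v).
Proof. apply (scal_distr_l (V := V)). Qed.
Lemma rscal_distr_r (x y : R) (u : V) :
  rscal (Rplus x y) u = plus (rscal x u) (rscal y u).
Proof. unfold rscal; rewrite RtoC_plus; apply (scal_distr_r (V := V)). Qed.

Definition RS_ModuleSpace : ModuleSpace R_Ring :=
  ModuleSpace.Pack R_Ring V (ModuleSpace.Class R_Ring V (AbelianGroup.class V)
    (ModuleSpace.Mixin R_Ring V rscal rscal_assoc rscal_one rscal_distr_l
       rscal_distr_r)) V.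

Definition RSaux : NormedModuleAux R_AbsRing :=
  NormedModuleAux.Pack R_AbsRing V
    (NormedModuleAux.Class R_AbsRing V (ModuleSpace.class R_Ring RS_ModuleSpace)
      (UniformSpace.class V)) V.

Lemma rscal_norm (l : R) (x : V) : norm (rscal l x) <= Rabs l * norm x.
Proof. unfold rscal; rewrite norm_scalC, Cmod_R; lra. Qed.

(** Carrier, group, balls and norm are those of [V], so statements over [V] and over [RSN] can be
    exchanged by conversion. This gives access to derivatives and Riemann integrals along a real
    parameter. *)
Definition RSN : NormedModule R_AbsRing :=
  NormedModule.Pack R_AbsRing V
    (NormedModule.Class R_AbsRing V (NormedModuleAux.class R_AbsRing RSaux)
      (NormedModule.Mixin R_AbsRing RSaux (@norm C_AbsRing V)
        (@norm_factor C_AbsRing V) (@norm_triangle C_AbsRing V) rscal_norm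
        (@norm_compat1 C_AbsRing V) (@norm_compat2 C_AbsRing V)
        (@norm_eq_zero C_AbsRing V))) V.

(** The complete variant, on which the integral exists as a function. Completeness is a separate
    argument because the quotient space is built as a plain normed module and shown complete
    afterwards. *)
Definition RS (cV : CompleteSpace.mixin_of V) : CompleteNormedModule R_AbsRing :=
  CompleteNormedModule.Pack R_AbsRing V
    (CompleteNormedModule.Class R_AbsRing V (NormedModule.class R_AbsRing RSN) cV) V.

Lemma RS_scal (r : R) (v : V) : @scal R_Ring RSN r v = scal (RtoC r) v.
Proof. reflexivity. Qed.

End RestrictScalars.

(** * The complex exponential and functions of a real variable *)

Lemma Cmod_le_abs (z : C) : Cmod z <= Rabs (Re z) + Rabs (Im z).
Proof.
  destruct z as [x y]; unfold Cmod; simpl fst; simpl snd; unfold Re, Im; simpl fst; simpl snd.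
  pose proof (Rabs_pos x); pose proof (Rabs_pos y).
  rewrite <- (sqrt_Rsqr (Rabs x + Rabs y)) by lra.
  apply sqrt_le_1_alt; unfold Rsqr.
  pose proof (Rsqr_abs x) as Hx; pose proof (Rsqr_abs y) as Hy.
  unfold Rsqr in Hx, Hy; simpl; nra.
Qed.

Lemma Im_le_Cmod (z : C) : Rabs (Im z) <= Cmod z.
Proof. eapply Rle_trans; [apply Rmax_r|apply Rmax_Cmod]. Qed.

Lemma Cmod_minus_sym (z w : C) : Cmod (z - w) = Cmod (w - z).
Proof. rewrite <- Cmod_opp; f_equal; ring. Qed.

Definition cexp (z : C) : C := (exp (Re z) * cos (Im z), exp (Re z) * sin (Im z)).

Lemma cexp_plus (z w : C) : cexp (z + w) = (cexp z * cexp w)%C.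
Proof.
  destruct z as [x y], w as [u v]; unfold cexp, Cmult, Cplus, Re, Im; simpl.
  rewrite exp_plus, cos_plus, sin_plus; f_equal; ring.
Qed.

Lemma cexp_0 : cexp 0 = 1.
Proof. unfold cexp; simpl; rewrite exp_0, cos_0, sin_0; unfold RtoC; f_equal; ring. Qed.

Lemma Cmod_cexp (z : C) : Cmod (cexp z) = exp (Re z).
Proof.
  unfold cexp, Cmod; simpl.
  replace (exp (Re z) * cos (Im z) * (exp (Re z) * cos (Im z) * 1) +
    exp (Re z) * sin (Im z) * (exp (Re z) * sin (Im z) * 1))
    with (exp (Re z) * exp (Re z) * (Rsqr (sin (Im z)) + Rsqr (cos (Im z))))
    by (unfold Rsqr; ring).
  rewrite sin2_cos2, Rmult_1_r; apply sqrt_square, Rlt_le, exp_pos.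
Qed.

Lemma cexp_neq_0 (z : C) : cexp z <> 0.
Proof. apply Cmod_gt_0; rewrite Cmod_cexp; apply exp_pos. Qed.

Lemma cexp_opp (z : C) : cexp (- z) = (/ cexp z)%C.
Proof.
  assert (H : (cexp (- z) * cexp z)%C = 1).
  { rewrite <- cexp_plus, <- cexp_0; f_equal; ring. }
  pose proof (cexp_neq_0 z) as Hz.
  replace (cexp (- z)) with (cexp (- z) * cexp z * / cexp z)%C by (field; exact Hz).
  rewrite H; ring.
Qed.

Lemma derive_small (f : R -> R) (x l : R) : is_derive f x l ->
  forall e, 0 < e -> exists d, 0 < d /\ forall y, Rabs (y - x) < d ->
    Rabs (f y - f x - (y - x) * l) <= e * Rabs (y - x).
Proof.
  intros [_ H] e He.
  destruct (H x (fun P h => h) (mkposreal e He)) as [d Hd].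
  exists d; split; [apply cond_pos|]; intros y Hy; apply Hd, Hy.
Qed.

Lemma cexp_small (e : R) : 0 < e -> exists d, 0 < d /\ forall z, Cmod z < d ->
  Cmod (cexp z - 1 - z) <= e * Cmod z.
Proof.
  (* With |exp x| <= 3 the errors of exp, cos and sin, each of relative size k, add up to at most k
     |x| + (3 + 3 + 2) k |y|, whence the 9. *)
  intros He; set (k := Rmin 1 (e / 9)).
  assert (Hk : 0 < k) by (apply Rmin_pos; lra).
  assert (Hk1 : k <= 1) by apply Rmin_l; assert (Hk2 : k <= e / 9) by apply Rmin_r.
  destruct (derive_small _ _ _ (is_derive_exp 0) k Hk) as [d1 [Hd1 H1]].
  destruct (derive_small _ _ _ (is_derive_cos 0) k Hk) as [d2 [Hd2 H2]].
  destruct (derive_small _ _ _ (is_derive_sin 0) k Hk) as [d3 [Hd3 H3]].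
  exists (Rmin (Rmin d1 k) (Rmin d2 d3)); split.
  { repeat apply Rmin_pos; lra. }
  intros [x y] Hz.
  pose proof (re_le_Cmod (x, y)) as Hx; pose proof (Im_le_Cmod (x, y)) as Hy.
  unfold Re, Im in Hx, Hy; simpl in Hx, Hy.
  pose proof (Rmin_l (Rmin d1 k) (Rmin d2 d3)); pose proof (Rmin_r (Rmin d1 k) (Rmin d2 d3)).
  pose proof (Rmin_l d1 k); pose proof (Rmin_r d1 k).
  pose proof (Rmin_l d2 d3); pose proof (Rmin_r d2 d3).
  specialize (H1 x); specialize (H2 y); specialize (H3 y).
  rewrite Rminus_0_r in H1, H2, H3; rewrite exp_0 in H1; rewrite cos_0, sin_0 in H2, H3.
  specialize (H1 ltac:(lra)); specialize (H2 ltac:(lra)); specialize (H3 ltac:(lra)).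
  assert (Hexp : Rabs (exp x) <= 3).
  { rewrite Rabs_pos_eq by (left; apply exp_pos).
    eapply Rle_trans; [|apply exp_le_3]; left; apply exp_increasing.
    pose proof (Rle_abs x); lra. }
  replace (x * 1) with x in H1 by ring; replace (y * -0) with 0 in H2 by ring.
  replace (y * 1) with y in H3 by ring.
  eapply Rle_trans; [apply Cmod_le_abs|]; unfold cexp, Re, Im; simpl.
  pose proof (Rabs_pos x) as Px; pose proof (Rabs_pos y) as Py.
  assert (A : Rabs (exp x * cos y + - (1) + - x) <= k * Rabs x + 3 * (k * Rabs y)).
  { replace (exp x * cos y + - (1) + - x) with ((exp x - 1 - x) + exp x * (cos y - 1 - 0))
      by ring.
    eapply Rle_trans; [apply Rabs_triang|]; rewrite Rabs_mult.
    apply Rplus_le_compat; [exact H1|].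
    apply Rmult_le_compat; auto using Rabs_pos. }
  assert (B : Rabs (exp x * sin y + - 0 + - y) <= 3 * (k * Rabs y) + 2 * k * Rabs y).
  { replace (exp x * sin y + - 0 + - y)
      with (exp x * (sin y - 0 - y) + (exp x - 1 - x + x) * y) by ring.
    eapply Rle_trans; [apply Rabs_triang|]; rewrite !Rabs_mult.
    apply Rplus_le_compat; [apply Rmult_le_compat; auto using Rabs_pos|].
    apply Rmult_le_compat_r; auto.
    eapply Rle_trans; [apply Rabs_triang|]; nra. }
  nra.
Qed.

Lemma is_derive_C_iff (V : NormedModule C_AbsRing) (f : C -> V) (z : C) (l : V) :
  is_derive (K := C_AbsRing) f z l <->
  forall e, 0 < e -> exists d, 0 < d /\ forall w, Cmod (w - z) < d ->
    norm (minus (minus (f w) (f z)) (scal (w - z)%C l)) <= e * Cmod (w - z).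
Proof.
  split.
  - intros [_ H] e He.
    destruct (H z (fun P h => h) (mkposreal e He)) as [d Hd].
    exists d; split; [apply cond_pos|]; intros w Hw; apply Hd, Hw.
  - intros H; split; [apply is_linear_scal_l|].
    intros x Hx; rewrite <- (is_filter_lim_locally_unique _ _ Hx).
    intros e; destruct (H e (cond_pos e)) as [d [Hd H1]].
    exists (mkposreal d Hd); intros w Hw; apply H1, Hw.
Qed.

(** Since cexp w = cexp z cexp (w - z), the estimate at 0 is transported to z. *)
Lemma is_derive_cexp (z : C) :
  is_derive (K := C_AbsRing) (V := AbsRing_NormedModule C_AbsRing) cexp z (cexp z).
Proof.
  apply (proj2 (is_derive_C_iff (AbsRing_NormedModule C_AbsRing) cexp z (cexp z))); intros e He.
  assert (Hm : 0 < Cmod (cexp z)) by (rewrite Cmod_cexp; apply exp_pos).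
  destruct (cexp_small (e / Cmod (cexp z))) as [d [Hd H]].
  { apply Rdiv_lt_0_compat; assumption. }
  exists d; split; [exact Hd|]; intros w Hw; specialize (H _ Hw).
  change (Cmod (cexp w - cexp z - (w - z) * cexp z) <= e * Cmod (w - z)).
  replace (cexp w - cexp z - (w - z) * cexp z)%C
    with (cexp z * (cexp (w - z) - 1 - (w - z)))%C.
  - rewrite Cmod_mult.
    apply (Rmult_le_compat_l (Cmod (cexp z))) in H; [|lra].
    replace (Cmod (cexp z) * (e / Cmod (cexp z) * Cmod (w - z)))
      with (e * Cmod (w - z)) in H by (field; lra); exact H.
  - replace (cexp w) with (cexp z * cexp (w - z))%C; [ring|].
    rewrite <- cexp_plus; f_equal; ring.
Qed.

(** * Vector-valued functions of a real variable *)

Section RealVariable.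

Variable V : NormedModule C_AbsRing.

Lemma is_derive_R_iff (f : R -> V) (t : R) (l : V) :
  is_derive (V := RSN V) f t l <->
  forall e, 0 < e -> exists d, 0 < d /\ forall s, Rabs (s - t) < d ->
    norm (minus (minus (f s) (f t)) (scal (RtoC (s - t)) l)) <= e * Rabs (s - t).
Proof.
  split.
  - intros [_ H] e He.
    destruct (H t (fun P h => h) (mkposreal e He)) as [d Hd].
    exists d; split; [apply cond_pos|]; intros w Hw; apply Hd, Hw.
  - intros H; split; [apply (is_linear_scal_l (V := RSN V))|].
    intros x Hx; rewrite <- (is_filter_lim_locally_unique _ _ Hx).
    intros e; destruct (H e (cond_pos e)) as [d [Hd H1]].
    exists (mkposreal d Hd); intros w Hw; apply H1, Hw.
Qed.

Lemma continuous_R_iff (f : R -> V) (t : R) :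
  continuous f t <->
  forall e, 0 < e -> exists d, 0 < d /\ forall s, Rabs (s - t) < d ->
    norm (minus (f s) (f t)) < e.
Proof.
  etransitivity; [apply (filterlim_norm_iff V R (locally t) f (f t))|].
  split; intros H e He; specialize (H e He).
  - destruct H as [d Hd]; exists d; split; [apply cond_pos|]; intros s Hs; apply Hd, Hs.
  - destruct H as [d [Hd H]]; exists (mkposreal d Hd); intros s Hs; apply H, Hs.
Qed.

Lemma is_derive_continuous_R (f : R -> V) (t : R) (l : V) :
  is_derive (V := RSN V) f t l -> continuous f t.
Proof.
  intros H; apply (ex_derive_continuous (V := RSN V)); exists l; exact H.
Qed.

Lemma norm_RInt_le_bound (f : R -> V) (a b M : R) (I : V) : a <= b ->
  (forall t, a <= t <= b -> norm (f t) <= M) -> is_RInt (V := RSN V) f a b I ->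
  norm I <= (b - a) * M.
Proof. intros Hab H HI; exact (norm_RInt_le_const (V := RSN V) f a b I M Hab H HI). Qed.

(** Linearity moves [L] through every Riemann sum, and its boundedness through the limit. The case
    of interest is the bounded operator [R1]. *)
Lemma is_RInt_linear (W : NormedModule C_AbsRing) (L : V -> W) (f : R -> V)
    (a b : R) (I : V) :
  is_linear (K := C_AbsRing) L -> is_RInt (V := RSN V) f a b I ->
  is_RInt (V := RSN W) (fun t => L (f t)) a b (L I).
Proof.
  intros HL HI; unfold is_RInt in *.
  assert (E : forall p, @scal R_Ring (RSN W) (sign (b - a))
      (Riemann_sum (V := RSN W) (fun t => L (f t)) p) =
      L (@scal R_Ring (RSN V) (sign (b - a)) (Riemann_sum (V := RSN V) f p))).
  { intros p; rewrite !RS_scal.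
    etransitivity; [|symmetry; apply (linear_scal L HL (RtoC (sign (b - a))))].
    apply (f_equal (fun x : W => scal (RtoC (sign (b - a))) x)).
    revert p; refine (@SF_cons_ind R (fun p => Riemann_sum (V := RSN W) (fun t => L (f t)) p =
      L (Riemann_sum (V := RSN V) f p)) _ _).
    - intros x0; unfold Riemann_sum; simpl; symmetry.
      assert (Hz : L (scal (RtoC 0) zero) = scal (RtoC 0) (L zero)) by apply (linear_scal L HL).
      etransitivity; [|etransitivity; [exact Hz|]].
      + apply (f_equal L); symmetry; apply (scal_zero_r (V := V)).
      + apply (scal_zero_l (V := W)).
    - intros h s IH; rewrite !Riemann_sum_cons, IH, !RS_scal.
      etransitivity; [|symmetry; apply (linear_plus L HL)].
      apply (f_equal (fun x : W => plus x (L (Riemann_sum (V := RSN V) f s)))).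
      symmetry; apply (linear_scal L HL). }
  eapply filterlim_ext; [intros p; symmetry; apply E|].
  eapply filterlim_comp; [exact HI|].
  apply (filterlim_norm_iff W); [apply locally_filter|]; intros e He.
  destruct (linear_norm L HL) as [M [HM H]].
  apply (locally_norm_iff V); exists (e / M); split; [apply Rdiv_lt_0_compat; assumption|].
  intros y Hy.
  assert (E2 : minus (L y) (L I) = L (minus y I)).
  { replace (minus y I) with (plus y (scal (RtoC (-1)) I)) by (vring V).
    etransitivity; [|symmetry; apply (linear_plus L HL)].
    etransitivity; [|symmetry; apply (f_equal (plus (L y))), (linear_scal L HL)].
    vring W. }
  apply (Rmult_lt_compat_l M) in Hy; [|exact HM].
  replace (M * (e / M)) with e in Hy by (field; lra).
  refine (Rle_lt_trans _ _ _ _ Hy).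
  eapply Rle_trans; [right; apply (f_equal norm E2)|apply H].
Qed.

Lemma is_RInt_scalC (c : C) (f : R -> V) (a b : R) (I : V) :
  is_RInt (V := RSN V) f a b I ->
  is_RInt (V := RSN V) (fun t => scal c (f t)) a b (scal c I).
Proof.
  apply is_RInt_linear; apply (is_linear_scal_r (V := V)); intros; apply Cmult_comm.
Qed.

(** The product rule: the remainder splits into a(s) times the remainder of f, the increment of a
    times h f', and the remainder of a times f(t). *)
Lemma is_derive_scal_fct (a : R -> C) (f : R -> V) (t : R) (a' : C) (f' : V) :
  is_derive (V := RSN C_NormedModule) a t a' -> is_derive (V := RSN V) f t f' ->
  is_derive (V := RSN V) (fun s => scal (a s) (f s)) t
    (plus (scal a' (f t)) (scal (a t) f')).
Proof.
  intros Ha Hf.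
  pose proof (proj1 (is_derive_R_iff f t f') Hf) as Hf'; clear Hf; rename Hf' into Hf.
  assert (Ha' : forall e, 0 < e -> exists d, 0 < d /\ forall s, Rabs (s - t) < d ->
    Cmod (a s - a t - RtoC (s - t) * a') <= e * Rabs (s - t)).
  { intros e He; destruct Ha as [_ H].
    destruct (H t (fun P h => h) (mkposreal e He)) as [d Hd].
    exists d; split; [apply cond_pos|]; intros w Hw; apply Hd, Hw. }
  clear Ha; apply (proj2 (is_derive_R_iff (fun s => scal (a s) (f s)) t _)); intros e He.
  pose proof (Cmod_ge_0 a'); pose proof (Cmod_ge_0 (a t)).
  pose proof (norm_ge_0 (f t)); pose proof (norm_ge_0 f').
  set (B := Cmod (a t) + Cmod a' + 1 + norm (f t) + norm f').
  assert (HB : 1 <= B) by (unfold B; lra).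
  (* Each of the three pieces of the remainder will be at most B^2 k |h|. *)
  set (k := Rmin 1 (e / (3 * B * B))).
  assert (Hk0 : 0 < e / (3 * B * B)) by (apply Rdiv_lt_0_compat; nra).
  assert (Hk : 0 < k) by (apply Rmin_pos; lra).
  assert (Hk1 : k <= 1) by apply Rmin_l; assert (Hk2 : k <= e / (3 * B * B)) by apply Rmin_r.
  assert (Hk3 : 3 * B * B * k <= e).
  { apply (Rmult_le_compat_l (3 * B * B)) in Hk2; [|nra].
    replace (3 * B * B * (e / (3 * B * B))) with e in Hk2 by (field; lra); exact Hk2. }
  destruct (Ha' k Hk) as [d1 [Hd1 K1]]; destruct (Hf k Hk) as [d2 [Hd2 K2]].
  exists (Rmin (Rmin d1 d2) k); split; [repeat apply Rmin_pos; lra|].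
  intros s Hs.
  pose proof (Rmin_l (Rmin d1 d2) k); pose proof (Rmin_r (Rmin d1 d2) k).
  pose proof (Rmin_l d1 d2); pose proof (Rmin_r d1 d2).
  specialize (K1 s ltac:(lra)); specialize (K2 s ltac:(lra)).
  set (h := s - t) in *; pose proof (Rabs_pos h) as Ph.
  assert (Hda : Cmod (a s - a t) <= B * Rabs h).
  { replace (a s - a t)%C with ((a s - a t - RtoC h * a') + RtoC h * a')%C by ring.
    eapply Rle_trans; [apply Cmod_triangle|]; rewrite Cmod_mult, Cmod_R.
    unfold B; nra. }
  assert (Has : Cmod (a s) <= B * B).
  { replace (a s) with ((a s - a t) + a t)%C by ring.
    eapply Rle_trans; [apply Cmod_triangle|].
    assert (B * Rabs h <= B * 1) by (apply Rmult_le_compat_l; lra).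
    assert (Cmod (a t) <= B - 1) by (unfold B; lra).
    nra. }
  set (df := minus (minus (f s) (f t)) (scal (RtoC h) f')) in *.
  apply (norm_eq_le V _ (plus (plus (scal (a s) df) (scal ((a s - a t) * RtoC h)%C f'))
    (scal (a s - a t - RtoC h * a')%C (f t)))).
  { unfold df; vring V. }
  assert (T1 : norm (scal (a s) df) <= B * B * (k * Rabs h)).
  { apply norm_scal_le; assumption. }
  assert (T2 : norm (scal ((a s - a t) * RtoC h)%C f') <= B * Rabs h * k * B).
  { apply norm_scal_le; [rewrite Cmod_mult, Cmod_R|unfold B; lra].
    apply Rmult_le_compat; auto using Cmod_ge_0; lra. }
  assert (T3 : norm (scal (a s - a t - RtoC h * a')%C (f t)) <= k * Rabs h * B).
  { apply norm_scal_le; [assumption|unfold B; lra]. }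
  assert (k * Rabs h * B <= k * Rabs h * (B * B)).
  { apply Rmult_le_compat_l; [apply Rmult_le_pos; lra|nra]. }
  assert (3 * B * B * k * Rabs h <= e * Rabs h) by (apply Rmult_le_compat_r; assumption).
  eapply Rle_trans; [apply (norm_plus_le V); [apply (norm_plus_le V)|]; eassumption|].
  lra.
Qed.

Lemma is_derive_cexp_line (l : C) (t : R) :
  is_derive (V := RSN C_NormedModule) (fun s : R => cexp (l * RtoC s)%C) t
    (l * cexp (l * RtoC t))%C.
Proof.
  split; [apply (is_linear_scal_l (V := RSN C_NormedModule))|].
  intros x Hx; rewrite <- (is_filter_lim_locally_unique _ _ Hx); clear x Hx; intros [e He].
  pose proof (proj1 (is_derive_C_iff (AbsRing_NormedModule C_AbsRing) cexp _ _)
    (is_derive_cexp (l * RtoC t)%C)) as H.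
  pose proof (Cmod_ge_0 l) as Hl.
  destruct (H (e / (Cmod l + 1))) as [d [Hd H1]]; [apply Rdiv_lt_0_compat; lra|].
  assert (Hd' : 0 < d / (Cmod l + 1)) by (apply Rdiv_lt_0_compat; lra).
  exists (mkposreal _ Hd'); intros s Hs.
  change (Rabs (s - t) < d / (Cmod l + 1)) in Hs.
  assert (E : (l * RtoC s - l * RtoC t)%C = (l * RtoC (s - t))%C)
    by (rewrite RtoC_minus; ring).
  assert (Hs2 : Cmod l * Rabs (s - t) <= (Cmod l + 1) * Rabs (s - t))
    by (pose proof (Rabs_pos (s - t)); nra).
  assert (Hs3 : (Cmod l + 1) * Rabs (s - t) < d).
  { apply (Rmult_lt_compat_l (Cmod l + 1)) in Hs; [|lra].
    replace ((Cmod l + 1) * (d / (Cmod l + 1))) with d in Hs by (field; lra); exact Hs. }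
  specialize (H1 (l * RtoC s)%C); rewrite E, Cmod_mult, Cmod_R in H1.
  specialize (H1 ltac:(lra)).
  change (Cmod (cexp (l * RtoC s) - cexp (l * RtoC t) -
    RtoC (s - t) * (l * cexp (l * RtoC t)))%C <= e * Rabs (s - t)).
  change (Cmod (cexp (l * RtoC s) - cexp (l * RtoC t) -
    (l * RtoC (s - t)) * cexp (l * RtoC t))%C
     <= e / (Cmod l + 1) * (Cmod l * Rabs (s - t))) in H1.
  replace (RtoC (s - t) * (l * cexp (l * RtoC t)))%C
    with (l * RtoC (s - t) * cexp (l * RtoC t))%C by ring.
  eapply Rle_trans; [exact H1|].
  assert (0 < e / (Cmod l + 1)) by (apply Rdiv_lt_0_compat; lra).
  apply Rle_trans with (e / (Cmod l + 1) * ((Cmod l + 1) * Rabs (s - t))); [nra|].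
  right; field; lra.
Qed.

End RealVariable.

(** * Goursat's theorem for rectangles *)

Section Goursat.

Variables (V : NormedModule C_AbsRing) (cV : CompleteSpace.mixin_of V).

Definition rint (f : R -> V) (a b : R) : V := RInt (V := RS V cV) f a b.

Lemma is_RInt_rint (f : R -> V) (a b : R) : a <= b ->
  (forall t, a <= t <= b -> continuous f t) ->
  is_RInt (V := RSN V) f a b (rint f a b).
Proof.
  intros Hab H; apply (RInt_correct (V := RS V cV)), (ex_RInt_continuous (V := RS V cV)).
  rewrite Rmin_left, Rmax_right by exact Hab; exact H.
Qed.

Lemma rint_unique (f : R -> V) (a b : R) (I : V) :
  is_RInt (V := RSN V) f a b I -> rint f a b = I.
Proof. apply (is_RInt_unique (V := RS V cV)). Qed.

Lemma rint_Chasles (f : R -> V) (a b c : R) : a <= b -> b <= c ->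
  (forall t, a <= t <= c -> continuous f t) ->
  rint f a c = plus (rint f a b) (rint f b c).
Proof.
  intros Hab Hbc H; apply rint_unique.
  apply (is_RInt_Chasles (V := RSN V) f a b c); apply is_RInt_rint; auto;
    intros t Ht; apply H; lra.
Qed.

Lemma is_RInt_derive_C (f df : R -> V) (a b : R) : a <= b ->
  (forall t, a <= t <= b -> is_derive (V := RSN V) f t (df t)) ->
  (forall t, a <= t <= b -> continuous df t) ->
  is_RInt (V := RSN V) df a b (minus (f b) (f a)).
Proof.
  intros Hab H1 H2; apply (is_RInt_derive (V := RS V cV));
    rewrite Rmin_left, Rmax_right by exact Hab; assumption.
Qed.

Lemma is_derive_hline (P : C -> V) (x y : R) (l : V) :
  is_derive (K := C_AbsRing) P (x, y) l ->
  is_derive (V := RSN V) (fun s => P (s, y)) x l.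
Proof.
  intros H; pose proof (proj1 (is_derive_C_iff V P (x, y) l) H) as H1.
  apply (proj2 (is_derive_R_iff V (fun s => P (s, y)) x l)); intros e He.
  destruct (H1 e He) as [d [Hd H2]]; exists d; split; [exact Hd|]; intros s Hs.
  assert (E : ((s, y) - (x, y))%C = RtoC (s - x)).
  { unfold Cminus, Cplus, Copp, RtoC; simpl; f_equal; ring. }
  specialize (H2 (s, y)); rewrite E, Cmod_R in H2; auto.
Qed.

Lemma is_derive_vline (P : C -> V) (x y : R) (l : V) :
  is_derive (K := C_AbsRing) P (x, y) l ->
  is_derive (V := RSN V) (fun s => P (x, s)) y (scal Ci l).
Proof.
  intros H; pose proof (proj1 (is_derive_C_iff V P (x, y) l) H) as H1.
  apply (proj2 (is_derive_R_iff V (fun s => P (x, s)) y (scal Ci l))); intros e He.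
  destruct (H1 e He) as [d [Hd H2]]; exists d; split; [exact Hd|]; intros s Hs.
  assert (E : ((x, s) - (x, y))%C = (RtoC (s - y) * Ci)%C).
  { unfold Cminus, Cplus, Copp, Cmult, Ci, RtoC; simpl; f_equal; ring. }
  specialize (H2 (x, s)); rewrite E, Cmod_mult, Cmod_R, Cmod_Ci, Rmult_1_r in H2.
  refine (norm_eq_le V _ _ _ _ (H2 Hs)); vring V.
Qed.

(** The counterclockwise contour integral: bottom minus top, plus i times right minus left. *)
Definition boundary_int (f : C -> V) (a b c d : R) : V :=
  plus (minus (rint (fun x => f (x, c)) a b) (rint (fun x => f (x, d)) a b))
    (scal Ci (minus (rint (fun y => f (b, y)) c d) (rint (fun y => f (a, y)) c d))).

Definition cdiff_on (f : C -> V) (a b c d : R) : Prop :=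
  forall x y, a <= x <= b -> c <= y <= d ->
    ex_derive (K := C_AbsRing) f (x, y).

Lemma cdiff_hcont (f : C -> V) (a b c d x y : R) : cdiff_on f a b c d ->
  a <= x <= b -> c <= y <= d -> continuous (fun s => f (s, y)) x.
Proof.
  intros H Hx Hy; destruct (H x y Hx Hy) as [l Hl].
  exact (is_derive_continuous_R V _ _ _ (is_derive_hline _ _ _ _ Hl)).
Qed.

Lemma cdiff_vcont (f : C -> V) (a b c d x y : R) : cdiff_on f a b c d ->
  a <= x <= b -> c <= y <= d -> continuous (fun s => f (x, s)) y.
Proof.
  intros H Hx Hy; destruct (H x y Hx Hy) as [l Hl].
  exact (is_derive_continuous_R V _ _ _ (is_derive_vline _ _ _ _ Hl)).
Qed.

(** The integrals over the common side are traversed in opposite directions and cancel. *)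
Lemma boundary_int_split_x (f : C -> V) (a m b c d : R) :
  cdiff_on f a b c d -> a <= m -> m <= b -> c <= d ->
  boundary_int f a b c d = plus (boundary_int f a m c d) (boundary_int f m b c d).
Proof.
  intros H Ham Hmb Hcd; unfold boundary_int.
  rewrite (rint_Chasles (fun x => f (x, c)) a m b), (rint_Chasles (fun x => f (x, d)) a m b);
    auto; try (intros t Ht; apply (cdiff_hcont f a b c d); auto; lra).
  vring V.
Qed.

Lemma boundary_int_split_y (f : C -> V) (a b c m d : R) :
  cdiff_on f a b c d -> a <= b -> c <= m -> m <= d ->
  boundary_int f a b c d = plus (boundary_int f a b c m) (boundary_int f a b m d).
Proof.
  intros H Ham Hmb Hcd; unfold boundary_int.
  rewrite (rint_Chasles (fun y => f (a, y)) c m d), (rint_Chasles (fun y => f (b, y)) c m d);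
    auto; try (intros t Ht; apply (cdiff_vcont f a b c d); auto; lra).
  vring V.
Qed.

(** Provides a primitive of the affine function u + z l, so that its integral around a closed
    contour vanishes. *)
Lemma is_derive_quadratic (u l : V) (z : C) :
  is_derive (K := C_AbsRing)
    (fun w => plus (scal w u) (scal (w * w / 2)%C l)) z (plus u (scal z l)).
Proof.
  apply (proj2 (is_derive_C_iff V (fun w => plus (scal w u) (scal (w * w / 2)%C l)) z _)).
  intros e He; pose proof (norm_ge_0 l) as Hl.
  exists (e / (norm l + 1)); split; [apply Rdiv_lt_0_compat; lra|]; intros w Hw.
  apply (norm_eq_le V _ (scal ((w - z) * (w - z) / 2)%C l)).
  { vreduce V; field. }
  rewrite norm_scalC, Cmod_div, Cmod_mult, Cmod_R, Rabs_pos_eq by (try lra; intros E; injection E; lra).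
  pose proof (Cmod_ge_0 (w - z)) as P.
  assert (Q : Cmod (w - z) * (norm l + 1) <= e).
  { apply (Rmult_lt_compat_r (norm l + 1)) in Hw; [|lra].
    replace (e / (norm l + 1) * (norm l + 1)) with e in Hw by (field; lra); lra. }
  nra.
Qed.

(** The first-order Taylor polynomial of f at z has the primitive [P], whose increments cancel
    around the rectangle. What remains on each side is its length times e S, where S bounds the
    distance to z; the four sides have total length 2 S. *)
Lemma boundary_int_bound (f : C -> V) (a b c d e : R) (z : C) (l : V) :
  cdiff_on f a b c d -> a <= b -> c <= d ->
  a <= Re z <= b -> c <= Im z <= d -> 0 <= e ->
  (forall x y, a <= x <= b -> c <= y <= d ->
    norm (minus (minus (f (x, y)) (f z)) (scal ((x, y) - z)%C l)) <= e * Cmod ((x, y) - z)) ->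
  norm (boundary_int f a b c d) <= 2 * e * ((b - a) + (d - c)) * ((b - a) + (d - c)).
Proof.
  intros Hf Hab Hcd Hz1 Hz2 He H.
  set (u := minus (f z) (scal z l)).
  set (P := fun w => plus (scal w u) (scal (w * w / 2)%C l)).
  set (S := (b - a) + (d - c)).
  assert (HS : forall x y, a <= x <= b -> c <= y <= d -> Cmod ((x, y) - z) <= S).
  { intros x y Hx Hy; eapply Rle_trans; [apply Cmod_le_abs|].
    destruct z as [p q]; unfold Re, Im in *; simpl in *; unfold S.
    apply Rplus_le_compat; apply Rabs_le; lra. }
  assert (HB : forall x y, a <= x <= b -> c <= y <= d ->
    norm (minus (f (x, y)) (plus u (scal ((x, y) : C_AbsRing) l))) <= e * S).
  { intros x y Hx Hy; eapply Rle_trans; [|apply Rmult_le_compat_l; [exact He|apply (HS x y Hx Hy)]].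
    refine (norm_eq_le V _ _ _ _ (H x y Hx Hy)); unfold u; vring V. }
  assert (Hh : forall y, c <= y <= d ->
    norm (minus (rint (fun x => f (x, y)) a b) (minus (P (b, y)) (P (a, y)))) <= (b - a) * (e * S)).
  { intros y Hy.
    apply (norm_RInt_le_bound V (fun x => minus (f (x, y)) (plus u (scal ((x, y) : C_AbsRing) l))) a b);
      [exact Hab|intros t Ht; apply HB; auto|].
    apply (is_RInt_minus (V := RSN V)).
    - apply is_RInt_rint; [exact Hab|]; intros t Ht; apply (cdiff_hcont f a b c d); auto.
    - apply (is_RInt_derive_C (fun x => P (x, y)) (fun x => plus u (scal ((x, y) : C_AbsRing) l))); [exact Hab| |].
      + intros t Ht; apply is_derive_hline, is_derive_quadratic.
      + intros t Ht; apply (is_derive_continuous_R V _ _ l).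
        apply (is_derive_hline (fun w => plus u (scal w l)) t y).
        apply (proj2 (is_derive_C_iff V _ _ _)); intros e' He'; exists 1; split; [lra|].
        intros w _; apply (norm_eq_le V _ zero); [vring V|].
        rewrite (norm_zero (V := V)); apply Rmult_le_pos; [lra|apply Cmod_ge_0]. }
  assert (Hv : forall x, a <= x <= b ->
    norm (minus (scal Ci (rint (fun y => f (x, y)) c d)) (minus (P (x, d)) (P (x, c)))) <= (d - c) * (e * S)).
  { intros x Hx.
    apply (norm_RInt_le_bound V (fun y => minus (scal Ci (f (x, y))) (scal Ci (plus u (scal ((x, y) : C_AbsRing) l)))) c d);
      [exact Hcd| |].
    - intros t Ht.
      apply (norm_eq_le V _ (scal Ci (minus (f (x, t)) (plus u (scal ((x, t) : C_AbsRing) l))))); [vring V|].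
      rewrite norm_scalC, Cmod_Ci, Rmult_1_l; apply HB; auto.
    - apply (is_RInt_minus (V := RSN V)).
      + apply is_RInt_scalC, is_RInt_rint; [exact Hcd|]; intros t Ht; apply (cdiff_vcont f a b c d); auto.
      + apply (is_RInt_derive_C (fun y => P (x, y)) (fun y => scal Ci (plus u (scal ((x, y) : C_AbsRing) l)))); [exact Hcd| |].
        * intros t Ht; apply is_derive_vline, is_derive_quadratic.
        * intros t Ht; apply (is_derive_continuous_R V _ _ (scal Ci (scal Ci l))).
          apply (is_derive_vline (fun w => scal Ci (plus u (scal w l))) x t).
          apply (proj2 (is_derive_C_iff V _ _ _)); intros e' He'; exists 1; split; [lra|].
          intros w _; apply (norm_eq_le V _ zero); [vring V|].
          rewrite (norm_zero (V := V)); apply Rmult_le_pos; [lra|apply Cmod_ge_0]. }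
  pose proof (Hh c ltac:(lra)) as H1; pose proof (Hh d ltac:(lra)) as H2.
  pose proof (Hv a ltac:(lra)) as H3; pose proof (Hv b ltac:(lra)) as H4.
  rewrite (norm_minus_sym V) in H2, H3.
  pose proof (norm_plus_le V _ _ _ _ (norm_plus_le V _ _ _ _ H1 H2)
    (norm_plus_le V _ _ _ _ H4 H3)) as H5.
  eapply Rle_trans; [refine (norm_eq_le V _ _ _ _ H5)|].
  - unfold boundary_int; vring V.
  - unfold S; right; ring.
Qed.

Definition rect : Type := (R * R * R * R)%type.

Definition quarter (r : rect) (i j : bool) : rect :=
  let '(a, b, c, d) := r in
  ((if i then a else (a + b) / 2), (if i then (a + b) / 2 else b),
   (if j then c else (c + d) / 2), (if j then (c + d) / 2 else d)).

(** Goursat's bisection. If the integral exceeds e times the square of the half-perimeter, then so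
    does the integral over one of the four quarters, because this square is divided by 4. The nested
    bad rectangles shrink to a point, where differentiability contradicts [boundary_int_bound]. *)
Theorem Goursat_rectangle (f : C -> V) (a b c d : R) : a <= b -> c <= d ->
  cdiff_on f a b c d -> boundary_int f a b c d = zero.
Proof.
  intros Hab Hcd Hf.
  assert (Key : forall e, 0 < e ->
    norm (boundary_int f a b c d) <= e * (((b - a) + (d - c)) * ((b - a) + (d - c)))).
  { intros e He; apply Rnot_lt_le; intros Hbad0.
    set (bad := fun r : rect => let '(a, b, c, d) := r in
      e * (((b - a) + (d - c)) * ((b - a) + (d - c))) < norm (boundary_int f a b c d)).
    set (good := fun r : rect => let '(a', b', c', d') := r in
      a <= a' /\ a' <= b' /\ b' <= b /\ c <= c' /\ c' <= d' /\ d' <= d).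
    assert (Hsplit : forall r, good r -> bad r -> exists i j, bad (quarter r i j)).
    { intros [[[a1 b1] c1] d1] Hg Hb; simpl in Hg, Hb.
      apply NNPP; intros Hn.
      assert (HN : forall i j, ~ bad (quarter (a1, b1, c1, d1) i j)).
      { intros i j Hij; apply Hn; exists i, j; exact Hij. }
      clear Hn; pose proof (HN true true) as N1; pose proof (HN true false) as N2.
      pose proof (HN false true) as N3; pose proof (HN false false) as N4.
      simpl in N1, N2, N3, N4; apply Rnot_lt_le in N1, N2, N3, N4.
      set (mx := (a1 + b1) / 2) in *; set (my := (c1 + d1) / 2) in *.
      assert (Hsub : forall a2 b2 c2 d2, a <= a2 -> b2 <= b -> c <= c2 -> d2 <= d ->
        cdiff_on f a2 b2 c2 d2) by (intros ? ? ? ? ? ? ? ? x y ? ?; apply Hf; lra).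
      assert (Hmx : a1 <= mx <= b1) by (unfold mx; lra).
      assert (Hmy : c1 <= my <= d1) by (unfold my; lra).
      revert Hb; apply Rle_not_lt.
      rewrite (boundary_int_split_x f a1 mx b1 c1 d1); [|apply Hsub|..]; try lra.
      rewrite (boundary_int_split_y f a1 mx c1 my d1); [|apply Hsub|..]; try lra.
      rewrite (boundary_int_split_y f mx b1 c1 my d1); [|apply Hsub|..]; try lra.
      eapply Rle_trans.
      - apply (norm_plus_le V); apply (norm_plus_le V); eassumption.
      - unfold mx, my; right; field. }
    (* Selects a bad quarter; the last branch needs no test, since by [Hsplit] one of the four is
       bad. *)
    set (step := fun r => match excluded_middle_informative (bad (quarter r true true)) with
      | left _ => quarter r true true | right _ =>
        match excluded_middle_informative (bad (quarter r true false)) with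
        | left _ => quarter r true false | right _ =>
          match excluded_middle_informative (bad (quarter r false true)) with
          | left _ => quarter r false true | right _ => quarter r false false end end end).
    assert (Hstep : forall r, good r -> bad r ->
      bad (step r) /\ exists i j, step r = quarter r i j).
    { intros r Hg Hb; destruct (Hsplit r Hg Hb) as [i [j Hij]]; unfold step.
      repeat destruct (excluded_middle_informative _);
        (split; [|repeat eexists]); auto.
      destruct i, j; tauto. }
    set (q := fun n => Nat.iter n step (a, b, c, d)).
    set (qa := fun n => let '(x, _, _, _) := q n in x).
    set (qb := fun n => let '(_, x, _, _) := q n in x).
    set (qc := fun n => let '(_, _, x, _) := q n in x).
    set (qd := fun n => let '(_, _, _, x) := q n in x).
    assert (Hq : forall n, good (q n) /\ bad (q n)).
    { induction n as [|n [IHg IHb]]; [simpl; repeat split; auto; lra|].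
      destruct (Hstep _ IHg IHb) as [H1 [i [j H2]]].
      change (q (S n)) with (step (q n)); split; [|exact H1]; rewrite H2.
      destruct (q n) as [[[a1 b1] c1] d1]; simpl in IHg |- *; destruct i, j; simpl; lra. }
    assert (Hmono : forall n, qa n <= qa (S n) /\ qb (S n) <= qb n /\ qc n <= qc (S n) /\
      qd (S n) <= qd n /\ qb (S n) - qa (S n) = (qb n - qa n) / 2 /\
      qd (S n) - qc (S n) = (qd n - qc n) / 2).
    { intros n; destruct (Hq n) as [Hg Hb]; destruct (Hstep _ Hg Hb) as [_ [i [j H2]]].
      unfold qa, qb, qc, qd; change (q (S n)) with (step (q n)); rewrite H2.
      destruct (q n) as [[[a1 b1] c1] d1]; simpl in Hg |- *; destruct i, j; simpl; lra. }
    assert (Hg : forall n, a <= qa n /\ qa n <= qb n /\ qb n <= b /\ c <= qc n /\ qc n <= qd n /\ qd n <= d).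
    { intros n; destruct (Hq n) as [Hg _]; unfold qa, qb, qc, qd.
      destruct (q n) as [[[a1 b1] c1] d1]; exact Hg. }
    assert (Hmon2 : forall n k, qa n <= qa (n + k)%nat /\ qb (n + k)%nat <= qb n /\
      qc n <= qc (n + k)%nat /\ qd (n + k)%nat <= qd n).
    { intros n k; induction k as [|k IH]; [rewrite Nat.add_0_r; lra|].
      rewrite Nat.add_succ_r; pose proof (Hmono (n + k)%nat); lra. }
    (* Nested intervals: the supremum of the left endpoints lies in all of them. *)
    assert (Hlim : forall s t : nat -> R, (forall n m, s n <= t m) ->
      exists x, forall n, s n <= x <= t n).
    { intros s t Hst.
      destruct (completeness (fun x => exists n, x = s n)) as [x [Hx1 Hx2]].
      - exists (t O); intros y [n ->]; apply Hst.
      - exists (s O), O; reflexivity.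
      - exists x; intros n; split; [apply Hx1; exists n; reflexivity|].
        apply Hx2; intros y [m ->]; apply Hst. }
    destruct (Hlim qa qb) as [x Hx].
    { intros n m; pose proof (Hmon2 n m); pose proof (Hmon2 m n); pose proof (Hg (n + m)%nat).
      rewrite (Nat.add_comm m n) in *; lra. }
    destruct (Hlim qc qd) as [y Hy].
    { intros n m; pose proof (Hmon2 n m); pose proof (Hmon2 m n); pose proof (Hg (n + m)%nat).
      rewrite (Nat.add_comm m n) in *; lra. }
    destruct (Hf x y) as [l Hl].
    { pose proof (Hx O); pose proof (Hg O); lra. }
    { pose proof (Hy O); pose proof (Hg O); lra. }
    (* The precision e / 2 absorbs the factor 2 of [boundary_int_bound]. *)
    destruct (proj1 (is_derive_C_iff V f (x, y) l) Hl (e / 2) ltac:(lra)) as [dl [Hdl Hder]].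
    set (T := (b - a) + (d - c)).
    assert (Hsize : forall n, (qb n - qa n) + (qd n - qc n) = T * (1 / 2) ^ n).
    { induction n as [|n IH]; [unfold T, qa, qb, qc, qd; simpl; ring|].
      pose proof (Hmono n); simpl; lra. }
    assert (HT : 0 <= T) by (unfold T; lra).
    destruct (pow_lt_1_zero (1 / 2) ltac:(rewrite Rabs_pos_eq; lra) (dl / (T + 1)))
      as [n Hn]; [apply Rdiv_lt_0_compat; lra|].
    specialize (Hn n (le_n n)); rewrite Rabs_pos_eq in Hn by (apply pow_le; lra).
    assert (Hn2 : T * (1 / 2) ^ n < dl).
    { apply (Rmult_lt_compat_l (T + 1)) in Hn; [|lra].
      replace ((T + 1) * (dl / (T + 1))) with dl in Hn by (field; lra).
      pose proof (pow_le (1 / 2) n ltac:(lra)); nra. }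
    rewrite <- Hsize in Hn2.
    pose proof (Hx n) as Hxn; pose proof (Hy n) as Hyn; pose proof (Hg n) as Hgn.
    destruct (Hq n) as [_ Hb].
    assert (Hb' : e * (((qb n - qa n) + (qd n - qc n)) * ((qb n - qa n) + (qd n - qc n))) <
      norm (boundary_int f (qa n) (qb n) (qc n) (qd n))).
    { unfold qa, qb, qc, qd; destruct (q n) as [[[a1 b1] c1] d1]; exact Hb. }
    revert Hb'; apply Rle_not_lt.
    eapply Rle_trans; [apply (boundary_int_bound f _ _ _ _ (e / 2) (x, y) l)|];
      try (unfold Re, Im; simpl; lra).
    - intros x' y' Hx' Hy'; apply Hf; lra.
    - intros x' y' Hx' Hy'; apply Hder.
      eapply Rle_lt_trans; [apply Cmod_le_abs|]; unfold Re, Im; simpl.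
      eapply Rle_lt_trans; [|exact Hn2].
      apply Rplus_le_compat; apply Rabs_le; lra. }
  apply norm_small_zero; intros e He.
  set (T := (b - a) + (d - c)) in *; assert (HT : 0 <= T) by (unfold T; lra).
  assert (HT1 : 0 < T * T + 1) by nra.
  eapply Rle_trans; [apply (Key (e / (T * T + 1))); apply Rdiv_lt_0_compat; lra|].
  assert (0 < e / (T * T + 1)) by (apply Rdiv_lt_0_compat; lra).
  replace e with (e / (T * T + 1) * (T * T + 1)) at 2 by (field; lra); nra.
Qed.

End Goursat.

(** * Vector-valued power series *)

Section Series.

Variables (V : NormedModule C_AbsRing) (cV : CompleteSpace.mixin_of V).

Lemma is_series_norm_iff (a : nat -> V) (s : V) :
  is_series a s <->
  forall e, 0 < e -> exists N, forall n, (N <= n)%nat -> norm (minus (sum_n a n) s) < e.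
Proof. apply (filterlim_norm_iff V nat eventually (sum_n a) s). Qed.

Lemma is_series_unique_norm (a : nat -> V) (s t : V) :
  is_series a s -> is_series a t -> s = t.
Proof.
  intros Hs Ht; exact (filterlim_locally_unique (V := V) (F := eventually) (sum_n a) s t Hs Ht).
Qed.

(** The subtracted power makes the induction close; only the bound 2 M is used later. *)
Lemma sum_n_geom_bound (a : nat -> V) (M : R) :
  (forall n, norm (a n) <= M * (1 / 2) ^ n) ->
  forall n, norm (sum_n a n) <= M * (2 - (1 / 2) ^ n).
Proof.
  intros H; induction n as [|n IH].
  - rewrite sum_O; specialize (H O); simpl in *; lra.
  - rewrite sum_Sn; eapply Rle_trans; [apply (norm_plus_le V); [exact IH|apply H]|].
    simpl; lra.
Qed.

Lemma series_geom_bound (a : nat -> V) (M : R) (s : V) :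
  (forall n, norm (a n) <= M * (1 / 2) ^ n) -> is_series a s -> norm s <= 2 * M.
Proof.
  intros H Hs.
  assert (HM : 0 <= M) by (specialize (H O); simpl in H; pose proof (norm_ge_0 (a O)); lra).
  apply le_epsilon; intros e He.
  destruct (proj1 (is_series_norm_iff a s) Hs e He) as [N HN]; specialize (HN N (le_n N)).
  rewrite (norm_minus_sym V) in HN.
  pose proof (norm_le_minus V s (sum_n a N)) as H1.
  pose proof (sum_n_geom_bound a M H N); pose proof (pow_le (1 / 2) N ltac:(lra)); nra.
Qed.

Lemma series_geom_ex (a : nat -> V) (M : R) :
  (forall n, norm (a n) <= M * (1 / 2) ^ n) -> exists s, is_series a s.
Proof.
  intros H.
  apply (ex_series_le (V := RS V cV) a (fun n => M * (1 / 2) ^ n) H).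
  apply (ex_series_scal (V := R_NormedModule) M (fun n => (1 / 2) ^ n)), ex_series_geom.
  rewrite Rabs_pos_eq; lra.
Qed.

Lemma is_series_scalC (k : C) (a : nat -> V) (s : V) :
  is_series a s -> is_series (fun n => scal k (a n)) (scal k s).
Proof. apply (is_series_scal k a s). Qed.

Lemma is_series_tail (a : nat -> V) (s : V) :
  is_series a s -> is_series (fun n => a (S n)) (minus s (a O)).
Proof.
  intros H; apply is_series_incr_1.
  assert (E : plus (minus s (a O)) (a O) = s) by (vring V).
  exact (eq_ind s (fun t => is_series a t) H _ (eq_sym E)).
Qed.

Lemma is_series_cons (a : nat -> V) (s : V) :
  is_series (fun n => a (S n)) s -> is_series a (plus (a O) s).
Proof.
  intros H; apply is_series_decr_1.
  assert (E : plus (plus (a O) s) (opp (a O)) = s) by (vring V).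
  exact (eq_ind s (fun t => is_series (fun n => a (S n)) t) H _ (eq_sym E)).
Qed.

(** Convertible to [is_pseries], but written with the complex power so that the coefficients can be
    handled by [ring]. *)
Definition ser (x : nat -> V) (u : C) (s : V) : Prop :=
  is_series (fun n => scal (u ^ n)%C (x n)) s.

(** With coefficients bounded by M rho^n the radius of convergence is at least 1 / rho. Staying
    within half of it gives the ratio 1/2, for which all constants are explicit. *)
Lemma ser_term_bound (x : nat -> V) (M rho : R) (u : C) (n : nat) :
  (forall n, norm (x n) <= M * rho ^ n) -> 0 <= rho -> Cmod u * rho <= 1 / 2 ->
  norm (scal (u ^ n)%C (x n)) <= M * (1 / 2) ^ n.
Proof.
  intros H Hr Hu; rewrite norm_scalC, Cmod_pow.
  assert (HM : 0 <= M) by (specialize (H O); simpl in H; pose proof (norm_ge_0 (x O)); lra).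
  pose proof (Cmod_ge_0 u) as H0.
  assert (Cmod u ^ n * norm (x n) <= Cmod u ^ n * (M * rho ^ n)).
  { apply Rmult_le_compat_l; [apply pow_le, H0|apply H]. }
  assert ((Cmod u * rho) ^ n <= (1 / 2) ^ n).
  { apply pow_incr; split; [apply Rmult_le_pos; assumption|exact Hu]. }
  rewrite Rpow_mult_distr in *; nra.
Qed.

Lemma ser_ex (x : nat -> V) (M rho : R) (u : C) :
  (forall n, norm (x n) <= M * rho ^ n) -> 0 <= rho -> Cmod u * rho <= 1 / 2 ->
  exists s, ser x u s.
Proof.
  intros H Hr Hu; apply (series_geom_ex _ M); intros n; apply (ser_term_bound x M rho); auto.
Qed.

Lemma ser_near_0 (x : nat -> V) (M rho : R) (u : C) (s : V) :
  (forall n, norm (x n) <= M * rho ^ n) -> 0 <= rho -> Cmod u * rho <= 1 / 2 ->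
  ser x u s -> norm (minus s (x O)) <= 2 * M * rho * Cmod u.
Proof.
  intros H Hr Hu Hs; apply is_series_tail in Hs.
  assert (E : minus s (x O) = minus s (scal (u ^ 0)%C (x O))).
  { change (u ^ 0)%C with (RtoC 1); vring V. }
  apply (norm_eq_le V _ _ _ E).
  replace (2 * M * rho * Cmod u) with (2 * (M * rho * Cmod u)) by ring.
  refine (series_geom_bound _ _ _ _ Hs); intros n.
  apply (norm_eq_le V _ (scal u (scal (u ^ n)%C (x (S n))))).
  { rewrite Cpow_S; vring V. }
  assert (HM : 0 <= M) by (specialize (H O); simpl in H; pose proof (norm_ge_0 (x O)); lra).
  rewrite norm_scalC.
  pose proof (ser_term_bound (fun n => x (S n)) (M * rho) rho u n) as T.
  specialize (T ltac:(intros k; specialize (H (S k)); simpl in H; lra) Hr Hu).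
  pose proof (Cmod_ge_0 u); simpl in T.
  apply (Rmult_le_compat_l (Cmod u)) in T; [|assumption]; lra.
Qed.

(** A factor u is split off and [ser_near_0] applied to the shifted coefficients, which are bounded
    by (M rho) rho^n. *)
Lemma ser_derive_0 (x : nat -> V) (M rho : R) (u : C) (s : V) :
  (forall n, norm (x n) <= M * rho ^ n) -> 0 <= rho -> Cmod u * rho <= 1 / 2 ->
  ser x u s ->
  norm (minus (minus s (x O)) (scal u (x 1%nat))) <= 2 * M * rho * rho * (Cmod u * Cmod u).
Proof.
  intros H Hr Hu Hs.
  destruct (ser_ex (fun n => x (S n)) (M * rho) rho u) as [s' Hs']; auto.
  { intros n; specialize (H (S n)); simpl in H; lra. }
  assert (E : minus s (x O) = scal u s').
  { apply is_series_tail in Hs; apply (is_series_scalC u) in Hs'.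
    transitivity (minus s (scal (u ^ 0)%C (x O))).
    - change (u ^ 0)%C with (RtoC 1); vring V.
    - apply (is_series_unique_norm _ _ _ Hs).
      refine (is_series_ext _ _ _ _ Hs'); intros n; rewrite Cpow_S; vring V. }
  apply (norm_eq_le V _ (scal u (minus s' (x 1%nat)))).
  { etransitivity; [apply (f_equal (fun w => minus w (scal u (x 1%nat)))), E|vring V]. }
  rewrite norm_scalC.
  pose proof (ser_near_0 (fun n => x (S n)) (M * rho) rho u s') as T.
  specialize (T ltac:(intros k; specialize (H (S k)); simpl in H; lra) Hr Hu Hs').
  pose proof (Cmod_ge_0 u).
  apply (Rmult_le_compat_l (Cmod u)) in T; [|assumption]; lra.
Qed.

(** Induction on u^{n+1} - v^{n+1} = u (u^n - v^n) + (u - v) v^n. The constant 4 reproduces itself,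
    since (1/4) 4 + 1 = 4 (1/2). *)
Lemma Cpow_diff_bound (u v : C) (rho : R) (n : nat) : 0 <= rho ->
  Cmod u * rho <= 1 / 4 -> Cmod v * rho <= 1 / 4 ->
  Cmod (u ^ n - v ^ n) * rho ^ n <= 4 * (Cmod (u - v) * rho) * (1 / 2) ^ n.
Proof.
  intros Hr Hu Hv; pose proof (Cmod_ge_0 (u - v)) as H0.
  assert (HK : 0 <= Cmod (u - v) * rho) by (apply Rmult_le_pos; assumption).
  induction n as [|n IH].
  - simpl; replace (1 - 1)%C with (RtoC 0) by ring; rewrite Cmod_0; lra.
  - rewrite !Cpow_S.
    replace (u * u ^ n - v * v ^ n)%C with (u * (u ^ n - v ^ n) + (u - v) * v ^ n)%C by ring.
    eapply Rle_trans; [apply Rmult_le_compat_r; [apply pow_le, Hr|apply Cmod_triangle]|].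
    rewrite !Cmod_mult, Cmod_pow; simpl.
    assert (T1 : Cmod u * rho * (Cmod (u ^ n - v ^ n) * rho ^ n) <=
      1 / 4 * (4 * (Cmod (u - v) * rho) * (1 / 2) ^ n)).
    { apply Rmult_le_compat; auto; apply Rmult_le_pos; auto using Cmod_ge_0; apply pow_le, Hr. }
    assert (T2 : Cmod v ^ n * rho ^ n <= (1 / 2) ^ n).
    { rewrite <- Rpow_mult_distr; apply pow_incr; split; [|lra].
      apply Rmult_le_pos; auto using Cmod_ge_0. }
    assert (T3 : Cmod (u - v) * rho * (Cmod v ^ n * rho ^ n) <= Cmod (u - v) * rho * (1 / 2) ^ n).
    { apply Rmult_le_compat_l; assumption. }
    lra.
Qed.

(** Compares the sum at a point of the axis with the sums at nearby points off the axis, where the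
    sum is known to be the resolvent. *)
Lemma ser_lipschitz (x : nat -> V) (M rho : R) (u v : C) (s t : V) :
  (forall n, norm (x n) <= M * rho ^ n) -> 0 <= rho ->
  Cmod u * rho <= 1 / 4 -> Cmod v * rho <= 1 / 4 ->
  ser x u s -> ser x v t -> norm (minus s t) <= 8 * M * rho * Cmod (u - v).
Proof.
  intros H Hr Hu Hv Hs Ht.
  assert (HM : 0 <= M) by (specialize (H O); simpl in H; pose proof (norm_ge_0 (x O)); lra).
  replace (8 * M * rho * Cmod (u - v)) with (2 * (4 * M * (Cmod (u - v) * rho))) by ring.
  pose proof (is_series_minus _ _ _ _ Hs Ht) as Hd.
  refine (series_geom_bound _ _ _ _ Hd); intros n.
  apply (norm_eq_le V _ (scal (u ^ n - v ^ n)%C (x n))); [vring V|].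
  rewrite norm_scalC.
  pose proof (Cpow_diff_bound u v rho n Hr Hu Hv) as T.
  assert (Cmod (u ^ n - v ^ n) * norm (x n) <= Cmod (u ^ n - v ^ n) * (M * rho ^ n)).
  { apply Rmult_le_compat_l; [apply Cmod_ge_0|apply H]. }
  apply (Rmult_le_compat_l M) in T; [|exact HM]; lra.
Qed.

(** The partial sums of a convergent series are bounded by some M, and its terms, being differences
    of them, by 2 M. *)
Lemma ser_conv_bound (x : nat -> V) (u : C) (s : V) : u <> 0 -> ser x u s ->
  exists M, forall n, norm (x n) <= M * (/ Cmod u) ^ n.
Proof.
  intros Hu Hs.
  destruct (filterlim_bounded (V := V) (sum_n (fun n => scal (u ^ n)%C (x n)))) as [M HM].
  { exists s; exact Hs. }
  assert (Hp : 0 < Cmod u) by (apply Cmod_gt_0, Hu).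
  assert (HT : forall n, norm (scal (u ^ n)%C (x n)) <= 2 * M).
  { intros [|n].
    - pose proof (HM O) as H0; rewrite sum_O in H0.
      pose proof (norm_ge_0 (scal (u ^ 0)%C (x O))); lra.
    - pose proof (HM n) as H1; pose proof (HM (S n)) as H2; rewrite sum_Sn in H2.
      set (p := sum_n (fun n => scal (u ^ n)%C (x n)) n) in *.
      apply (norm_eq_le V _ (minus (plus p (scal (u ^ S n)%C (x (S n)))) p)); [vring V|].
      eapply Rle_trans; [apply norm_minus_le|lra]. }
  exists (2 * M); intros n; specialize (HT n).
  rewrite norm_scalC, Cmod_pow in HT; rewrite pow_inv.
  assert (Hpn : 0 < Cmod u ^ n) by (apply pow_lt, Hp).
  apply (Rmult_le_compat_r (/ Cmod u ^ n)) in HT; [|left; apply Rinv_0_lt_compat, Hpn].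
  replace (Cmod u ^ n * norm (x n) * / Cmod u ^ n) with (norm (x n)) in HT by (field; lra).
  exact HT.
Qed.

(** Differentiability at the centre suffices: [analytic_at] provides an expansion around each point
    of an open set. *)
Lemma ser_cdiff (f : C -> V) (x : nat -> V) (c : C) (r : R) : 0 < r ->
  (forall z, Cmod (z - c) < r -> ser x (z - c)%C (f z)) ->
  is_derive (K := C_AbsRing) f c (x 1%nat).
Proof.
  intros Hr H.
  (* Convergence at distance r / 2 bounds the coefficients with rho = 2 / r. *)
  destruct (ser_conv_bound x (RtoC (r / 2)) (f (c + RtoC (r / 2))%C)) as [M HM].
  { intros E; injection E; lra. }
  { replace (RtoC (r / 2)) with (c + RtoC (r / 2) - c)%C at 1 by ring; apply H.
    replace (c + RtoC (r / 2) - c)%C with (RtoC (r / 2)) by ring.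
    rewrite Cmod_R, Rabs_pos_eq; lra. }
  rewrite Cmod_R, Rabs_pos_eq in HM by lra.
  set (rho := / (r / 2)) in *.
  assert (Hrho : 0 < rho) by (apply Rinv_0_lt_compat; lra).
  assert (Hp : rho * (r / 2) = 1) by (apply Rinv_l; lra).
  assert (HM0 : 0 <= M) by (specialize (HM O); simpl in HM; pose proof (norm_ge_0 (x O)); lra).
  assert (Hc : f c = x O).
  { assert (H0 := H c); replace (c - c)%C with (RtoC 0) in H0 by ring.
    rewrite Cmod_0 in H0; specialize (H0 Hr).
    apply minus_zero_eq, norm_eq_zero, Rle_antisym; [|apply norm_ge_0].
    eapply Rle_trans; [apply (ser_near_0 x M rho 0); auto; try lra|]; rewrite Cmod_0; lra. }
  apply (proj2 (is_derive_C_iff V f c (x 1%nat))); intros e He.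
  set (K := 2 * M * rho * rho + 1); assert (HK : 0 < K) by (unfold K; nra).
  exists (Rmin (r / 4) (e / K)); split.
  { apply Rmin_pos; [lra|apply Rdiv_lt_0_compat; lra]. }
  intros w Hw; pose proof (Rmin_l (r / 4) (e / K)); pose proof (Rmin_r (r / 4) (e / K)).
  rewrite Hc; pose proof (Cmod_ge_0 (w - c)) as P.
  eapply Rle_trans; [apply (ser_derive_0 x M rho (w - c)); auto; try lra|].
  - nra.
  - apply H; lra.
  - assert (T : K * Cmod (w - c) <= e).
    { assert (T : Cmod (w - c) <= e / K) by lra.
      apply (Rmult_le_compat_l K) in T; [|lra].
      replace (K * (e / K)) with e in T by (field; lra); exact T. }
    assert (2 * M * rho * rho * Cmod (w - c) <= e) by (unfold K in T; nra).
    nra.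
Qed.

Lemma ser_opp (x : nat -> V) (u : C) (s : V) :
  ser x u s -> ser (fun n => scal ((- (1)) ^ n)%C (x n)) (- u)%C s.
Proof.
  intros H; refine (is_series_ext _ _ _ _ H); intros n.
  replace (u ^ n)%C with ((- u) ^ n * (- (1)) ^ n)%C; [vring V|].
  rewrite <- Cpow_mult_l; f_equal; ring.
Qed.

End Series.

(** * The local resolvent and its singularities *)

Section LocalResolvent.

Variables (V : NormedModule C_AbsRing) (cV : CompleteSpace.mixin_of V).
(* [R1] stands for the resolvent [(1 - D)^{-1}] of a closed operator [D]. *)
Variable R1 : V -> V.
Hypothesis R1_lin : is_linear (K := C_AbsRing) R1.

(* [(l - D) x = y], expressed with the bounded operator [R1] only. *)
Definition Sol (l : C) (y x : V) : Prop := x = R1 (plus y (scal (1 - l)%C x)).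

Hypothesis Sol_bound : forall l y x, Sol l y x -> norm x * Rabs (Re l) <= norm y.
Variable hat : V -> C -> V.
Hypothesis Sol_hat : forall y l, Re l <> 0 -> Sol l y (hat y l).

Lemma R1_plus (x y : V) : R1 (plus x y) = plus (R1 x) (R1 y).
Proof. apply (linear_plus R1 R1_lin). Qed.
Lemma R1_scal (k : C) (x : V) : R1 (scal k x) = scal k (R1 x).
Proof. apply (linear_scal R1 R1_lin). Qed.
Lemma R1_minus (x y : V) : R1 (minus x y) = minus (R1 x) (R1 y).
Proof.
  replace (minus x y) with (plus x (scal (RtoC (-1)) y)) by (vring V).
  rewrite R1_plus, R1_scal; vring V.
Qed.

Lemma Sol_plus (l : C) (y x y' x' : V) :
  Sol l y x -> Sol l y' x' -> Sol l (plus y y') (plus x x').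
Proof.
  unfold Sol; intros H H'; rewrite H at 1; rewrite H' at 1.
  rewrite <- R1_plus; f_equal; vring V.
Qed.

Lemma Sol_scal (l k : C) (y x : V) : Sol l y x -> Sol l (scal k y) (scal k x).
Proof.
  unfold Sol; intros H; rewrite H at 1; rewrite <- R1_scal; f_equal; vring V.
Qed.

Lemma Sol_minus (l : C) (y x y' x' : V) :
  Sol l y x -> Sol l y' x' -> Sol l (minus y y') (minus x x').
Proof.
  unfold Sol; intros H H'; rewrite H at 1; rewrite H' at 1.
  rewrite <- R1_minus; f_equal; vring V.
Qed.

Lemma Sol_unique (l : C) (y x x' : V) : Re l <> 0 -> Sol l y x -> Sol l y x' -> x = x'.
Proof.
  intros Hl H H'.
  assert (Hb : norm (minus x x') * Rabs (Re l) <= 0).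
  { eapply Rle_trans; [apply (Sol_bound _ _ _ (Sol_minus _ _ _ _ _ H H'))|].
    right; apply norm_zero_eq; vring V. }
  apply minus_zero_eq, norm_eq_zero.
  pose proof (norm_ge_0 (minus x x')); pose proof (Rabs_pos_lt _ Hl); nra.
Qed.

(** Both sides of x = R1 (y + (1 - l) x) depend continuously on l and x, so the equation passes to
    the limit. This is how it reaches points of the axis. *)
Lemma Sol_closed (l : C) (y x : V) :
  (forall e, 0 < e -> exists m z, Cmod (m - l) < e /\ norm (minus z x) < e /\ Sol m y z) ->
  Sol l y x.
Proof.
  intros H; destruct (linear_norm R1 R1_lin) as [K [HK HR]].
  apply minus_zero_eq, (norm_small_zero V); intros e He.
  pose proof (Cmod_ge_0 (1 - l)) as P; pose proof (norm_ge_0 x) as P'.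
  set (B := 1 + K * (Cmod (1 - l) + norm x + 1)).
  assert (HB : 1 <= B) by (unfold B; nra).
  set (d := Rmin 1 (e / B)).
  assert (Hd : 0 < d) by (apply Rmin_pos; [lra|apply Rdiv_lt_0_compat; lra]).
  assert (Hd1 : d <= 1) by apply Rmin_l; assert (Hd2 : d <= e / B) by apply Rmin_r.
  destruct (H d Hd) as [m [z [Hm [Hz Hs]]]].
  apply (norm_eq_le V _ (plus (minus x z)
    (R1 (plus (scal (1 - l)%C (minus z x)) (scal (l - m)%C z))))).
  { assert (Ez : z = plus (R1 (plus y (scal (1 - l)%C x)))
      (R1 (plus (scal (1 - l)%C (minus z x)) (scal (l - m)%C z)))).
    { etransitivity; [exact Hs|]; rewrite <- R1_plus; f_equal; vring V. }
    set (r := R1 (plus (scal (1 - l)%C (minus z x)) (scal (l - m)%C z))) in *.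
    rewrite Ez; vring V. }
  assert (Hzn : norm z <= norm x + 1) by (pose proof (norm_le_minus V z x); lra).
  apply Rle_trans with (d + K * (Cmod (1 - l) * d + d * (norm x + 1))).
  - apply (norm_plus_le V); [rewrite (norm_minus_sym V); lra|].
    eapply Rle_trans; [apply HR|apply Rmult_le_compat_l; [lra|]].
    apply (norm_plus_le V); apply norm_scal_le; try lra.
    rewrite Cmod_minus_sym; lra.
  - assert (T : B * d <= e).
    { apply (Rmult_le_compat_l B) in Hd2; [|lra].
      replace (B * (e / B)) with e in Hd2 by (field; lra); exact Hd2. }
    unfold B in T; nra.
Qed.

(* [x n = (c - D)^{-n-1} g], with geometric bounds. *)
Definition regdata (g : V) (c : C) (x : nat -> V) (M rho : R) : Prop :=
  0 < rho /\ (forall n, norm (x n) <= M * rho ^ n) /\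
  Sol c g (x O) /\ (forall n, Sol c (x n) (x (S n))).

(** Stands for holomorphy of the continued resolvent at c: [Reg_Gl_cdiff] and [cdiff_Reg] are the
    two directions. Being expressed by the equation itself, it is inherited by images under
    operators commuting with D. *)
Definition Reg (g : V) (c : C) : Prop := exists x M rho, regdata g c x M rho.

Lemma regdata_M (g : V) (c : C) (x : nat -> V) (M rho : R) : regdata g c x M rho -> 0 <= M.
Proof.
  intros [_ [H _]]; specialize (H O); simpl in H; pose proof (norm_ge_0 (x O)); lra.
Qed.

(** The equations of the chain, multiplied by powers of c - l and added up. The term with c - l lags
    one index behind, so the identity is exact and carries no remainder term. *)
Lemma regdata_partial (g : V) (c l : C) (x : nat -> V) (M rho : R) :
  regdata g c x M rho -> forall n,
  let S n := sum_n (fun n => scal ((c - l) ^ n)%C (x n)) n in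
  S (Datatypes.S n) = R1 (plus (plus g (scal (c - l)%C (S n))) (scal (1 - c)%C (S (Datatypes.S n)))).
Proof.
  intros [_ [_ [H0 Hn]]] n S; unfold S; clear S.
  assert (Ht : forall n, scal ((c - l) ^ Datatypes.S n)%C (x (Datatypes.S n)) =
    R1 (plus (scal ((c - l) ^ Datatypes.S n)%C (x n))
      (scal (1 - c)%C (scal ((c - l) ^ Datatypes.S n)%C (x (Datatypes.S n)))))).
  { intros k; exact (Sol_scal c ((c - l) ^ Datatypes.S k)%C _ _ (Hn k)). }
  induction n as [|n IH].
  - rewrite sum_Sn, sum_O.
    assert (H0' : scal ((c - l) ^ 0)%C (x O) = R1 (plus g (scal (1 - c)%C (scal ((c - l) ^ 0)%C (x O))))).
    { change ((c - l) ^ 0)%C with (RtoC 1); rewrite !(scal_one (V := V) (x O) : scal (RtoC 1) (x O) = _).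
      exact H0. }
    transitivity (plus (R1 (plus g (scal (1 - c)%C (scal ((c - l) ^ 0)%C (x O)))))
      (R1 (plus (scal ((c - l) ^ 1)%C (x O)) (scal (1 - c)%C (scal ((c - l) ^ 1)%C (x 1%nat)))))).
    + f_equal; [exact H0'|apply Ht].
    + rewrite <- R1_plus; f_equal; rewrite !Cpow_S; change ((c - l) ^ 0)%C with (RtoC 1); vring V.
  - rewrite sum_Sn.
    set (p := sum_n (fun n => scal ((c - l) ^ n)%C (x n)) (Datatypes.S n)) in *.
    set (t := scal ((c - l) ^ Datatypes.S (Datatypes.S n))%C (x (Datatypes.S (Datatypes.S n)))).
    set (p0 := sum_n (fun n => scal ((c - l) ^ n)%C (x n)) n) in *.
    assert (Ep : p = plus p0 (scal ((c - l) ^ Datatypes.S n)%C (x (Datatypes.S n))))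
      by apply sum_Sn.
    transitivity (plus (R1 (plus (plus g (scal (c - l)%C p0)) (scal (1 - c)%C p)))
      (R1 (plus (scal ((c - l) ^ Datatypes.S (Datatypes.S n))%C (x (Datatypes.S n)))
        (scal (1 - c)%C t)))).
    + f_equal; [exact IH|apply Ht].
    + rewrite <- R1_plus; f_equal.
      transitivity (plus (plus g (scal (c - l)%C (plus p0 (scal ((c - l) ^ Datatypes.S n)%C (x (Datatypes.S n))))))
        (scal (1 - c)%C (plus p t))).
      * rewrite (Cpow_S _ (Datatypes.S n)); vring V.
      * rewrite <- Ep; reflexivity.
Qed.

(** The Neumann series: in the limit of [regdata_partial] the two factors add up to (c - l) + (1 -
    c) = 1 - l. *)
Lemma regdata_Sol (g : V) (c l : C) (x : nat -> V) (M rho : R) (s : V) :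
  regdata g c x M rho -> ser V x (c - l)%C s -> Sol l g s.
Proof.
  intros Hd Hs; unfold Sol.
  destruct (linear_norm R1 R1_lin) as [K [HK HR]].
  pose proof (regdata_partial g c l x M rho Hd) as HP; cbv zeta in HP.
  pose proof (proj1 (is_series_norm_iff V _ _) Hs) as Hl; clear Hs Hd.
  set (S := sum_n (fun n => scal ((c - l) ^ n)%C (x n))) in *.
  apply minus_zero_eq, (norm_small_zero V); intros e He.
  pose proof (Cmod_ge_0 (c - l)) as P; pose proof (Cmod_ge_0 (1 - c)) as P'.
  set (B := 1 + K * (Cmod (c - l) + Cmod (1 - c))).
  assert (HB : 1 <= B) by (unfold B; nra).
  destruct (Hl (e / B)) as [N HN]; [apply Rdiv_lt_0_compat; lra|].
  pose proof (HN N (le_n N)) as H1; pose proof (HN (Datatypes.S N) (le_S _ _ (le_n N))) as H2.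
  apply (norm_eq_le V _ (plus (minus s (S (Datatypes.S N)))
    (R1 (plus (scal (c - l)%C (minus (S N) s)) (scal (1 - c)%C (minus (S (Datatypes.S N)) s)))))).
  { assert (Ez : S (Datatypes.S N) = plus (R1 (plus g (scal (1 - l)%C s)))
      (R1 (plus (scal (c - l)%C (minus (S N) s)) (scal (1 - c)%C (minus (S (Datatypes.S N)) s))))).
    { etransitivity; [exact (HP N)|]; rewrite <- R1_plus; f_equal; vring V. }
    set (r := R1 (plus (scal (c - l)%C (minus (S N) s)) _)) in *.
    rewrite Ez; vring V. }
  apply Rle_trans with (e / B + K * (Cmod (c - l) * (e / B) + Cmod (1 - c) * (e / B))).
  - apply (norm_plus_le V); [rewrite (norm_minus_sym V); left; exact H2|].
    eapply Rle_trans; [apply HR|apply Rmult_le_compat_l; [lra|]].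
    apply (norm_plus_le V); apply norm_scal_le;
      solve [apply Rle_refl | left; exact H1 | left; exact H2].
  - right; unfold B; field; fold B; lra.
Qed.

Lemma regdata_ser_ex (g : V) (c l : C) (x : nat -> V) (M rho : R) :
  regdata g c x M rho -> Cmod (c - l) * rho <= 1 / 2 -> exists s, ser V x (c - l)%C s.
Proof. intros [H1 [H2 _]]; apply (ser_ex V cV x M rho); [exact H2|lra]. Qed.

(** * Continuation of the resolvent across the axis *)

Definition right_lim (F : C -> V) (z : C) (L : V) : Prop :=
  forall e, 0 < e -> exists d, 0 < d /\ forall a : R, 0 < a < d ->
    norm (minus (F (z + RtoC a)%C) L) < e.

Lemma right_lim_unique (F : C -> V) (z : C) (L L' : V) :
  right_lim F z L -> right_lim F z L' -> L = L'.
Proof.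
  intros H H'; apply minus_zero_eq, (norm_small_zero V); intros e He.
  destruct (H (e / 2) ltac:(lra)) as [d [Hd K]], (H' (e / 2) ltac:(lra)) as [d' [Hd' K']].
  pose proof (Rmin_pos d d' Hd Hd').
  specialize (K (Rmin d d' / 2)); specialize (K' (Rmin d d' / 2)).
  pose proof (Rmin_l d d'); pose proof (Rmin_r d d').
  specialize (K ltac:(lra)); specialize (K' ltac:(lra)).
  rewrite (norm_minus_sym V) in K.
  pose proof (norm_minus_triangle V L (F (z + RtoC (Rmin d d' / 2))%C) L'); lra.
Qed.

(* The value of the continuation of [hat g] at [z], possibly on the axis. *)
Definition Gl (g : V) (z : C) : V := epsilon (inhabits zero) (right_lim (hat g) z).

Lemma Gl_eq (g : V) (z : C) (L : V) : right_lim (hat g) z L -> Gl g z = L.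
Proof.
  intros H; apply (right_lim_unique (hat g) z); [|exact H].
  unfold Gl; apply epsilon_spec; exists L; exact H.
Qed.

(** Near z the horizontal ray to the right of z avoids the axis, so [hat] is meaningful along it
    even when z lies on the axis. *)
Lemma shift_off_axis (z : C) : exists d, 0 < d /\ forall a : R, 0 < a < d ->
  Re (z + RtoC a) <> 0.
Proof.
  destruct z as [x y]; unfold Re; simpl.
  destruct (Req_dec x 0) as [->|Hx].
  - exists 1; split; [lra|]; intros; lra.
  - exists (Rabs x); split; [apply Rabs_pos_lt, Hx|]; intros a Ha E.
    assert (x = - a) by lra; subst x; rewrite Rabs_Ropp, Rabs_pos_eq in Ha; lra.
Qed.

Lemma right_lim_lipschitz (F : C -> V) (z : C) (L : V) (B d : R) : 0 < d ->
  (forall a : R, 0 < a < d -> norm (minus (F (z + RtoC a)%C) L) <= B * a) ->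
  right_lim F z L.
Proof.
  intros Hd H e He.
  assert (HB : 0 < Rabs B + 1) by (pose proof (Rabs_pos B); lra).
  exists (Rmin d (e / (Rabs B + 1))); split.
  { apply Rmin_pos; [lra|apply Rdiv_lt_0_compat; lra]. }
  intros a Ha; pose proof (Rmin_l d (e / (Rabs B + 1))); pose proof (Rmin_r d (e / (Rabs B + 1))).
  assert (T : a < e / (Rabs B + 1)) by lra.
  apply (Rmult_lt_compat_l (Rabs B + 1)) in T; [|lra].
  replace ((Rabs B + 1) * (e / (Rabs B + 1))) with e in T by (field; lra).
  eapply Rle_lt_trans; [apply H; lra|].
  pose proof (Rle_abs B); nra.
Qed.

(** At z + a the sum of the chain solves the resolvent equation and therefore equals [hat] by
    uniqueness off the axis; the Lipschitz bound then lets a tend to 0. *)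
Lemma regdata_right_lim (g : V) (c z : C) (x : nat -> V) (M rho : R) (s : V) :
  regdata g c x M rho -> Cmod (z - c) * rho < 1 / 4 -> ser V x (c - z)%C s ->
  right_lim (hat g) z s.
Proof.
  intros Hd Hz Hs; pose proof Hd as [Hr [Hx _]].
  destruct (shift_off_axis z) as [d [Hd1 Hd2]].
  (* Keeps z + a inside the disc of radius 1 / (4 rho) where [ser_lipschitz] applies. *)
  set (d' := Rmin d ((1 / 4 - Cmod (z - c) * rho) / rho)).
  assert (Hd' : 0 < d') by (apply Rmin_pos; [lra|apply Rdiv_lt_0_compat; lra]).
  apply (right_lim_lipschitz _ _ _ (8 * M * rho) d' Hd'); intros a Ha.
  pose proof (Rmin_l d ((1 / 4 - Cmod (z - c) * rho) / rho)) as H1.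
  pose proof (Rmin_r d ((1 / 4 - Cmod (z - c) * rho) / rho)) as H2; fold d' in H1, H2.
  assert (Ha2 : a < (1 / 4 - Cmod (z - c) * rho) / rho) by lra.
  apply (Rmult_lt_compat_r rho) in Ha2; [|lra].
  replace ((1 / 4 - Cmod (z - c) * rho) / rho * rho) with (1 / 4 - Cmod (z - c) * rho)
    in Ha2 by (field; lra).
  assert (Hza : Cmod (c - (z + RtoC a)) * rho <= 1 / 4).
  { replace (c - (z + RtoC a))%C with (- (z - c) + - RtoC a)%C by ring.
    pose proof (Cmod_triangle (- (z - c)) (- RtoC a)) as T.
    rewrite !Cmod_opp, Cmod_R, Rabs_pos_eq in T by lra.
    apply (Rmult_le_compat_r rho) in T; lra. }
  destruct (regdata_ser_ex g c (z + RtoC a) x M rho Hd ltac:(lra)) as [t Ht].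
  replace (hat g (z + RtoC a)%C) with t.
  - eapply Rle_trans.
    + apply (ser_lipschitz V x M rho (c - (z + RtoC a))%C (c - z)%C t s Hx);
        [lra|exact Hza|rewrite Cmod_minus_sym; lra|exact Ht|exact Hs].
    + replace (c - (z + RtoC a) - (c - z))%C with (- RtoC a)%C by ring.
      rewrite Cmod_opp, Cmod_R, Rabs_pos_eq; lra.
  - apply (Sol_unique (z + RtoC a)%C g); [apply Hd2; lra| |apply Sol_hat, Hd2; lra].
    exact (regdata_Sol g c _ x M rho t Hd Ht).
Qed.

Lemma regdata_Gl_ser (g : V) (c z : C) (x : nat -> V) (M rho : R) :
  regdata g c x M rho -> Cmod (z - c) * rho < 1 / 4 -> ser V x (c - z)%C (Gl g z).
Proof.
  intros Hd Hz; destruct (regdata_ser_ex g c z x M rho Hd) as [s Hs].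
  { rewrite Cmod_minus_sym; lra. }
  assert (E : Gl g z = s); [|rewrite E; exact Hs].
  apply Gl_eq; exact (regdata_right_lim g c z x M rho s Hd Hz Hs).
Qed.

Lemma ser_at_0 (x : nat -> V) : ser V x (RtoC 0) (x O).
Proof.
  assert (H := is_pseries_0 (K := C_AbsRing) (V := V) x).
  exact H.
Qed.

Lemma regdata_Gl_c (g : V) (c : C) (x : nat -> V) (M rho : R) :
  regdata g c x M rho -> right_lim (hat g) c (x O).
Proof.
  intros Hd; pose proof Hd as [Hr _].
  apply (regdata_right_lim g c c x M rho); [exact Hd| |].
  - replace (c - c)%C with (RtoC 0) by ring; rewrite Cmod_0; lra.
  - replace (c - c)%C with (RtoC 0) by ring; apply ser_at_0.
Qed.

Lemma Reg_Gl_Sol (g : V) (c : C) : Reg g c -> Sol c g (Gl g c).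
Proof.
  intros [x [M [rho Hd]]]; rewrite (Gl_eq g c (x O)); [apply Hd|].
  exact (regdata_Gl_c g c x M rho Hd).
Qed.

(** The chain is obtained by iterating the resolvent at c; each step costs a factor 1 / |Re c|. *)
Lemma Reg_off_axis (g : V) (c : C) : Re c <> 0 -> Reg g c.
Proof.
  intros Hc; pose proof (Rabs_pos_lt _ Hc) as Hp.
  set (x := fun n => Nat.iter (S n) (fun y => hat y c) g).
  exists x, (norm g / Rabs (Re c)), (/ Rabs (Re c)).
  assert (Hs : forall n, Sol c (x n) (x (S n))) by (intros n; apply Sol_hat, Hc).
  assert (H0 : Sol c g (x O)) by apply Sol_hat, Hc.
  repeat split; auto; [apply Rinv_0_lt_compat, Hp|].
  assert (Hdiv : forall a b, a * Rabs (Re c) <= b -> a <= b * / Rabs (Re c)).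
  { intros a b Hab; apply (Rmult_le_compat_r (/ Rabs (Re c))) in Hab;
      [|left; apply Rinv_0_lt_compat, Hp].
    rewrite Rmult_assoc, Rinv_r, Rmult_1_r in Hab by lra; exact Hab. }
  induction n as [|n IH].
  - simpl (_ ^ 0); rewrite Rmult_1_r; apply Hdiv, (Sol_bound _ _ _ H0).
  - eapply Rle_trans; [apply Hdiv, (Sol_bound _ _ _ (Hs n))|].
    simpl (_ ^ S n).
    apply (Rmult_le_compat_r (/ Rabs (Re c))) in IH; [|left; apply Rinv_0_lt_compat, Hp]; lra.
Qed.

Lemma Gl_off_axis (g : V) (c : C) : Re c <> 0 -> Gl g c = hat g c.
Proof.
  intros Hc; apply (Sol_unique c g); [exact Hc| |apply Sol_hat, Hc].
  apply Reg_Gl_Sol, Reg_off_axis, Hc.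
Qed.

Lemma Reg_Gl_cdiff (g : V) (c : C) : Reg g c -> ex_derive (K := C_AbsRing) (Gl g) c.
Proof.
  intros [x [M [rho Hd]]]; pose proof Hd as [Hr _].
  (* The expansion is in powers of c - z, hence the sign. *)
  exists (scal (- (1))%C (x 1%nat)).
  assert (E : scal (- (1))%C (x 1%nat) = scal ((- (1)) ^ 1)%C (x 1%nat)) by (rewrite Cpow_1_r; reflexivity).
  apply (eq_ind_r (fun t => is_derive (K := C_AbsRing) (Gl g) c t)) with (2 := E).
  apply (ser_cdiff V cV (Gl g) (fun n => scal ((- (1)) ^ n)%C (x n)) c (1 / 4 / rho)).
  { apply Rdiv_lt_0_compat; lra. }
  intros z Hz; replace (z - c)%C with (- (c - z))%C by ring.
  apply ser_opp; apply (regdata_Gl_ser g c z x M rho Hd).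
  apply (Rmult_lt_compat_r rho) in Hz; [|lra].
  replace (1 / 4 / rho * rho) with (1 / 4) in Hz by (field; lra); exact Hz.
Qed.

(** * Laurent coefficients at a point of the axis *)

Section Laurent.

Variables (F : C -> V) (c : C).

(* The integrand [zeta^k F (c + zeta)] in the logarithmic coordinate
   [zeta = cexp z]; circles become vertical segments. *)
Definition circ (k : R) (z : C) : V :=
  scal (cexp (RtoC k * z)%C) (F (c + cexp z)%C).

Lemma circ_cdiff (k : R) (z : C) :
  ex_derive (K := C_AbsRing) F (c + cexp z)%C ->
  ex_derive (K := C_AbsRing) (circ k) z.
Proof.
  intros [l Hl].
  assert (H1 : is_derive (K := C_AbsRing) (V := AbsRing_NormedModule C_AbsRing)
    (fun z : C => c + cexp z)%C z (cexp z)).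
  { apply (proj2 (is_derive_C_iff (AbsRing_NormedModule C_AbsRing) (fun z : C => c + cexp z)%C z (cexp z))).
    intros e He.
    destruct (proj1 (is_derive_C_iff (AbsRing_NormedModule C_AbsRing) cexp z (cexp z))
      (is_derive_cexp z) e He) as [d [Hd H]].
    exists d; split; [exact Hd|]; intros w Hw; specialize (H w Hw).
    refine (eq_ind _ (fun t => Cmod t <= e * Cmod (w - z)) H _ _).
    change ((cexp w - cexp z) - (w - z) * cexp z = (c + cexp w - (c + cexp z)) - (w - z) * cexp z)%C.
    ring. }
  assert (H2 : is_derive (K := C_AbsRing) (V := AbsRing_NormedModule C_AbsRing)
    (fun z : C => RtoC k * z)%C z (RtoC k)).
  { apply (proj2 (is_derive_C_iff (AbsRing_NormedModule C_AbsRing) (fun z : C => RtoC k * z)%C z (RtoC k))).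
    intros e He; exists 1; split; [lra|]; intros w _.
    change (Cmod ((RtoC k * w - RtoC k * z) - (w - z) * RtoC k)%C <= e * Cmod (w - z)).
    replace ((RtoC k * w - RtoC k * z) - (w - z) * RtoC k)%C with (RtoC 0) by ring.
    rewrite Cmod_0; apply Rmult_le_pos; [lra|apply Cmod_ge_0]. }
  pose proof (is_derive_comp (V := V) F (fun z : C => c + cexp z)%C z l (cexp z) Hl H1) as H3.
  pose proof (is_derive_comp (V := AbsRing_NormedModule C_AbsRing) cexp (fun z : C => RtoC k * z)%C z
    _ _ (is_derive_cexp _) H2) as H4.
  pose proof (filterdiff_scal_fct (K := C_AbsRing) (U := AbsRing_NormedModule C_AbsRing) (V := V) z _ _ _ _ Cmult_comm H4 H3) as H5.
  eexists; refine (filterdiff_ext_lin _ _ _ H5 _); intros y.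
  instantiate (1 := plus (scal (RtoC k * cexp (RtoC k * z))%C (F (c + cexp z)%C))
    (scal (cexp (RtoC k * z))%C (scal (cexp z) l))).
  vring V.
Qed.

Variables (g : V) (R0 : R).
Hypothesis c_axis : Re c = 0.
Hypothesis F_sol : forall z, 0 < Cmod (z - c) < R0 ->
  ex_derive (K := C_AbsRing) F z /\ Sol z g (F z).

Lemma circ_point (s t : R) : 0 < s -> Cmod (cexp (ln s, t)) = s.
Proof. intros Hs; rewrite Cmod_cexp; apply exp_ln, Hs. Qed.

Lemma circ_cdiff_on (k s1 s2 : R) : 0 < s1 -> 0 < s2 < R0 ->
  cdiff_on V (circ k) (ln s1) (ln s2) 0 (2 * PI).
Proof.
  intros H1 H2 x y Hx Hy; apply circ_cdiff, F_sol.
  replace (c + cexp (x, y) - c)%C with (cexp (x, y)) by ring; rewrite Cmod_cexp.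
  unfold Re; simpl; split; [apply exp_pos|].
  apply Rle_lt_trans with (exp (ln s2)); [|rewrite exp_ln; lra].
  destruct (proj2 Hx) as [H|H]; [left; apply exp_increasing, H|rewrite H; right; reflexivity].
Qed.

(** Up to the factor 2 pi this is the Laurent coefficient of order -k, because zeta^{k-1} d zeta = i
    zeta^k d theta on the circle. *)
Definition circ_int (k s : R) : V :=
  rint V cV (fun t => circ k (ln s, t)) 0 (2 * PI).

Lemma circ_int_correct (k s : R) : 0 < s < R0 ->
  is_RInt (V := RSN V) (fun t => circ k (ln s, t)) 0 (2 * PI) (circ_int k s).
Proof.
  intros Hs; pose proof PI_RGT_0; apply is_RInt_rint; [lra|].
  intros t Ht; apply (cdiff_vcont V (circ k) (ln s) (ln s) 0 (2 * PI)); [|lra|exact Ht].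
  apply circ_cdiff_on; lra.
Qed.

Lemma cexp_INR (n : nat) (z : C) : cexp (RtoC (INR n) * z) = (cexp z ^ n)%C.
Proof.
  induction n as [|n IH]; [simpl INR; replace (RtoC 0 * z)%C with (RtoC 0) by ring; apply cexp_0|].
  rewrite S_INR, RtoC_plus, Cpow_S, <- IH, <- cexp_plus; f_equal; ring.
Qed.

Lemma cexp_opp_INR (n : nat) (z : C) : cexp (RtoC (- INR n) * z) = ((/ cexp z) ^ n)%C.
Proof.
  rewrite <- cexp_opp, <- cexp_INR; f_equal; rewrite RtoC_opp; ring.
Qed.

(** Real exponents allow k + 1 and negative k in a uniform notation. Periodicity, which holds for
    integers, makes the segment from 0 to 2 pi a closed circle. *)
Definition periodic_weight (k : R) : Prop :=
  forall x : R, cexp (RtoC k * (x, 2 * PI)) = cexp (RtoC k * (x, 0)).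

Lemma cexp_2PI (x : R) : cexp (x, 2 * PI) = cexp (x, 0).
Proof. unfold cexp, Re, Im; simpl; rewrite cos_2PI, sin_2PI, cos_0, sin_0; reflexivity. Qed.

Lemma periodic_INR (n : nat) : periodic_weight (INR n).
Proof. intros x; rewrite !cexp_INR, cexp_2PI; reflexivity. Qed.

Lemma periodic_opp_INR (n : nat) : periodic_weight (- INR n).
Proof. intros x; rewrite !cexp_opp_INR, cexp_2PI; reflexivity. Qed.

(** Goursat on the rectangle between ln s1 and ln s2 of height 2 pi: the horizontal sides cancel by
    periodicity, and the vertical ones are the two circles. *)
Lemma circ_int_const (k s1 s2 : R) : periodic_weight k -> 0 < s1 <= s2 -> s2 < R0 ->
  circ_int k s1 = circ_int k s2.
Proof.
  intros Hk H1 H2; pose proof PI_RGT_0.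
  assert (Hln : ln s1 <= ln s2).
  { destruct (proj2 H1) as [H'|H']; [left; apply ln_increasing; lra|rewrite H'; lra]. }
  pose proof (Goursat_rectangle V cV (circ k) (ln s1) (ln s2) 0 (2 * PI) Hln ltac:(lra)
    (circ_cdiff_on k s1 s2 ltac:(lra) ltac:(lra))) as G.
  unfold boundary_int in G.
  assert (E : (fun x => circ k (x, 2 * PI)) = (fun x => circ k (x, 0))).
  { apply functional_extensionality; intros x; unfold circ; rewrite Hk, cexp_2PI; reflexivity. }
  rewrite E in G; fold (circ_int k s1) (circ_int k s2) in G.
  apply minus_zero_eq.
  (* Multiplication by i turns i (I2 - I1) into I1 - I2. *)
  transitivity (scal Ci (plus (minus (rint V cV (fun x => circ k (x, 0)) (ln s1) (ln s2))
    (rint V cV (fun x => circ k (x, 0)) (ln s1) (ln s2)))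
    (scal Ci (minus (circ_int k s2) (circ_int k s1))))).
  - vreduce V; unfold Ci; apply injective_projections; simpl; ring.
  - etransitivity; [apply (f_equal (fun w => scal Ci w)), G|apply (scal_zero_r (V := V))].
Qed.

(** The integrand is the derivative of the periodic function e^{ikt} / (ik), up to a constant
    factor. *)
Lemma circ_const_int (k s : R) : k <> 0 -> periodic_weight k ->
  is_RInt (V := RSN V) (fun t => scal (cexp (RtoC k * (ln s, t))%C) g) 0 (2 * PI) zero.
Proof.
  intros Hk Hp; pose proof PI_RGT_0.
  set (l := (RtoC k * Ci)%C); set (e0 := cexp (RtoC k * RtoC (ln s))).
  assert (Hl : l <> 0).
  { unfold l, Ci, RtoC, Cmult; simpl; intros E; injection E; intros; apply Hk; lra. }
  assert (Ee : forall t, cexp (RtoC k * (ln s, t)) = (e0 * cexp (l * RtoC t))%C).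
  { intros t; unfold e0; rewrite <- cexp_plus; f_equal; unfold l.
    replace ((ln s, t) : C) with (RtoC (ln s) + Ci * RtoC t)%C; [ring|].
    unfold Ci, RtoC, Cmult, Cplus; simpl; f_equal; ring. }
  assert (Hder : forall (u : V) t, is_derive (V := RSN V)
    (fun t => scal (cexp (l * RtoC t)%C) u) t (scal (l * cexp (l * RtoC t))%C u)).
  { intros u t.
    pose proof (is_derive_scal_fct V (fun t => cexp (l * RtoC t)%C) (fun _ => u) t _ _
      (is_derive_cexp_line l t) (is_derive_const (V := RSN V) u t)) as H1.
    refine (eq_ind _ (fun w => is_derive (V := RSN V) _ t w) H1 _ _).
    change (@zero (RSN V)) with (@zero V); vring V. }
  pose proof (is_RInt_derive_C V cV (fun t => scal (cexp (l * RtoC t)%C) (scal (e0 / l)%C g))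
    (fun t => scal (l * cexp (l * RtoC t))%C (scal (e0 / l)%C g)) 0 (2 * PI) ltac:(lra)
    (fun t _ => Hder _ t)) as HI.
  assert (Ef : (fun t => scal (l * cexp (l * RtoC t))%C (scal (e0 / l)%C g)) =
    (fun t => scal (cexp (RtoC k * (ln s, t))%C) g)).
  { apply functional_extensionality; intros t; rewrite Ee; vreduce V; field; exact Hl. }
  assert (Ez : minus (scal (cexp (l * RtoC (2 * PI))%C) (scal (e0 / l)%C g))
     (scal (cexp (l * RtoC 0)%C) (scal (e0 / l)%C g)) = zero).
  { specialize (Hp (ln s)); rewrite !Ee in Hp.
    assert (Hp' : cexp (l * RtoC (2 * PI)) = cexp (l * RtoC 0)).
    { pose proof (cexp_neq_0 (RtoC k * RtoC (ln s))) as Hn; fold e0 in Hn.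
      replace (cexp (l * RtoC (2 * PI))) with (/ e0 * (e0 * cexp (l * RtoC (2 * PI))))%C
        by (field; exact Hn).
      rewrite Hp; field; exact Hn. }
    rewrite Hp'; vring V. }
  rewrite Ef in HI; refine (eq_ind _ (fun w => is_RInt (V := RSN V) _ 0 (2 * PI) w) (HI _) _ Ez).
  intros t Ht; rewrite <- Ef.
  apply (is_derive_continuous_R V _ _ (scal (l * cexp (l * RtoC t))%C (scal e0 g))).
  refine (eq_ind _ (fun h => is_derive (V := RSN V) h t _) (Hder (scal e0 g) t) _ _).
  apply functional_extensionality; intros r; vreduce V; field; exact Hl.
Qed.

(** At c + zeta the equation reads (c - D) F = g - zeta F; it is multiplied by zeta^k and
    integrated, with [R1] taken through the integral. *)
Lemma circ_int_rel (k s : R) (G : V) : 0 < s < R0 ->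
  is_RInt (V := RSN V) (fun t => scal (cexp (RtoC k * (ln s, t))%C) g) 0 (2 * PI) G ->
  Sol c (minus G (circ_int (k + 1) s)) (circ_int k s).
Proof.
  intros Hs HG.
  pose proof (circ_int_correct k s Hs) as H1.
  pose proof (circ_int_correct (k + 1) s Hs) as H2.
  pose proof (is_RInt_plus (V := RSN V) _ _ _ _ _ _
    (is_RInt_minus (V := RSN V) _ _ _ _ _ _ HG H2) (is_RInt_scalC V (1 - c)%C _ _ _ _ H1)) as H3.
  pose proof (is_RInt_linear V V R1 _ _ _ _ R1_lin H3) as H4.
  unfold Sol; transitivity (rint V cV (fun t => circ k (ln s, t)) 0 (2 * PI)); [reflexivity|].
  apply rint_unique; refine (eq_ind _ (fun h => is_RInt (V := RSN V) h _ _ _) H4 _ _).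
  apply functional_extensionality; intros t; symmetry.
  destruct (F_sol (c + cexp (ln s, t))%C) as [_ HF].
  { replace (c + cexp (ln s, t) - c)%C with (cexp (ln s, t)) by ring; rewrite circ_point; lra. }
  apply (Sol_scal _ (cexp (RtoC k * (ln s, t)))) in HF.
  etransitivity; [exact HF|]; apply (f_equal R1); unfold circ.
  assert (Ek : cexp (RtoC (k + 1) * (ln s, t)) = (cexp (RtoC k * (ln s, t)) * cexp (ln s, t))%C).
  { rewrite <- cexp_plus; f_equal; rewrite RtoC_plus; ring. }
  rewrite Ek.
  change (@plus (RSN V)) with (@plus V); change (@minus (RSN V)) with (@minus V); vring V.
Qed.

(** On the circle s^2 is zeta times its conjugate, so the integrand is 2 zeta Re(zeta) F. As Re c =
    0, [Sol_bound] gives |Re(zeta)| |F| <= |g|, hence a bound by |g| alone, which F itself does not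
    have near the axis. *)
Lemma circ_bound_pos (s : R) : 0 < s < R0 ->
  norm (plus (circ_int 2 s) (scal (RtoC (s * s)) (circ_int 0 s))) <=
  2 * PI * (2 * s * norm g).
Proof.
  intros Hs; pose proof PI_RGT_0.
  pose proof (is_RInt_plus (V := RSN V) _ _ _ _ _ _ (circ_int_correct 2 s Hs)
    (is_RInt_scalC V (RtoC (s * s)) _ _ _ _ (circ_int_correct 0 s Hs))) as HI.
  replace (2 * PI) with (2 * PI - 0) by ring.
  refine (norm_RInt_le_bound V _ 0 (2 * PI) _ _ _ _ HI); [lra|]; intros t _.
  change (@plus (RSN V)) with (@plus V); unfold circ.
  set (zt := cexp (ln s, t)).
  destruct (F_sol (c + zt)%C) as [_ HF].
  { replace (c + zt - c)%C with zt by ring; unfold zt; rewrite circ_point; lra. }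
  apply Sol_bound in HF; set (f := F (c + zt)%C) in *.
  assert (Hre : Re (c + zt) = Re zt).
  { unfold Re in *; simpl; rewrite c_axis; ring. }
  rewrite Hre in HF.
  assert (E2 : cexp (RtoC 2 * (ln s, t)) = (zt * zt)%C).
  { change 2 with (INR 2); rewrite cexp_INR; unfold zt; simpl; ring. }
  assert (E0 : cexp (RtoC 0 * (ln s, t)) = RtoC 1).
  { rewrite <- cexp_0; f_equal; ring. }
  assert (Es : RtoC (s * s) = (zt * Cconj zt)%C).
  { rewrite <- Cmod2_conj; unfold zt; rewrite circ_point by lra.
    f_equal; ring. }
  rewrite E2, E0, Es.
  apply (norm_eq_le V _ (scal (zt * RtoC (2 * Re zt))%C f)).
  { vreduce V; destruct zt as [p q]; unfold Cconj, Re, Cmult, Cplus, RtoC; simpl.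
    apply injective_projections; simpl; ring. }
  rewrite norm_scalC, Cmod_mult, Cmod_R, Rabs_mult, (Rabs_pos_eq 2) by lra.
  unfold zt at 1; rewrite circ_point by lra.
  apply (Rmult_le_compat_l (2 * s)) in HF; lra.
Qed.

(** The ordinary Cauchy estimate, with M coming from the maximum of |F| on the one circle
    considered. *)
Lemma circ_int_bound (s : R) : 0 < s < R0 ->
  exists M, forall n, norm (circ_int (- INR n) s) <= M * (/ s) ^ n.
Proof.
  intros Hs; pose proof PI_RGT_0.
  assert (Hc : forall t, 0 <= t <= 2 * PI -> continuous (fun t => circ 0 (ln s, t)) t).
  { intros t Ht; apply (cdiff_vcont V (circ 0) (ln s) (ln s) 0 (2 * PI)); [|lra|exact Ht].
    apply circ_cdiff_on; lra. }
  destruct (bounded_continuity (V := V) (fun t => circ 0 (ln s, t)) 0 (2 * PI)) as [M HM].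
  { exact Hc. }
  exists (2 * PI * M); intros n.
  replace (2 * PI * M * (/ s) ^ n) with ((2 * PI - 0) * (M * (/ s) ^ n)) by ring.
  refine (norm_RInt_le_bound V _ 0 (2 * PI) _ _ _ _ (circ_int_correct (- INR n) s Hs)); [lra|].
  intros t Ht; specialize (HM t Ht); unfold circ in *.
  rewrite norm_scalC in HM |- *.
  rewrite cexp_opp_INR, Cmod_pow, Cmod_inv, circ_point by (try apply cexp_neq_0; lra).
  replace (RtoC 0 * (ln s, t))%C with (RtoC 0) in HM by ring.
  rewrite cexp_0, Cmod_1, Rmult_1_l in HM.
  rewrite Rmult_comm; apply Rmult_le_compat_r; [|lra].
  apply pow_le; left; apply Rinv_0_lt_compat; lra.
Qed.

(* The Laurent coefficient of order [-2] vanishes because of the bound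
   [|F| |Re| <= |g|], tested against the weight [zeta^2 + s^2 = 2 zeta Re zeta];
   hence the residue [Q] is an eigenvector, and the regular part of the expansion
   solves the resolvent equation for [g - Q]. *)
Theorem laurent : 0 < R0 -> exists Q x M rho,
  Sol c zero Q /\ regdata (minus g Q) c x M rho /\
  forall s, 0 < s < R0 -> s * norm (x O) <= 2 * norm g.
Proof.
  intros HR; pose proof PI_RGT_0.
  (* All coefficients are read off on this one circle; the radius varies only in the estimate
     [Hb]. *)
  set (s0 := R0 / 2); assert (Hs0 : 0 < s0 < R0) by (unfold s0; lra).
  assert (Hconst : forall k s, periodic_weight k -> 0 < s < R0 -> circ_int k s = circ_int k s0).
  { intros k s Hk Hs; destruct (Rle_dec s s0).
    - apply circ_int_const; auto; lra.
    - symmetry; apply circ_int_const; auto; lra. }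
  assert (P0 : periodic_weight 0) by apply (periodic_INR 0).
  assert (P2 : periodic_weight 2) by apply (periodic_INR 2).
  assert (Hb : forall s, 0 < s < R0 ->
    norm (plus (circ_int 2 s0) (scal (RtoC (s * s)) (circ_int 0 s0))) <= 2 * PI * (2 * s * norm g)).
  { intros s Hs; rewrite <- (Hconst 2 s P2 Hs), <- (Hconst 0 s P0 Hs); apply circ_bound_pos, Hs. }
  set (q0 := circ_int 0 s0) in *.
  pose proof (norm_ge_0 g) as Pg; pose proof (norm_ge_0 q0) as Pq.
  (* As s tends to 0, both the term with s^2 and the right-hand side of [Hb] vanish. *)
  assert (Z2 : circ_int 2 s0 = zero).
  { apply (norm_small_zero V); intros e He.
    set (B := 2 * PI * (2 * norm g) + norm q0 + 1); assert (HB : 0 < B) by (unfold B; nra).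
    set (s := Rmin (Rmin 1 s0) (e / B)).
    assert (H1 : 0 < s) by (repeat apply Rmin_pos; try lra; apply Rdiv_lt_0_compat; lra).
    assert (H2 : s <= Rmin 1 s0) by apply Rmin_l; assert (H3 : s <= e / B) by apply Rmin_r.
    pose proof (Rmin_l 1 s0); pose proof (Rmin_r 1 s0).
    specialize (Hb s ltac:(lra)).
    assert (HN : norm (scal (RtoC (s * s)) q0) <= s * norm q0).
    { rewrite norm_scalC, Cmod_R, Rabs_pos_eq by nra; apply Rmult_le_compat_r; nra. }
    apply (norm_eq_le V _ (minus (plus (circ_int 2 s0) (scal (RtoC (s * s)) q0)) (scal (RtoC (s * s)) q0))).
    { vring V. }
    eapply Rle_trans; [apply norm_minus_le|].
    apply (Rmult_le_compat_l B) in H3; [|lra].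
    replace (B * (e / B)) with e in H3 by (field; lra).
    unfold B in H3; nra. }
  set (k := RtoC (/ (2 * PI))).
  assert (Hk : Cmod k = / (2 * PI)).
  { unfold k; rewrite Cmod_R; apply Rabs_pos_eq; left; apply Rinv_0_lt_compat; lra. }
  set (Q := scal k (circ_int 1 s0)).
  (* The chain is summed in powers of c - z, so the coefficient of order n enters with the sign
     (-1)^n; this also turns (c - D) Q_n = - Q_{n-1} into (c - D) x_n = x_{n-1}. *)
  set (x := fun n => scal (((- (1)) ^ n) * k)%C (circ_int (- INR n) s0)).
  destruct (circ_int_bound s0 Hs0) as [M HM].
  exists Q, x, (/ (2 * PI) * M), (/ s0); split; [|split].
  - assert (H1 : Sol c (minus zero (circ_int (1 + 1) s0)) (circ_int 1 s0)).
    { apply circ_int_rel; [exact Hs0|]; apply circ_const_int; [lra|apply (periodic_INR 1)]. }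
    apply (Sol_scal _ k) in H1; fold Q in H1.
    replace (1 + 1) with 2 in H1 by ring; rewrite Z2 in H1.
    refine (eq_ind _ (fun w => Sol c w Q) H1 _ _); vring V.
  - split; [apply Rinv_0_lt_compat; lra|]; split; [|split].
    + intros n; unfold x; rewrite norm_scalC, Cmod_mult, Cmod_pow, Cmod_m1, pow1, Hk.
      rewrite Rmult_1_l, Rmult_assoc; apply Rmult_le_compat_l; [|apply HM].
      left; apply Rinv_0_lt_compat; lra.
    + assert (H1 : Sol c (minus (scal (RtoC (2 * PI)) g) (circ_int (0 + 1) s0)) (circ_int 0 s0)).
      { apply circ_int_rel; [exact Hs0|].
        pose proof (is_RInt_const (V := RSN V) 0 (2 * PI) g) as H1.
        rewrite Rminus_0_r in H1.
        refine (eq_ind _ (fun h => is_RInt (V := RSN V) h 0 (2 * PI) _) H1 _ _).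
        apply functional_extensionality; intros t.
        replace (RtoC 0 * (ln s0, t))%C with (RtoC 0) by ring; rewrite cexp_0; vring V. }
      apply (Sol_scal _ k) in H1; rewrite Rplus_0_l in H1.
      assert (Ex : x O = scal k (circ_int 0 s0)).
      { unfold x; simpl INR; rewrite Ropp_0; change ((- (1)) ^ 0)%C with (RtoC 1); vring V. }
      rewrite Ex; refine (eq_ind _ (fun w => Sol c w _) H1 _ _); unfold Q, k.
      vreduce V; rewrite ?RtoC_inv by lra; field; intros E; injection E; lra.
    + intros n.
      assert (H1 : Sol c (minus zero (circ_int (- INR (S n) + 1) s0)) (circ_int (- INR (S n)) s0)).
      { apply circ_int_rel; [exact Hs0|]; apply circ_const_int; [|apply periodic_opp_INR].
        rewrite S_INR; pose proof (pos_INR n); lra. }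
      apply (Sol_scal _ ((- (1)) ^ S n * k)%C) in H1; fold (x (S n)) in H1.
      replace (- INR (S n) + 1) with (- INR n) in H1 by (rewrite S_INR; ring).
      refine (eq_ind _ (fun w => Sol c w _) H1 _ _); unfold x; rewrite Cpow_S; vring V.
  (* Without the coefficient of order -2, [Hb] bounds s^2 |q0| by 4 pi s |g|; it remains to divide
     by 2 pi s. *)
  - intros s Hs; specialize (Hb s Hs); rewrite Z2 in Hb.
    assert (Hb' : s * s * norm q0 <= 2 * PI * (2 * s * norm g)).
    { refine (Rle_trans _ _ _ _ Hb); right.
      transitivity (norm (scal (RtoC (s * s)) q0)).
      - rewrite norm_scalC, Cmod_R, Rabs_pos_eq; [reflexivity|nra].
      - apply f_equal; symmetry; apply (plus_zero_l (G := V)). }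
    unfold x; rewrite norm_scalC; simpl INR; rewrite Ropp_0; fold q0.
    change ((- (1)) ^ 0)%C with (RtoC 1); rewrite Cmult_1_l, Hk.
    apply (Rmult_le_compat_l (/ (2 * PI) * / s)) in Hb';
      [|left; apply Rmult_lt_0_compat; apply Rinv_0_lt_compat; lra].
    replace (/ (2 * PI) * / s * (s * s * norm q0)) with (s * (/ (2 * PI) * norm q0)) in Hb'
      by (field; lra).
    replace (/ (2 * PI) * / s * (2 * PI * (2 * s * norm g))) with (2 * norm g) in Hb'
      by (field; lra).
    exact Hb'.
Qed.

End Laurent.

(** * Residues and the removal of singularities *)

Lemma residue_expansion (g Q : V) (c l : C) (x : nat -> V) (M rho : R) (s : V) :
  Sol c zero Q -> regdata (minus g Q) c x M rho -> Re l <> 0 -> l <> c ->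
  ser V x (c - l)%C s -> hat g l = plus s (scal (/ (l - c))%C Q).
Proof.
  intros HQ Hd Hl Hlc Hs.
  assert (Hne : (l - c)%C <> 0).
  { intros E; apply Hlc; replace l with (l - c + c)%C by ring; rewrite E; ring. }
  assert (H1 : Sol l Q (scal (/ (l - c))%C Q)).
  { apply (Sol_scal _ (/ (l - c))%C) in HQ; unfold Sol in HQ |- *.
    etransitivity; [exact HQ|]; apply (f_equal R1); vreduce V; field; exact Hne. }
  pose proof (Sol_plus _ _ _ _ _ (regdata_Sol _ _ _ _ _ _ _ Hd Hs) H1) as H2.
  apply (Sol_unique l g); [exact Hl|apply Sol_hat, Hl|].
  refine (eq_ind _ (fun w => Sol l w _) H2 _ _); vring V.
Qed.

Lemma cdiff_continuous (F : C -> V) (z : C) : ex_derive (K := C_AbsRing) F z ->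
  forall e, 0 < e -> exists d, 0 < d /\ forall w, Cmod (w - z) < d -> norm (minus (F w) (F z)) < e.
Proof.
  intros [l Hl] e He; pose proof (norm_ge_0 l) as P.
  destruct (proj1 (is_derive_C_iff V F z l) Hl 1 Rlt_0_1) as [d [Hd H]].
  exists (Rmin d (e / (norm l + 2))); split.
  { apply Rmin_pos; [lra|apply Rdiv_lt_0_compat; lra]. }
  intros w Hw; pose proof (Rmin_l d (e / (norm l + 2))); pose proof (Rmin_r d (e / (norm l + 2))).
  specialize (H w ltac:(lra)).
  assert (T : Cmod (w - z) < e / (norm l + 2)) by lra.
  apply (Rmult_lt_compat_l (norm l + 2)) in T; [|lra].
  replace ((norm l + 2) * (e / (norm l + 2))) with e in T by (field; lra).
  pose proof (norm_le_minus V (minus (F w) (F z)) (scal (w - z)%C l)) as T2.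
  rewrite (norm_scalC V (w - z)) in T2; pose proof (Cmod_ge_0 (w - z)); lra.
Qed.

(** On the axis the value of a holomorphic extension is forced by continuity, which ties it to the
    canonical continuation [Gl]. *)
Lemma cdiff_right_lim (F : C -> V) (g : V) (z : C) (r : R) : 0 < r ->
  ex_derive (K := C_AbsRing) F z ->
  (forall w, Cmod (w - z) < r -> Re w <> 0 -> F w = hat g w) ->
  right_lim (hat g) z (F z).
Proof.
  intros Hr HF Hw e He.
  destruct (cdiff_continuous F z HF e He) as [d [Hd Hc]].
  destruct (shift_off_axis z) as [d' [Hd' Hoff]].
  exists (Rmin (Rmin d d') r); split; [repeat apply Rmin_pos; lra|]; intros a Ha.
  pose proof (Rmin_l (Rmin d d') r); pose proof (Rmin_r (Rmin d d') r).
  pose proof (Rmin_l d d'); pose proof (Rmin_r d d').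
  assert (E : Cmod (z + RtoC a - z) = a).
  { replace (z + RtoC a - z)%C with (RtoC a) by ring; rewrite Cmod_R, Rabs_pos_eq; lra. }
  rewrite <- Hw; [apply Hc; rewrite E; lra|rewrite E; lra|apply Hoff; lra].
Qed.

Lemma right_lim_Sol (g : V) (z : C) (L : V) : right_lim (hat g) z L -> Sol z g L.
Proof.
  intros H; apply Sol_closed; intros e He.
  destruct (H e He) as [d [Hd Hl]]; destruct (shift_off_axis z) as [d' [Hd' Hoff]].
  set (a := Rmin (Rmin d d') e / 2).
  assert (0 < Rmin (Rmin d d') e) by (repeat apply Rmin_pos; lra).
  pose proof (Rmin_l (Rmin d d') e); pose proof (Rmin_r (Rmin d d') e).
  pose proof (Rmin_l d d'); pose proof (Rmin_r d d').
  exists (z + RtoC a)%C, (hat g (z + RtoC a)%C); split; [|split].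
  - replace (z + RtoC a - z)%C with (RtoC a) by ring; rewrite Cmod_R, Rabs_pos_eq; unfold a; lra.
  - apply Hl; unfold a; lra.
  - apply Sol_hat, Hoff; unfold a; lra.
Qed.

(** At l = c + a one has Q = a (hat g l - s). The bracket stays bounded when [hat g] has a right
    limit at c, while a tends to 0. *)
Lemma residue_zero (g Q : V) (c : C) (x : nat -> V) (M rho : R) (L : V) : Re c = 0 ->
  Sol c zero Q -> regdata (minus g Q) c x M rho -> right_lim (hat g) c L -> Q = zero.
Proof.
  intros Hc HQ Hd HL; pose proof Hd as [Hr [Hx _]].
  pose proof (regdata_M _ _ _ _ _ Hd) as HM.
  destruct (HL 1 Rlt_0_1) as [d [Hd0 HL']].
  apply (norm_small_zero V); intros e He.
  pose proof (norm_ge_0 L) as P1; pose proof (norm_ge_0 (x O)) as P2.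
  set (B := norm L + 1 + norm (x O) + 2 * M); assert (HB : 0 < B) by (unfold B; lra).
  (* Half of the minimum: [HL'] needs a strictly below d. *)
  set (a := Rmin (Rmin d (1 / 2 / rho)) (e / B) / 2).
  assert (Hpos : 0 < Rmin (Rmin d (1 / 2 / rho)) (e / B)).
  { repeat apply Rmin_pos; try lra; apply Rdiv_lt_0_compat; lra. }
  pose proof (Rmin_l (Rmin d (1 / 2 / rho)) (e / B)) as M1.
  pose proof (Rmin_r (Rmin d (1 / 2 / rho)) (e / B)) as M2.
  pose proof (Rmin_l d (1 / 2 / rho)) as M3; pose proof (Rmin_r d (1 / 2 / rho)) as M4.
  assert (Ha : 0 < a) by (unfold a; lra).
  assert (Har : a * rho <= 1 / 2).
  { assert (T : a <= 1 / 2 / rho) by (unfold a; lra).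
    apply (Rmult_le_compat_r rho) in T; [|lra].
    replace (1 / 2 / rho * rho) with (1 / 2) in T by (field; lra); exact T. }
  assert (HaB : B * a <= e).
  { assert (T : a <= e / B) by (unfold a; lra).
    apply (Rmult_le_compat_l B) in T; [|lra].
    replace (B * (e / B)) with e in T by (field; lra); exact T. }
  set (l := (c + RtoC a)%C).
  assert (El : (c - l)%C = (- RtoC a)%C) by (unfold l; ring).
  assert (Hma : Cmod (c - l) = a) by (rewrite El, Cmod_opp, Cmod_R, Rabs_pos_eq; lra).
  destruct (regdata_ser_ex _ _ l _ _ _ Hd ltac:(rewrite Hma; lra)) as [s Hs].
  pose proof (ser_near_0 V x M rho _ s Hx ltac:(lra) ltac:(rewrite Hma; lra) Hs) as Hs0.
  rewrite Hma in Hs0.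
  assert (Hane : RtoC a <> 0) by (intros E; injection E; lra).
  assert (Hrel : Re l <> 0) by (unfold l, Re in *; simpl; rewrite Hc; lra).
  assert (Hlc : l <> c) by (intros E; apply Hrel; rewrite E; exact Hc).
  pose proof (residue_expansion _ _ _ _ _ _ _ _ HQ Hd Hrel Hlc Hs) as HE.
  specialize (HL' a ltac:(unfold a; lra)); fold l in HL'.
  assert (Hh : norm (hat g l) <= norm L + 1) by (pose proof (norm_le_minus V (hat g l) L); lra).
  assert (Hsn : norm s <= norm (x O) + 2 * M).
  { pose proof (norm_le_minus V s (x O)); nra. }
  apply (norm_eq_le V _ (scal (RtoC a) (minus (hat g l) s))).
  { rewrite HE; replace (l - c)%C with (RtoC a) by (unfold l; ring).
    vreduce V; field; exact Hane. }
  rewrite norm_scalC, Cmod_R, Rabs_pos_eq by lra.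
  eapply Rle_trans; [apply Rmult_le_compat_l; [lra|apply norm_minus_le]|].
  unfold B in HaB; nra.
Qed.

Lemma regdata_eq (g g' : V) (c : C) (x : nat -> V) (M rho : R) :
  g = g' -> regdata g c x M rho -> regdata g' c x M rho.
Proof. intros ->; auto. Qed.

(** The Laurent expansion of F at c has zero residue because F is continuous there, so its chain
    belongs to g itself. *)
Lemma cdiff_Reg (F : C -> V) (g : V) (c : C) (r : R) : Re c = 0 -> 0 < r ->
  (forall z, Cmod (z - c) < r -> ex_derive (K := C_AbsRing) F z) ->
  (forall z, Cmod (z - c) < r -> Re z <> 0 -> F z = hat g z) -> Reg g c.
Proof.
  intros Hc Hr HF Hh.
  assert (Hlim : forall z, Cmod (z - c) < r -> right_lim (hat g) z (F z)).
  { intros z Hz; apply (cdiff_right_lim F g z (r - Cmod (z - c))); [lra|apply HF, Hz|].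
    intros w Hw; apply Hh.
    replace (w - c)%C with ((w - z) + (z - c))%C by ring.
    pose proof (Cmod_triangle (w - z) (z - c)); lra. }
  destruct (laurent F c g r Hc) as [Q [x [M [rho [HQ [Hd _]]]]]]; [|exact Hr|].
  { intros z Hz; split; [apply HF; lra|apply right_lim_Sol, Hlim; lra]. }
  assert (EQ : Q = zero).
  { apply (residue_zero g Q c x M rho (F c)); auto.
    apply Hlim; replace (c - c)%C with (RtoC 0) by ring; rewrite Cmod_0; exact Hr. }
  exists x, M, rho; refine (regdata_eq _ _ _ _ _ _ _ Hd); rewrite EQ; vring V.
Qed.

(** At points of the axis the value of [Gl] is only a right limit, so regular part and polar part
    are both compared between z and z + a. *)
Lemma isolated_expansion (g : V) (c : C) (r : R) : Re c = 0 -> 0 < r ->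
  (forall z, 0 < Cmod (z - c) < r -> Reg g z) ->
  exists Q x M rho d, Sol c zero Q /\ regdata (minus g Q) c x M rho /\ 0 < d /\
    forall z, 0 < Cmod (z - c) < d ->
      ser V x (c - z)%C (minus (Gl g z) (scal (/ (z - c))%C Q)).
Proof.
  intros Hc Hr HR.
  destruct (laurent (Gl g) c g r Hc) as [Q [x [M [rho [HQ [Hd _]]]]]]; [|exact Hr|].
  { intros z Hz; split; [apply Reg_Gl_cdiff|apply Reg_Gl_Sol]; auto. }
  (* An eighth, so that z + a with a <= 1 / (8 rho) still lies within 1 / (4 rho) of c. *)
  exists Q, x, M, rho, (1 / 8 / rho); split; [exact HQ|split; [exact Hd|]].
  pose proof Hd as [Hrho [Hx _]].
  split; [apply Rdiv_lt_0_compat; lra|]; intros z [Hz1 Hz2].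
  apply (Rmult_lt_compat_r rho) in Hz2; [|lra].
  replace (1 / 8 / rho * rho) with (1 / 8) in Hz2 by (field; lra).
  set (m := Cmod (z - c)) in *.
  destruct (regdata_ser_ex _ _ z _ _ _ Hd) as [s Hs].
  { rewrite Cmod_minus_sym; fold m; lra. }
  assert (E : Gl g z = plus s (scal (/ (z - c))%C Q)).
  2: { refine (eq_ind _ (fun w => ser V x (c - z)%C w) Hs _ _); rewrite E; vring V. }
  apply Gl_eq; destruct (shift_off_axis z) as [d [Hd0 Hoff]].
  assert (Hdp : 0 < Rmin (Rmin d (m / 2)) (1 / 8 / rho)).
  { repeat apply Rmin_pos; try lra; apply Rdiv_lt_0_compat; lra. }
  (* The second constant comes from 1 / (z + a - c) - 1 / (z - c), with |z + a - c| >= m / 2. *)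
  apply (right_lim_lipschitz _ _ _ (8 * M * rho + 2 / (m * m) * norm Q) _ Hdp); intros a Ha.
  pose proof (Rmin_l (Rmin d (m / 2)) (1 / 8 / rho)).
  pose proof (Rmin_r (Rmin d (m / 2)) (1 / 8 / rho)).
  pose proof (Rmin_l d (m / 2)); pose proof (Rmin_r d (m / 2)).
  assert (Har : a * rho <= 1 / 8).
  { assert (T : a <= 1 / 8 / rho) by lra.
    apply (Rmult_le_compat_r rho) in T; [|lra].
    replace (1 / 8 / rho * rho) with (1 / 8) in T by (field; lra); exact T. }
  assert (Hup : Cmod (c - (z + RtoC a)) <= m + a).
  { replace (c - (z + RtoC a))%C with (- (z - c) + - RtoC a)%C by ring.
    eapply Rle_trans; [apply Cmod_triangle|]; rewrite !Cmod_opp, Cmod_R, Rabs_pos_eq by lra.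
    fold m; lra. }
  assert (Hlow : m / 2 <= Cmod (z + RtoC a - c)).
  { pose proof (Cmod_triangle (z + RtoC a - c) (- RtoC a)) as T.
    replace (z + RtoC a - c + - RtoC a)%C with (z - c)%C in T by ring; fold m in T.
    rewrite Cmod_opp, Cmod_R, Rabs_pos_eq in T by lra; lra. }
  destruct (regdata_ser_ex _ _ (z + RtoC a) _ _ _ Hd) as [t Ht]; [nra|].
  assert (Hne1 : (z - c)%C <> 0) by (apply Cmod_gt_0; exact Hz1).
  assert (Hne2 : (z + RtoC a - c)%C <> 0) by (apply Cmod_gt_0; lra).
  rewrite (residue_expansion g Q c (z + RtoC a) x M rho t HQ Hd); [|apply Hoff; lra| |exact Ht].
  2: { intros E; apply Hne2; rewrite E; ring. }
  apply (norm_eq_le V _ (plus (minus t s)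
    (scal (- RtoC a * (/ (z + RtoC a - c) * / (z - c)))%C Q))).
  { vreduce V; field; split; assumption. }
  rewrite Rmult_plus_distr_r; apply (norm_plus_le V).
  - eapply Rle_trans.
    + apply (ser_lipschitz V x M rho (c - (z + RtoC a))%C (c - z)%C t s Hx);
        [lra|nra|rewrite Cmod_minus_sym; fold m; lra|exact Ht|exact Hs].
    + replace (c - (z + RtoC a) - (c - z))%C with (- RtoC a)%C by ring.
      rewrite Cmod_opp, Cmod_R, Rabs_pos_eq; lra.
  - rewrite norm_scalC, !Cmod_mult, Cmod_opp, Cmod_R, Rabs_pos_eq, !Cmod_inv by (auto; lra).
    fold m; pose proof (norm_ge_0 Q).
    assert (T : / Cmod (z + RtoC a - c) <= 2 / m).
    { replace (2 / m) with (/ (m / 2)) by (field; lra); apply Rinv_le_contravar; lra. }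
    assert (T2 : / Cmod (z + RtoC a - c) * / m <= 2 / m * / m).
    { apply Rmult_le_compat_r; [left; apply Rinv_0_lt_compat; lra|exact T]. }
    replace (2 / (m * m)) with (2 / m * / m) by (field; lra).
    replace (2 / m * / m * norm Q * a) with (a * (2 / m * / m) * norm Q) by ring.
    apply Rmult_le_compat_r; [assumption|apply Rmult_le_compat_l; lra].
Qed.

(** Liouville's argument: the last clause of [laurent] at 0, for arbitrarily large radii, forces the
    continuation to vanish at 0, and the equation there becomes 0 = R1 g. Injectivity of the
    concrete resolvent is supplied by [resolvent1_injective]. *)
Theorem Reg_everywhere (g : V) : (forall z, Re z = 0 -> Reg g z) -> R1 g = zero.
Proof.
  intros H.
  assert (HA : forall z, Reg g z).
  { intros z; destruct (Req_dec (Re z) 0) as [E|E]; [apply H, E|apply Reg_off_axis, E]. }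
  assert (Hb : forall r, 0 < r -> r * norm (Gl g 0) <= 2 * norm g).
  { intros r Hr.
    destruct (laurent (Gl g) 0 g (r + 1) eq_refl) as [Q [x [M [rho [HQ [Hd Hx]]]]]]; [|lra|].
    { intros z _; split; [apply Reg_Gl_cdiff|apply Reg_Gl_Sol]; auto. }
    assert (EQ : Q = zero).
    { destruct (HA 0) as [x' [M' [rho' Hd']]].
      apply (residue_zero g Q 0 x M rho (x' O) eq_refl HQ Hd).
      exact (regdata_Gl_c g 0 x' M' rho' Hd'). }
    rewrite (Gl_eq g 0 (x O)); [apply Hx; lra|].
    apply (regdata_Gl_c g 0 x M rho); refine (regdata_eq _ _ _ _ _ _ _ Hd).
    rewrite EQ; vring V. }
  assert (HG : Gl g 0 = zero).
  { apply (norm_small_zero V); intros e He.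
    pose proof (norm_ge_0 g); specialize (Hb ((2 * norm g + 1) / e)).
    assert (P : 0 < (2 * norm g + 1) / e) by (apply Rdiv_lt_0_compat; lra).
    specialize (Hb P); apply (Rmult_le_compat_l e) in Hb; [|lra].
    replace (e * ((2 * norm g + 1) / e * norm (Gl g 0))) with ((2 * norm g + 1) * norm (Gl g 0))
      in Hb by (field; lra).
    pose proof (norm_ge_0 (Gl g 0)); nra. }
  pose proof (Reg_Gl_Sol g 0 (HA 0)) as HS; rewrite HG in HS; unfold Sol in HS.
  symmetry; etransitivity; [exact HS|]; apply (f_equal R1); vring V.
Qed.

(** A bounded operator that respects the resolvent equation maps the chain of g to a chain of A
    g. *)
Lemma Reg_map (A : V -> V) (g : V) (c : C) : is_linear (K := C_AbsRing) A ->
  (forall l y x, Sol l y x -> Sol l (A y) (A x)) -> Reg g c -> Reg (A g) c.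
Proof.
  intros HA HS [x [M [rho [H1 [H2 [H3 H4]]]]]]; destruct (linear_norm A HA) as [K [HK HAb]].
  exists (fun n => A (x n)), (K * M), rho; repeat split; auto.
  intros n; eapply Rle_trans; [apply HAb|]; rewrite Rmult_assoc.
  apply Rmult_le_compat_l; [lra|apply H2].
Qed.

End LocalResolvent.

(** * Completeness of the quotient space *)

Lemma pow_half_small (e : R) : 0 < e -> exists N, forall n, (N <= n)%nat -> (1 / 2) ^ n < e.
Proof.
  intros He; destruct (pow_lt_1_zero (1 / 2) ltac:(rewrite Rabs_pos_eq; lra) e He) as [N HN].
  exists N; intros n Hn; specialize (HN n Hn); rewrite Rabs_pos_eq in HN; [exact HN|].
  apply pow_le; lra.
Qed.

Section Completeness.

Variable V : NormedModule C_AbsRing.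

(** Chosen from a predicate on limits, so that equivalent filters receive literally the same limit;
    the second axiom of a complete space follows. *)
Definition filter_limit (F : (V -> Prop) -> Prop) : V :=
  epsilon (inhabits (zero : V)) (fun l : V => forall eps : posreal, F (ball l eps)).

(** One index N serving both estimates suffices, because the filter contains a ball of radius
    (1/2)^N / 4 around the N-th point. *)
Hypothesis fast_cauchy_cv : forall u : nat -> V,
  (forall n, norm (minus (u (S n)) (u n)) <= (1 / 2) ^ n) ->
  exists l, forall e, 0 < e -> exists N, norm (minus (u N) l) < e /\ (1 / 2) ^ N < e.

Lemma filter_limit_correct (F : (V -> Prop) -> Prop) :
  ProperFilter F -> cauchy F -> forall eps : posreal, F (ball (filter_limit F) eps).
Proof.
  intros HF HC.
  cut (exists l : V, forall eps : posreal, F (ball l eps)).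
  { intros H; unfold filter_limit; apply (epsilon_spec (inhabits (zero : V))
      (fun l : V => forall eps : posreal, F (ball l eps))), H. }
  assert (Hc : forall n, exists x, F (fun y => norm (minus y x) < (1 / 2) ^ n / 4)).
  { intros n; pose proof (pow_lt (1 / 2) n ltac:(lra)) as Hp.
    pose proof (norm_factor_gt_0 (V := V)) as Hf.
    assert (He : 0 < (1 / 2) ^ n / 4 / norm_factor (V := V)) by (apply Rdiv_lt_0_compat; lra).
    destruct (HC (mkposreal _ He)) as [x Hx]; exists x; revert Hx.
    apply (filter_imp (F := F)); intros y Hy; apply norm_compat2 in Hy; simpl in Hy.
    replace (norm_factor (V := V) * ((1 / 2) ^ n / 4 / norm_factor (V := V)))
      with ((1 / 2) ^ n / 4) in Hy by (field; lra); exact Hy. }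
  set (u := fun n => proj1_sig (constructive_indefinite_description _ (Hc n))).
  assert (Hu : forall n, F (fun y => norm (minus y (u n)) < (1 / 2) ^ n / 4)).
  { intros n; unfold u; destruct (constructive_indefinite_description _ _); assumption. }
  destruct (fast_cauchy_cv u) as [l Hl].
  { intros n; destruct (filter_ex (F := F) _ (filter_and _ _ (Hu n) (Hu (S n)))) as [y [H1 H2]].
    eapply Rle_trans; [apply (norm_minus_triangle V _ y)|].
    rewrite (norm_minus_sym V (u (S n)) y); simpl in H2.
    pose proof (pow_lt (1 / 2) n ltac:(lra)); lra. }
  exists l; intros eps.
  destruct (Hl (eps / 2)) as [N [HN1 HN2]]; [pose proof (cond_pos eps); lra|].
  generalize (Hu N); apply (filter_imp (F := F)); intros y Hy; apply norm_compat1.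
  pose proof (norm_minus_triangle V y (u N) l); pose proof (pow_lt (1 / 2) N ltac:(lra)); lra.
Qed.

Definition complete_of_fast_cauchy : CompleteSpace.mixin_of V.
Proof.
  exists filter_limit; [exact filter_limit_correct|].
  intros F1 F2 H1 H2.
  assert (E : filter_limit F1 = filter_limit F2).
  { unfold filter_limit; f_equal; apply functional_extensionality; intros l.
    apply propositional_extensionality; split; intros H eps; auto. }
  rewrite E; intros eps; apply ball_center.
Defined.

End Completeness.

Section YComplete.

Variables (X : NormedModule C_AbsRing) (cX : CompleteSpace.mixin_of X).

Notation bnorm := (@sup_norm X).

Lemma BUC_minus_eval (f h : BUC_NormedModule X) (t : nonnegreal) :
  buc_fun (minus f h) t = minus (buc_fun f t) (buc_fun h t).
Proof.
  change (buc_fun (minus f h) t)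
    with (plus (buc_fun f t) (scal (opp one : C_AbsRing) (buc_fun h t))); vring X.
Qed.

Lemma norm_tilde (f : BUC X) : norm (tilde f) <= bnorm f.
Proof. apply (quot_norm_le (C0_submodule X)). Qed.

Lemma tilde_approx (y : Y X) (e : R) : 0 < e -> exists f, tilde f = y /\ bnorm f < norm y + e.
Proof. intros He; apply (quot_norm_approx y He). Qed.

Lemma tilde_eq (f h : BUC X) : tilde f = tilde h <-> C0 (minus (G := BUC_NormedModule X) f h).
Proof. apply (qclass_eq (C0_submodule X) f h). Qed.

Lemma tilde_surj (y : Y X) : exists f, tilde f = y.
Proof. exists (qrepr y); apply qreprK. Qed.

Lemma tilde_plus (f h : BUC X) : tilde (BUC_plus f h) = plus (tilde f) (tilde h).
Proof. symmetry; apply (@quot_plusE _ _ (C0_submodule X) f h). Qed.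

Lemma tilde_scal (k : C) (f : BUC X) : tilde (BUC_scal k f) = scal k (tilde f).
Proof. symmetry; apply (@quot_scalE _ _ (C0_submodule X) k f). Qed.

Lemma tilde_minus (f h : BUC X) :
  tilde (minus (G := BUC_NormedModule X) f h) = minus (tilde f) (tilde h).
Proof.
  change (minus (G := BUC_NormedModule X) f h) with (BUC_plus f (BUC_scal (opp (one : C_AbsRing)) h)).
  rewrite tilde_plus, tilde_scal; vring (Y X).
Qed.

(** The successive differences are lifted to functions of sup norm at most 2 (1/2)^n, the factor 2
    being the slack left by the infimum in the quotient norm. Their series converges pointwise by
    completeness of X, and uniformly by the geometric bound. *)
Lemma Y_fast_cauchy_cv (y : nat -> Y X) :
  (forall n, norm (minus (y (S n)) (y n)) <= (1 / 2) ^ n) ->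
  exists l, forall e, 0 < e -> exists N, norm (minus (y N) l) < e /\ (1 / 2) ^ N < e.
Proof.
  intros Hy.
  assert (Hd : forall n, exists d, tilde d = minus (y (S n)) (y n) /\ bnorm d <= 2 * (1 / 2) ^ n).
  { intros n; destruct (tilde_approx (minus (y (S n)) (y n)) ((1 / 2) ^ n)) as [d [H1 H2]].
    { apply pow_lt; lra. }
    exists d; split; [exact H1|specialize (Hy n); lra]. }
  apply choice in Hd; destruct Hd as [d Hd].
  destruct (tilde_surj (y O)) as [v0 Hv0].
  set (v := fix v n := match n with O => v0 | S n => BUC_plus (v n) (d n) end).
  assert (Hv : forall n, tilde (v n) = y n).
  { induction n as [|n IH]; [exact Hv0|]; simpl.
    rewrite tilde_plus, IH, (proj1 (Hd n)); vring (Y X). }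
  assert (Hdt : forall n t, norm (d n t) <= 2 * (1 / 2) ^ n).
  { intros n t; eapply Rle_trans; [apply sup_norm_ub|apply Hd]. }
  assert (Hs : forall t, exists s, is_series (fun n => d n t) s).
  { intros t; apply (series_geom_ex X cX _ 2); intros n; apply Hdt. }
  apply choice in Hs; destruct Hs as [s Hs].
  set (u := fun t => plus (v0 t) (s t)).
  assert (Htail : forall t n, is_series (fun k => d (n + k)%nat t) (minus (u t) (v n t))).
  { intros t n; induction n as [|n IH].
    - refine (eq_ind _ (fun w => is_series _ w) (Hs t) _ _); unfold u; simpl; vring X.
    - apply is_series_tail in IH; rewrite Nat.add_0_r in IH.
      refine (eq_ind _ (fun w => is_series _ w) (is_series_ext _ _ _ _ IH) _ _).
      + intros k; rewrite Nat.add_succ_r; reflexivity.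
      + simpl; vring X. }
  assert (Huv : forall t n, norm (minus (u t) (v n t)) <= 4 * (1 / 2) ^ n).
  { intros t n; replace (4 * (1 / 2) ^ n) with (2 * (2 * (1 / 2) ^ n)) by ring.
    refine (series_geom_bound X _ _ _ _ (Htail t n)); intros k.
    eapply Rle_trans; [apply Hdt|]; rewrite pow_add; lra. }
  assert (Hub : exists M, forall t, norm (u t) <= M).
  { destruct (buc_bounded v0) as [M HM]; exists (4 + M); intros t.
    pose proof (norm_le_minus X (u t) (v0 t)); pose proof (Huv t O) as H1.
    simpl in H1; specialize (HM t); lra. }
  assert (Huc : forall eps : posreal, exists delta : posreal, forall s t : nonnegreal,
    Rabs (s - t) < delta -> norm (minus (u s) (u t)) < eps).
  (* Each of the two comparisons with [v n] costs 4 (1/2)^n < eps / 4, and the continuity of [v n]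
     costs eps / 2. *)
  { intros eps; destruct (pow_half_small (eps / 16)) as [n Hn]; [pose proof (cond_pos eps); lra|].
    specialize (Hn n (le_n n)); destruct (buc_ucont (v n) (pos_div_2 eps)) as [de Hde].
    exists de; intros a b Hab; specialize (Hde a b Hab); simpl in Hde.
    pose proof (norm_minus_triangle X (u a) (v n a) (u b)).
    pose proof (norm_minus_triangle X (v n a) (v n b) (u b)).
    pose proof (Huv a n); pose proof (Huv b n) as Hb; rewrite (norm_minus_sym X) in Hb.
    pose proof (cond_pos eps); lra. }
  exists (tilde (mkBUC Hub Huc)); intros e He.
  destruct (pow_half_small (e / 8)) as [N HN]; [lra|]; exists N; specialize (HN N (le_n N)).
  pose proof (pow_lt (1 / 2) N ltac:(lra)); split; [|lra].
  rewrite <- Hv, <- tilde_minus.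
  eapply Rle_lt_trans; [apply norm_tilde|].
  apply Rle_lt_trans with (4 * (1 / 2) ^ N); [|lra].
  apply sup_norm_le; intros t; rewrite BUC_minus_eval; simpl.
  rewrite (norm_minus_sym X); apply Huv.
Qed.

Definition Y_complete : CompleteSpace.mixin_of (Y X) :=
  complete_of_fast_cauchy (Y X) Y_fast_cauchy_cv.

End YComplete.

(** * The resolvent equation on the half-line *)

Lemma exp_decay (k C0 e : R) : 0 < k -> 0 < e ->
  exists T, forall t, T < t -> C0 * exp (- k * t) <= e.
Proof.
  intros Hk He; exists (Rabs C0 / (k * e)); intros t Ht.
  assert (Hke : 0 < k * e) by (apply Rmult_lt_0_compat; assumption).
  apply (Rmult_lt_compat_l (k * e)) in Ht; [|exact Hke].
  replace (k * e * (Rabs C0 / (k * e))) with (Rabs C0) in Ht by (field; lra).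
  pose proof (Rabs_pos C0); pose proof (Rle_abs C0).
  assert (Ht0 : 0 < k * t) by nra.
  replace (- k * t) with (- (k * t)) by ring; rewrite exp_Ropp.
  pose proof (exp_ineq1 (k * t) ltac:(lra)) as H1; pose proof (exp_pos (k * t)).
  apply Rle_trans with (e * exp (k * t) * / exp (k * t)).
  - apply Rmult_le_compat_r; [left; apply Rinv_0_lt_compat; lra|nra].
  - right; field; lra.
Qed.

Lemma RtoC_neq_0 (r : R) : r <> 0 -> RtoC r <> 0.
Proof. intros H E; apply H, RtoC_inj, E. Qed.

Definition nn (r : R) : nonnegreal := mknonnegreal (Rmax 0 r) (Rmax_l 0 r).

Lemma nonnegreal_eq (s t : nonnegreal) : nonneg s = nonneg t -> s = t.
Proof.
  destruct s as [s Hs], t as [t Ht]; simpl; intros <-; f_equal; apply proof_irrelevance.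
Qed.

Lemma nn_nonneg (t : nonnegreal) : nn t = t.
Proof. apply nonnegreal_eq; simpl; apply Rmax_right, cond_nonneg. Qed.

Lemma nn_pos (r : R) : 0 <= r -> nonneg (nn r) = r.
Proof. intros H; simpl; apply Rmax_right, H. Qed.

Section HalfLine.

Variables (X : NormedModule C_AbsRing) (cX : CompleteSpace.mixin_of X).

(** Constant continuation to the left of 0, so that the calculus on the whole real line applies;
    two-sided derivatives are claimed only at t > 0. *)
Definition ext (f : BUC X) (r : R) : X := f (nn r).

Lemma ext_nonneg (f : BUC X) (t : nonnegreal) : ext f t = f t.
Proof. unfold ext; rewrite nn_nonneg; reflexivity. Qed.

Lemma ext_norm (f : BUC X) (r : R) : norm (ext f r) <= sup_norm f.
Proof. apply sup_norm_ub. Qed.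

Lemma ext_continuous (f : BUC X) (r : R) : continuous (ext f) r.
Proof.
  apply (proj2 (continuous_R_iff X (ext f) r)); intros e He.
  destruct (buc_ucont f (mkposreal e He)) as [d Hd].
  exists d; split; [apply cond_pos|]; intros s Hs; apply Hd; simpl.
  refine (Rle_lt_trans _ _ _ _ Hs).
  unfold Rmax; destruct (Rle_dec 0 s), (Rle_dec 0 r);
    unfold Rabs; repeat destruct (Rcase_abs _); lra.
Qed.

Lemma is_D_iff (u v : BUC X) :
  is_D u v <-> forall t : nonnegreal, forall e, 0 < e -> exists d, 0 < d /\
    forall s : nonnegreal, Rabs (s - t) < d ->
      norm (minus (minus (u s) (u t)) (scal (RtoC (s - t)) (v t))) <= e * Rabs (s - t).
Proof.
  split.
  - intros H t e He.
    assert (HP : locally (v t) (fun x => norm (minus x (v t)) < e)).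
    { apply (proj2 (locally_norm_iff X (v t) _)); exists e; auto. }
    destruct (H t _ HP) as [d Hd]; exists d; split; [apply cond_pos|]; intros s Hs.
    destruct (Req_dec s t) as [E|E].
    { apply nonnegreal_eq in E; subst s; rewrite Rminus_diag, Rabs_R0, Rmult_0_r.
      right; apply norm_zero_eq; vring X. }
    specialize (Hd s Hs E s eq_refl); simpl in Hd.
    assert (Hne : RtoC (s - t) <> 0) by (apply RtoC_neq_0; intros E'; apply E; lra).
    apply (norm_eq_le X _ (scal (RtoC (s - t))
      (minus (scal (RtoC (/ (s - t))) (minus (u s) (u t))) (v t)))).
    { vreduce X; rewrite RtoC_inv by lra; field; exact Hne. }
    rewrite norm_scalC, Cmod_R, Rmult_comm; apply Rmult_le_compat_r; [apply Rabs_pos|left; exact Hd].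
  - intros H t P HP; apply (proj1 (locally_norm_iff X (v t) P)) in HP.
    destruct HP as [e [He HP]]; destruct (H t (e / 2) ltac:(lra)) as [d [Hd K]].
    exists (mkposreal d Hd); intros r Hr Hrt s <-; apply HP.
    specialize (K s Hr).
    assert (Hne : RtoC (s - t) <> 0) by (apply RtoC_neq_0; intros E'; apply Hrt; lra).
    assert (Hp : 0 < Rabs (s - t)) by (apply Rabs_pos_lt; intros E'; apply Hrt; lra).
    apply (norm_eq_lt X _ (scal (RtoC (/ (s - t)))
      (minus (minus (u s) (u t)) (scal (RtoC (s - t)) (v t))))).
    { vreduce X; rewrite ?RtoC_inv by lra; field; exact Hne. }
    rewrite norm_scalC, Cmod_R, Rabs_inv.
    apply (Rmult_le_compat_l (/ Rabs (s - t))) in K; [|left; apply Rinv_0_lt_compat, Hp].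
    replace (/ Rabs (s - t) * (e / 2 * Rabs (s - t))) with (e / 2) in K by (field; lra).
    lra.
Qed.

Lemma is_D_derive (u v : BUC X) (t : R) : is_D u v -> 0 < t ->
  is_derive (V := RSN X) (ext u) t (ext v t).
Proof.
  intros H Ht; pose proof (proj1 (is_D_iff u v) H (nn t)) as H1.
  rewrite nn_pos in H1 by lra.
  apply (proj2 (is_derive_R_iff X (ext u) t (ext v t))); intros e He.
  destruct (H1 e He) as [d [Hd H2]].
  exists (Rmin d t); split; [apply Rmin_pos; assumption|]; intros s Hs.
  pose proof (Rmin_l d t); pose proof (Rmin_r d t).
  assert (Hs0 : 0 <= s) by (apply Rabs_def2 in Hs; lra).
  specialize (H2 (nn s)); rewrite nn_pos in H2 by exact Hs0; apply H2; lra.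
Qed.

Lemma derive_is_D (u v : BUC X) (U W : R -> X) :
  (forall t : nonnegreal, u t = U t) -> (forall t : nonnegreal, v t = W t) ->
  (forall t, 0 <= t -> is_derive (V := RSN X) U t (W t)) -> is_D u v.
Proof.
  intros Hu Hv H; apply is_D_iff; intros t e He; rewrite Hv.
  destruct (proj1 (is_derive_R_iff X U t (W t)) (H t (cond_nonneg t)) e He) as [d [Hd H1]].
  exists d; split; [exact Hd|]; intros s Hs; rewrite !Hu; apply H1, Hs.
Qed.

Lemma increment_bound (h dh : R -> X) (a b M : R) : a <= b ->
  (forall t, a <= t <= b -> is_derive (V := RSN X) h t (dh t)) ->
  (forall t, a <= t <= b -> continuous dh t) ->
  (forall t, a <= t <= b -> norm (dh t) <= M) ->
  norm (minus (h b) (h a)) <= (b - a) * M.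
Proof.
  intros Hab H1 H2 H3; exact (norm_RInt_le_bound X dh a b M _ Hab H3
    (is_RInt_derive_C X cX h dh a b Hab H1 H2)).
Qed.

(** The bound is the integral of L e^{-kt}; this form is valid for both signs of k. *)
Lemma increment_exp_bound (h dh : R -> X) (a b L k : R) : a <= b -> k <> 0 ->
  (forall t, a <= t <= b -> is_derive (V := RSN X) h t (dh t)) ->
  (forall t, a <= t <= b -> continuous dh t) ->
  (forall t, a <= t <= b -> norm (dh t) <= L * exp (- k * t)) ->
  norm (minus (h b) (h a)) <= L * (exp (- k * a) - exp (- k * b)) / k.
Proof.
  intros Hab Hk H1 H2 H3.
  assert (HI : is_RInt (fun t => L * exp (- k * t)) a b
    (minus (- L / k * exp (- k * b)) (- L / k * exp (- k * a)))).
  { apply (is_RInt_derive (V := R_CompleteNormedModule) (fun t => - L / k * exp (- k * t))).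
    - intros t _; auto_derive; [exact I|field; exact Hk].
    - intros t _; apply (ex_derive_continuous (V := R_NormedModule)); auto_derive; exact I. }
  replace (L * (exp (- k * a) - exp (- k * b)) / k) with
    (minus (- L / k * exp (- k * b)) (- L / k * exp (- k * a))).
  - exact (norm_RInt_le (V := RSN X) dh _ a b _ _ Hab H3 (is_RInt_derive_C X cX h dh a b Hab H1 H2) HI).
  - unfold minus, plus, opp; simpl; field; exact Hk.
Qed.

(** A bounded derivative makes U Lipschitz, hence uniformly continuous. *)
Lemma BUC_of_derive (U W : R -> X) (M N : R) :
  (forall t, 0 <= t -> is_derive (V := RSN X) U t (W t)) ->
  (forall t, 0 <= t -> continuous W t) ->
  (forall t, 0 <= t -> norm (U t) <= M) -> (forall t, 0 <= t -> norm (W t) <= N) ->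
  exists u : BUC X, (forall t : nonnegreal, u t = U t) /\ sup_norm u <= M.
Proof.
  intros H1 H2 H3 H4.
  assert (Hb : exists M', forall t : nonnegreal, norm (U t) <= M').
  { exists M; intros t; apply H3, cond_nonneg. }
  assert (HN : 0 <= N) by (specialize (H4 0 (Rle_refl 0)); pose proof (norm_ge_0 (W 0)); lra).
  assert (Hl : forall s t, 0 <= s <= t -> norm (minus (U t) (U s)) <= (t - s) * N).
  { intros s t Hst; apply (increment_bound U W); try lra; intros r Hr; auto with real;
      [apply H1|apply H2|apply H4]; lra. }
  assert (Hc : forall eps : posreal, exists delta : posreal, forall s t : nonnegreal,
    Rabs (s - t) < delta -> norm (minus (U s) (U t)) < eps).
  { intros eps; assert (Hd : 0 < eps / (N + 1)) by (apply Rdiv_lt_0_compat; [apply cond_pos|lra]).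
    exists (mkposreal _ Hd); simpl; intros s t Hst.
    apply (Rmult_lt_compat_r (N + 1)) in Hst; [|lra].
    replace (eps / (N + 1) * (N + 1)) with (pos eps) in Hst by (field; lra).
    refine (Rle_lt_trans _ _ _ _ Hst).
    pose proof (cond_nonneg s); pose proof (cond_nonneg t); pose proof (Rabs_pos (s - t)).
    destruct (Rle_dec s t) as [Hle|Hle].
    - rewrite norm_minus_sym, Rabs_minus_sym, Rabs_pos_eq by lra.
      specialize (Hl s t ltac:(lra)); nra.
    - rewrite Rabs_pos_eq by lra; specialize (Hl t s ltac:(lra)); nra. }
  exists (mkBUC Hb Hc); split; [reflexivity|].
  apply sup_norm_le; intros t; simpl; apply H3, cond_nonneg.
Qed.

Lemma scal_continuous (k : C) (f : R -> X) (t : R) :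
  continuous f t -> continuous (fun s => scal k (f s)) t.
Proof.
  intros H; pose proof (proj1 (continuous_R_iff X f t) H) as Hf.
  apply (proj2 (continuous_R_iff X (fun s => scal k (f s)) t)); intros e He.
  pose proof (Cmod_ge_0 k) as Hk.
  destruct (Hf (e / (Cmod k + 1))) as [d [Hd K]]; [apply Rdiv_lt_0_compat; lra|].
  exists d; split; [exact Hd|]; intros s Hs; specialize (K s Hs).
  apply (norm_eq_lt X _ (scal k (minus (f s) (f t)))); [vring X|]; rewrite norm_scalC.
  apply Rle_lt_trans with (Cmod k * (e / (Cmod k + 1))).
  - apply Rmult_le_compat_l; [exact Hk|left; exact K].
  - apply Rlt_le_trans with ((Cmod k + 1) * (e / (Cmod k + 1))); [|right; field; lra].
    apply Rmult_lt_compat_r; [apply Rdiv_lt_0_compat|]; lra.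
Qed.

(** The integrating factor e^{-lt}: it turns u' = l u - f into the statement that the twist of u has
    derivative minus the twist of f. *)
Definition twist (l : C) (f : R -> X) (t : R) : X := scal (cexp (- l * RtoC t)%C) (f t).

Lemma norm_twist (l : C) (f : R -> X) (t : R) :
  norm (twist l f t) = exp (- Re l * t) * norm (f t).
Proof.
  unfold twist; rewrite norm_scalC, Cmod_cexp; f_equal; f_equal.
  destruct l; unfold Re; simpl; ring.
Qed.

Lemma twist_derive (l : C) (f : R -> X) (t : R) (f' : X) :
  is_derive (V := RSN X) f t f' ->
  is_derive (V := RSN X) (twist l f) t
    (scal (cexp (- l * RtoC t)%C) (minus f' (scal l (f t)))).
Proof.
  intros H.
  refine (eq_ind _ (fun w => is_derive (V := RSN X) (twist l f) t w)
    (is_derive_scal_fct X _ _ _ _ _ (is_derive_cexp_line (- l)%C t) H) _ _).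
  vring X.
Qed.

Lemma twist_continuous (l : C) (f : R -> X) (t : R) :
  continuous f t -> continuous (twist l f) t.
Proof.
  intros H; apply (proj2 (continuous_R_iff X (twist l f) t)); intros e He.
  pose proof (proj1 (continuous_R_iff X f t) H) as Hf.
  pose proof (is_derive_continuous_R C_NormedModule _ _ _ (is_derive_cexp_line (- l)%C t)) as Hc.
  pose proof (proj1 (continuous_R_iff C_NormedModule _ t) Hc) as Hc'; clear H Hc.
  set (A := cexp (- l * RtoC t)%C) in *; pose proof (Cmod_ge_0 A); pose proof (norm_ge_0 (f t)).
  set (B := Cmod A + 1 + norm (f t)); assert (HB : 1 <= B) by (unfold B; lra).
  set (k := Rmin 1 (e / (2 * B))).
  assert (Hk : 0 < k) by (apply Rmin_pos; [lra|apply Rdiv_lt_0_compat; lra]).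
  assert (Hk1 : k <= 1) by apply Rmin_l; assert (Hk2 : k <= e / (2 * B)) by apply Rmin_r.
  assert (Hk3 : 2 * B * k <= e).
  { apply (Rmult_le_compat_l (2 * B)) in Hk2; [|lra].
    replace (2 * B * (e / (2 * B))) with e in Hk2 by (field; lra); exact Hk2. }
  destruct (Hf k Hk) as [d1 [Hd1 K1]], (Hc' k Hk) as [d2 [Hd2 K2]].
  exists (Rmin d1 d2); split; [apply Rmin_pos; assumption|]; intros s Hs.
  pose proof (Rmin_l d1 d2); pose proof (Rmin_r d1 d2).
  specialize (K1 s ltac:(lra)); specialize (K2 s ltac:(lra)).
  set (A' := cexp (- l * RtoC s)%C) in *.
  change (Cmod (A' - A) < k) in K2.
  assert (HA : Cmod A' <= Cmod A + 1).
  { replace A' with ((A' - A) + A)%C by ring; eapply Rle_trans; [apply Cmod_triangle|lra]. }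
  unfold twist; fold A A'.
  apply (norm_eq_lt X _ (plus (scal A' (minus (f s) (f t))) (scal (A' - A)%C (f t)))); [vring X|].
  apply Rle_lt_trans with ((Cmod A + 1) * norm (minus (f s) (f t)) + k * norm (f t)).
  - apply (norm_plus_le X); apply norm_scal_le; lra.
  - assert ((Cmod A + 1) * norm (minus (f s) (f t)) < (Cmod A + 1) * k)
      by (apply Rmult_lt_compat_l; lra).
    unfold B in Hk3; nra.
Qed.

Definition prim (l : C) (f : BUC X) (t : R) : X :=
  RInt (V := RS X cX) (twist l (ext f)) 0 t.

Lemma prim_derive (l : C) (f : BUC X) (t : R) :
  is_derive (V := RSN X) (prim l f) t (twist l (ext f) t).
Proof.
  assert (Hc : forall s, continuous (twist l (ext f)) s).
  { intros s; apply twist_continuous, ext_continuous. }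
  apply (is_derive_RInt (V := RSN X) (twist l (ext f)) (prim l f) 0 t).
  - exists (mkposreal 1 Rlt_0_1); intros s _.
    apply (RInt_correct (V := RS X cX)), (ex_RInt_continuous (V := RS X cX)); intros; apply Hc.
  - apply Hc.
Qed.

Lemma twist_ext_continuous (l : C) (f : BUC X) (t : R) : continuous (twist l (ext f)) t.
Proof. apply twist_continuous, ext_continuous. Qed.

Lemma prim_increment (l : C) (f : BUC X) (a b : R) : Re l <> 0 -> a <= b ->
  norm (minus (prim l f b) (prim l f a)) <=
  sup_norm f * (exp (- Re l * a) - exp (- Re l * b)) / Re l.
Proof.
  intros Hl Hab; apply (increment_exp_bound _ (twist l (ext f))); auto.
  - intros t _; apply prim_derive.
  - intros t _; apply twist_ext_continuous.
  - intros t _; rewrite norm_twist, Rmult_comm; apply Rmult_le_compat_r.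
    + left; apply exp_pos.
    + apply ext_norm.
Qed.

Lemma sup_norm_ge_0 (f : BUC X) : 0 <= sup_norm f.
Proof. eapply Rle_trans; [apply (norm_ge_0 (f (nn 0)))|apply (sup_norm_ub f (nn 0))]. Qed.

(* The initial value for which the solution of [u' = l u - f] stays bounded. *)
Lemma prim_limit (l : C) (f : BUC X) : Re l <> 0 -> exists I : X, forall a, 0 <= a ->
  norm (minus I (prim l f a)) <= sup_norm f * exp (- Re l * a) / Rabs (Re l).
Proof.
  intros Hl; pose proof (sup_norm_ge_0 f) as HN; set (N := sup_norm f) in *; set (k := Re l) in *.
  destruct (Rlt_dec k 0) as [Hk|Hk].
  (* For Re l < 0 every solution stays bounded; starting from 0 gives the stated constant. *)
  - exists zero; intros a Ha.
    pose proof (prim_increment l f 0 a Hl Ha) as H; fold N k in H.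
    assert (E0 : prim l f 0 = zero) by apply (RInt_point (V := RS X cX)).
    rewrite E0, Rmult_0_r, exp_0 in H; rewrite norm_minus_sym.
    eapply Rle_trans; [exact H|]; rewrite (Rabs_left k) by exact Hk.
    replace (N * (1 - exp (- k * a)) / k) with (N * (exp (- k * a) - 1) / - k) by (field; lra).
    unfold Rdiv; apply Rmult_le_compat_r; [left; apply Rinv_0_lt_compat; lra|].
    apply Rmult_le_compat_l; lra.
  - assert (Hk' : 0 < k) by lra; clear Hk; rewrite (Rabs_pos_eq k) by lra.
    assert (Hinc : forall a b, a <= b ->
      norm (minus (prim l f b) (prim l f a)) <= N * exp (- k * a) / k).
    { intros a b Hab; eapply Rle_trans; [apply (prim_increment l f a b Hl Hab)|]; fold N k.
      unfold Rdiv; apply Rmult_le_compat_r; [left; apply Rinv_0_lt_compat; lra|].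
      apply Rmult_le_compat_l; [lra|]; pose proof (exp_pos (- k * b)); lra. }
    (* For Re l > 0 the value is forced: I is the improper integral of e^{-ls} f(s) over the
       half-line. *)
    assert (Hcv : exists I : X, filterlim (prim l f) (Rbar_locally p_infty) (locally I)).
    { apply (proj1 (filterlim_locally_cauchy (U := RS X cX) (F := Rbar_locally p_infty) (prim l f))).
      intros [e He]; destruct (exp_decay k (N / k) (e / 3) Hk' ltac:(lra)) as [T HT].
      exists (fun t => T + 1 < t); split; [exists (T + 1); auto|].
      intros a b Ha Hb; apply (norm_compat1 (V := X)); simpl.
      specialize (HT (T + 1) ltac:(lra)).
      assert (H1 : forall b, T + 1 < b -> norm (minus (prim l f b) (prim l f (T + 1))) <= e / 3).
      { intros b' Hb'; eapply Rle_trans; [apply Hinc; lra|].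
        eapply Rle_trans; [|exact HT]; right; field; lra. }
      pose proof (H1 b Hb) as H2; pose proof (H1 a Ha) as H3; rewrite norm_minus_sym in H3.
      pose proof (norm_minus_triangle X (prim l f b) (prim l f (T + 1)) (prim l f a)); lra. }
    destruct Hcv as [I HI]; exists I; intros a Ha; apply le_epsilon; intros e He.
    assert (HP : locally I (fun x => norm (minus x I) < e)).
    { apply (proj2 (locally_norm_iff X I _)); exists e; auto. }
    destruct (HI _ HP) as [T HT].
    pose proof (Rmax_l T a); pose proof (Rmax_r T a).
    specialize (HT (Rmax T a + 1) ltac:(lra)); rewrite norm_minus_sym in HT.
    pose proof (Hinc a (Rmax T a + 1) ltac:(lra)).
    pose proof (norm_minus_triangle X I (prim l f (Rmax T a + 1)) (prim l f a)); lra.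
Qed.

(** Variation of constants: u(t) = e^{lt} (I - integral of e^{-ls} f(s) from 0 to t). The growth of
    e^{lt} is cancelled by the decay in [prim_limit]. *)
Lemma resolvent_equation (l : C) (f : BUC X) : Re l <> 0 -> exists u v : BUC X,
  is_D u v /\ (forall t, minus (scal l (u t)) (v t) = f t) /\
  sup_norm u <= sup_norm f / Rabs (Re l).
Proof.
  intros Hl; destruct (prim_limit l f Hl) as [I HI].
  set (U := twist (- l)%C (fun t => minus I (prim l f t))).
  set (W := fun t => minus (scal l (U t)) (ext f t)).
  assert (Hne : forall t, (cexp (- - l * RtoC t) * cexp (- l * RtoC t))%C = 1).
  { intros t; rewrite <- cexp_plus, <- cexp_0; f_equal; ring. }
  assert (HD : forall t, is_derive (V := RSN X) U t (W t)).
  { intros t.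
    assert (H1 : is_derive (V := RSN X) (fun t => minus I (prim l f t)) t
      (minus zero (twist l (ext f) t))).
    { apply (is_derive_minus (V := RSN X) (fun _ => I) (prim l f) t (@zero (RSN X)));
        [apply (is_derive_const (V := RSN X))|apply prim_derive]. }
    refine (eq_ind _ (fun w => is_derive (V := RSN X) U t w) (twist_derive (- l)%C _ _ _ H1) _ _).
    unfold W, U, twist.
    transitivity (minus (scal l (scal (cexp (- - l * RtoC t)%C) (minus I (prim l f t))))
      (scal (cexp (- - l * RtoC t) * cexp (- l * RtoC t))%C (ext f t))).
    - vring X.
    - rewrite Hne; vring X. }
  assert (HU : forall t, 0 <= t -> norm (U t) <= sup_norm f / Rabs (Re l)).
  { intros t Ht; unfold U; rewrite norm_twist.
    eapply Rle_trans; [apply Rmult_le_compat_l; [left; apply exp_pos|apply (HI t Ht)]|].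
    right; transitivity (exp (- Re (- l) * t) * exp (- Re l * t) * (sup_norm f / Rabs (Re l))).
    - field; apply Rabs_no_R0, Hl.
    - rewrite <- exp_plus; replace (- Re (- l) * t + - Re l * t) with 0.
      + rewrite exp_0; ring.
      + destruct l; unfold Re; simpl; ring. }
  set (M := sup_norm f / Rabs (Re l)) in *.
  assert (HUc : forall t, continuous U t) by (intros t; exact (is_derive_continuous_R X _ _ _ (HD t))).
  destruct (BUC_of_derive U W M (Cmod l * M + sup_norm f)) as [u [Hu1 Hu2]]; auto.
  - intros t _; apply (continuous_minus (V := RSN X) (fun t => scal l (U t)) (ext f));
      [|apply ext_continuous].
    apply scal_continuous, HUc.
  - intros t Ht; unfold W; eapply Rle_trans; [apply norm_minus_le|].
    rewrite norm_scalC; apply Rplus_le_compat; [|apply ext_norm].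
    apply Rmult_le_compat_l; [apply Cmod_ge_0|apply HU, Ht].
  - exists u, (BUC_plus (BUC_scal l u) (BUC_scal (opp (one : C_AbsRing)) f)); split; [|split].
    + apply (derive_is_D _ _ U W); [exact Hu1| |intros; apply HD].
      intros t; simpl; rewrite Hu1; unfold W; rewrite ext_nonneg; vring X.
    + intros t; simpl; vring X.
    + exact Hu2.
Qed.

Lemma twist_D_increment (l : C) (u v : BUC X) (T e a b : R) :
  is_D u v -> Re l <> 0 -> 0 <= T ->
  (forall t : nonnegreal, T < t -> norm (minus (scal l (u t)) (v t)) < e) ->
  T < a -> a <= b ->
  norm (minus (twist l (ext u) b) (twist l (ext u) a)) <=
  e * (exp (- Re l * a) - exp (- Re l * b)) / Re l.
Proof.
  intros HD Hl HT He Ha Hab.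
  apply (increment_exp_bound _ (fun t => scal (cexp (- l * RtoC t)%C)
    (minus (ext v t) (scal l (ext u t))))); auto.
  - intros t Ht; apply twist_derive, is_D_derive; [exact HD|lra].
  - intros t Ht; apply (twist_continuous l (fun t => minus (ext v t) (scal l (ext u t)))).
    apply (continuous_minus (V := RSN X) (ext v) (fun t => scal l (ext u t)));
      [apply ext_continuous|].
    change (continuous (ext (BUC_scal l u)) t); apply ext_continuous.
  - intros t Ht.
    pose proof (norm_twist l (fun t => minus (ext v t) (scal l (ext u t))) t) as E.
    unfold twist in E; rewrite E, Rmult_comm; apply Rmult_le_compat_r; [left; apply exp_pos|].
    rewrite norm_minus_sym; left; apply He; rewrite nn_pos; lra.
Qed.

(** Injectivity of l - Dtilde off the axis. For Re l < 0 one integrates forward from a fixed time,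
    whose contribution decays; for Re l > 0 one integrates backward from a remote time, where
    boundedness of u is enough. *)
Lemma resolvent_C0 (l : C) (u v : BUC X) : Re l <> 0 -> is_D u v ->
  (forall eps : posreal, at_infty (fun t => norm (minus (scal l (u t)) (v t)) < eps)) -> C0 u.
Proof.
  intros Hl HD H; apply C0_eps; intros eps; pose proof (cond_pos eps) as Hep.
  set (k := Re l) in *; pose proof (Rabs_pos_lt k Hl) as Hk.
  (* After integration the error contributes at most e / |k| = eps / 4. *)
  set (e := eps * Rabs k / 4).
  assert (He : 0 < e) by (unfold e; nra).
  assert (Hek : e / Rabs k = eps / 4) by (unfold e; field; lra).
  destruct (H (mkposreal e He)) as [T0 HT0]; simpl in HT0.
  set (T := Rmax 0 T0); assert (HT : 0 <= T) by apply Rmax_l.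
  assert (HT' : forall t : nonnegreal, T < t -> norm (minus (scal l (u t)) (v t)) < e).
  { intros t Ht; apply HT0; pose proof (Rmax_r 0 T0); unfold T in Ht; lra. }
  pose proof (fun a b => twist_D_increment l u v T e a b HD Hl HT HT') as Hinc; fold k in Hinc.
  assert (Hun : forall t : R, norm (ext u t) = exp (k * t) * norm (twist l (ext u) t)).
  { intros t; rewrite norm_twist, <- Rmult_assoc, <- exp_plus; fold k.
    replace (k * t + - k * t) with 0 by ring; rewrite exp_0; ring. }
  assert (Hee : forall a b, exp (k * b) * (e * (exp (- k * a) - exp (- k * b)) / k) =
    e / k * (exp (k * (b - a)) - 1)).
  { intros a b.
    transitivity (e / k * (exp (k * b) * exp (- k * a) - exp (k * b) * exp (- k * b)));
      [field; exact Hl|].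
    rewrite <- !exp_plus; replace (k * b + - k * b) with 0 by ring; rewrite exp_0.
    do 3 f_equal; ring. }
  destruct (Rlt_dec k 0) as [Hk0|Hk0].
  - rewrite (Rabs_left k) in Hek by exact Hk0.
    destruct (exp_decay (- k) (norm (twist l (ext u) (T + 1))) (eps / 4)) as [T1 HT1]; try lra.
    exists (Rmax T1 (T + 1)); intros t Ht; rewrite <- ext_nonneg, Hun.
    pose proof (Rmax_l T1 (T + 1)); pose proof (Rmax_r T1 (T + 1)).
    specialize (HT1 t ltac:(lra)); rewrite Ropp_involutive in HT1.
    specialize (Hinc (T + 1) t ltac:(lra) ltac:(lra)).
    pose proof (exp_pos (k * t)) as Hp.
    apply (Rmult_le_compat_l (exp (k * t))) in Hinc; [|lra]; rewrite Hee in Hinc.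
    pose proof (norm_le_minus X (twist l (ext u) t) (twist l (ext u) (T + 1))) as Hn.
    apply (Rmult_le_compat_l (exp (k * t))) in Hn; [|lra].
    assert (Hf : e / k * (exp (k * (t - (T + 1))) - 1) <= eps / 4).
    { replace (e / k) with (- (e / - k)) by (field; lra); rewrite Hek.
      pose proof (exp_pos (k * (t - (T + 1)))); nra. }
    lra.
  - assert (Hk1 : 0 < k) by lra; rewrite (Rabs_pos_eq k) in Hek by lra.
    exists T; intros t Ht; rewrite <- ext_nonneg.
    destruct (exp_decay k (sup_norm u) (eps / 4)) as [T1 HT1]; try lra.
    (* Far enough beyond t that e^{-k (b - t)} times the sup norm of u is at most eps / 4. *)
    set (b := t + Rmax 0 T1 + 1).
    pose proof (Rmax_l 0 T1); pose proof (Rmax_r 0 T1).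
    specialize (HT1 (b - t) ltac:(unfold b; lra)).
    specialize (Hinc t b ltac:(lra) ltac:(unfold b; lra)).
    rewrite norm_minus_sym in Hinc.
    pose proof (norm_le_minus X (twist l (ext u) t) (twist l (ext u) b)) as Hn.
    pose proof (exp_pos (k * t)) as Hp.
    assert (Hw : exp (k * t) * norm (twist l (ext u) b) <= eps / 4).
    { rewrite norm_twist, <- Rmult_assoc, <- exp_plus; fold k.
      replace (k * t + - k * b) with (- k * (b - t)) by ring.
      eapply Rle_trans; [|exact HT1]; rewrite Rmult_comm.
      apply Rmult_le_compat_r; [left; apply exp_pos|apply ext_norm]. }
    assert (Hf : exp (k * t) * (e * (exp (- k * t) - exp (- k * b)) / k) <= eps / 4).
    { transitivity (e / k * (exp (k * t) * exp (- k * t) - exp (k * t) * exp (- k * b)));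
        [right; field; exact Hl|].
      rewrite <- !exp_plus; replace (k * t + - k * t) with 0 by ring; rewrite exp_0, Hek.
      pose proof (exp_pos (k * t + - k * b)); nra. }
    rewrite Hun.
    apply (Rmult_le_compat_l (exp (k * t))) in Hinc; [|lra].
    apply (Rmult_le_compat_l (exp (k * t))) in Hn; [|lra].
    lra.
Qed.

(** Barbalat's argument: by uniform continuity v is almost constant on a step h, so h v(t) is close
    to u(t + h) - u(t). It expresses that Dtilde is well defined. *)
Lemma C0_derivative (u v : BUC X) : is_D u v -> C0 u -> C0 v.
Proof.
  intros HD Hu; apply C0_eps; intros eps; pose proof (cond_pos eps) as He.
  destruct (buc_ucont v (pos_div_2 (pos_div_2 eps))) as [d Hd]; simpl in Hd.
  pose proof (cond_pos d) as Hdp; set (h := d / 2).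
  assert (Hh : 0 < h) by (unfold h; lra).
  (* The variation of v costs h eps / 4 and the two values of u another h eps / 4, in all h eps /
     2. *)
  assert (He2 : 0 < eps * h / 8) by (apply Rdiv_lt_0_compat; nra).
  destruct (proj1 (C0_eps u) Hu (mkposreal _ He2)) as [T HT]; simpl in HT.
  exists (Rmax 0 T); intros t Ht.
  pose proof (Rmax_l 0 T); pose proof (Rmax_r 0 T).
  set (w := fun s : R => minus (ext u s) (scal (RtoC s) (v t))).
  assert (Hw : norm (minus (w (t + h)) (w t)) <= (t + h - t) * (eps / 4)).
  { apply (increment_bound w (fun s => minus (ext v s) (v t))); [lra| | |].
    - intros s Hs; apply (is_derive_minus (V := RSN X) (ext u) (fun s => scal (RtoC s) (v t)));
        [apply is_D_derive; [exact HD|lra]|].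
      apply (proj2 (is_derive_R_iff X (fun s => scal (RtoC s) (v t)) s (v t))).
      intros e He'; exists 1; split; [lra|]; intros r _.
      rewrite norm_zero_eq; [apply Rmult_le_pos; [lra|apply Rabs_pos]|].
      vreduce X; rewrite RtoC_minus; ring.
    - intros s Hs; apply (continuous_minus (V := RSN X) (ext v) (fun _ => v t));
        [apply ext_continuous|apply continuous_const].
    - intros s Hs; left; unfold ext.
      replace (eps / 4) with (eps / 2 / 2) by field.
      apply Hd; rewrite nn_pos by lra; rewrite Rabs_pos_eq by lra; unfold h in Hs; lra. }
  assert (Hu1 : norm (ext u t) < eps * h / 8) by (apply HT; rewrite nn_pos; lra).
  assert (Hu2 : norm (ext u (t + h)) < eps * h / 8) by (apply HT; rewrite nn_pos; lra).
  assert (Hv : norm (scal (RtoC h) (v t)) <= eps * h / 4 + (eps * h / 8 + eps * h / 8)).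
  { apply (norm_eq_le X _ (plus (opp (minus (w (t + h)) (w t)))
      (minus (ext u (t + h)) (ext u t)))).
    - unfold w; vreduce X; rewrite ?RtoC_plus; ring.
    - apply (norm_plus_le X).
      + rewrite norm_opp; eapply Rle_trans; [exact Hw|right; field].
      + eapply Rle_trans; [apply norm_minus_le|lra]. }
  rewrite norm_scalC, Cmod_R, Rabs_pos_eq in Hv by lra; nra.
Qed.

End HalfLine.

(** * The resolvent and the Bloch operator on the quotient *)

Section Quotient.

Variables (X : NormedModule C_AbsRing) (cX : CompleteSpace.mixin_of X).

(** The very predicate under [epsilon] in [resolvent], kept as a relation so that it makes sense on
    the axis too. *)
Definition Res (l : C) (y x : Y X) : Prop := exists z, is_Dtilde x z /\ minus (scal l x) z = y.

Lemma is_D_lincomb (k m : C) (u v u' v' : BUC X) : is_D u v -> is_D u' v' ->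
  is_D (BUC_plus (BUC_scal k u) (BUC_scal m u')) (BUC_plus (BUC_scal k v) (BUC_scal m v')).
Proof.
  intros H H'; apply is_D_iff; intros t e He.
  pose proof (Cmod_ge_0 k); pose proof (Cmod_ge_0 m).
  set (B := Cmod k + Cmod m + 1).
  assert (HB : 0 < e / B) by (apply Rdiv_lt_0_compat; unfold B; lra).
  destruct (proj1 (is_D_iff X u v) H t _ HB) as [d [Hd K]].
  destruct (proj1 (is_D_iff X u' v') H' t _ HB) as [d' [Hd' K']].
  exists (Rmin d d'); split; [apply Rmin_pos; assumption|]; intros s Hs.
  pose proof (Rmin_l d d'); pose proof (Rmin_r d d').
  specialize (K s ltac:(lra)); specialize (K' s ltac:(lra)); simpl.
  apply (norm_eq_le X _ (plus
    (scal k (minus (minus (u s) (u t)) (scal (RtoC (s - t)) (v t))))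
    (scal m (minus (minus (u' s) (u' t)) (scal (RtoC (s - t)) (v' t)))))); [vring X|].
  apply Rle_trans with (Cmod k * (e / B * Rabs (s - t)) + Cmod m * (e / B * Rabs (s - t))).
  - apply (norm_plus_le X); apply norm_scal_le; auto; apply Rle_refl.
  - replace (e * Rabs (s - t)) with (B * (e / B * Rabs (s - t))) by (field; unfold B; lra).
    assert (0 <= e / B * Rabs (s - t)) by (apply Rmult_le_pos; [lra|apply Rabs_pos]).
    unfold B at 3; nra.
Qed.

Lemma is_Dtilde_lincomb (k m : C) (x z x' z' : Y X) : is_Dtilde x z -> is_Dtilde x' z' ->
  is_Dtilde (plus (scal k x) (scal m x')) (plus (scal k z) (scal m z')).
Proof.
  intros [u [v [<- [H <-]]]] [u' [v' [<- [H' <-]]]].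
  exists (BUC_plus (BUC_scal k u) (BUC_scal m u')), (BUC_plus (BUC_scal k v) (BUC_scal m v')).
  rewrite !tilde_plus, !tilde_scal; repeat split; apply is_D_lincomb; assumption.
Qed.

Lemma Res_lincomb (l k m : C) (y x y' x' : Y X) : Res l y x -> Res l y' x' ->
  Res l (plus (scal k y) (scal m y')) (plus (scal k x) (scal m x')).
Proof.
  intros [z [H <-]] [z' [H' <-]]; exists (plus (scal k z) (scal m z')); split.
  - apply is_Dtilde_lincomb; assumption.
  - vring (Y X).
Qed.

Lemma tilde_zero (f : BUC X) : tilde f = zero <-> C0 f.
Proof.
  change (@zero (Y X)) with (tilde (BUC_zero X)); split.
  - intros H; apply tilde_eq in H.
    refine (eq_ind _ (@C0 X) H _ _); apply BUC_ext; intros t; rewrite BUC_minus_eval; simpl; vring X.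
  - intros H; apply tilde_eq; refine (eq_ind _ (@C0 X) H _ _).
    apply BUC_ext; intros t; rewrite BUC_minus_eval; simpl; vring X.
Qed.

Lemma Res_zero (l : C) (x : Y X) : Re l <> 0 -> Res l zero x -> x = zero.
Proof.
  intros Hl [z [[u [v [<- [HD <-]]]] E]]; apply tilde_zero.
  apply (resolvent_C0 X cX l u v Hl HD).
  assert (HC : C0 (BUC_plus (BUC_scal l u) (BUC_scal (opp (one : C_AbsRing)) v))).
  { apply tilde_zero; rewrite tilde_plus, !tilde_scal; etransitivity; [|exact E]; vring (Y X). }
  intros eps; destruct (proj1 (C0_eps _) HC eps) as [T HT]; exists T; intros t Ht.
  refine (norm_eq_lt X _ _ _ _ (HT t Ht)); simpl; vring X.
Qed.

Lemma Res_unique (l : C) (y x x' : Y X) : Re l <> 0 -> Res l y x -> Res l y x' -> x = x'.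
Proof.
  intros Hl H H'; apply minus_zero_eq.
  pose proof (Res_lincomb l (RtoC 1) (RtoC (-1)) _ _ _ _ H H') as Hd.
  transitivity (plus (scal (RtoC 1) x) (scal (RtoC (-1)) x')); [vring (Y X)|].
  apply (Res_zero l _ Hl); refine (eq_ind _ (fun w => Res l w _) Hd _ _); vring (Y X).
Qed.

Lemma tilde_resolvent (l : C) (u v : BUC X) :
  minus (scal l (tilde u)) (tilde v) = tilde (minus (G := BUC_NormedModule X) (BUC_scal l u) v).
Proof. rewrite tilde_minus, tilde_scal; reflexivity. Qed.

Lemma Res_exists (l : C) (f : BUC X) : Re l <> 0 ->
  exists x, Res l (tilde f) x /\ norm x * Rabs (Re l) <= sup_norm f.
Proof.
  intros Hl; destruct (resolvent_equation X cX l f Hl) as [u [v [HD [E Hb]]]].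
  exists (tilde u); split.
  - exists (tilde v); split; [exists u, v; auto|].
    etransitivity; [apply tilde_resolvent|]; apply f_equal.
    apply BUC_ext; intros t; rewrite BUC_minus_eval; apply E.
  - pose proof (norm_tilde X u); pose proof (Rabs_pos_lt _ Hl) as Hp.
    apply (Rmult_le_compat_r (Rabs (Re l))) in Hb; [|lra].
    replace (sup_norm f / Rabs (Re l) * Rabs (Re l)) with (sup_norm f) in Hb by (field; lra).
    apply (Rmult_le_compat_r (Rabs (Re l))) in H; lra.
Qed.

(** The estimate on functions holds for every representative of y; one of nearly minimal norm gives
    the quotient norm. On the axis the left-hand side is 0. *)
Lemma Res_bound (l : C) (y x : Y X) : Res l y x -> norm x * Rabs (Re l) <= norm y.
Proof.
  intros H; destruct (Req_dec (Re l) 0) as [E|Hl].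
  - rewrite E, Rabs_R0, Rmult_0_r; apply norm_ge_0.
  - apply le_epsilon; intros e He; destruct (tilde_approx X y e He) as [f [Hf Hn]].
    destruct (Res_exists l f Hl) as [x' [Hx' Hb]]; rewrite Hf in Hx'.
    rewrite (Res_unique l y x x' Hl H Hx'); lra.
Qed.

Lemma Res_resolvent (l : C) (y : Y X) : Re l <> 0 -> Res l y (resolvent l y).
Proof.
  intros Hl; unfold resolvent; apply (epsilon_spec (inhabits zero) (Res l y)).
  destruct (tilde_surj X y) as [f <-]; destruct (Res_exists l f Hl) as [x [Hx _]].
  exists x; exact Hx.
Qed.

Definition resolvent1 : Y X -> Y X := resolvent (RtoC 1).

Lemma Re_1 : Re (RtoC 1) <> 0.
Proof. unfold Re; simpl; lra. Qed.

Lemma resolvent1_eq (y x : Y X) : resolvent1 y = x <-> Res (RtoC 1) y x.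
Proof.
  split.
  - intros <-; apply Res_resolvent, Re_1.
  - intros H; apply (Res_unique (RtoC 1) y); [exact Re_1|apply Res_resolvent, Re_1|exact H].
Qed.

Lemma resolvent1_linear : is_linear (K := C_AbsRing) resolvent1.
Proof.
  assert (H : forall y, Res (RtoC 1) y (resolvent1 y)) by (intros y; apply resolvent1_eq; reflexivity).
  split.
  - intros x y; apply resolvent1_eq.
    pose proof (Res_lincomb _ (RtoC 1) (RtoC 1) _ _ _ _ (H x) (H y)) as H1.
    assert (E : forall a b : Y X, plus (scal (RtoC 1) a) (scal (RtoC 1) b) = plus a b)
      by (intros; vring (Y X)).
    rewrite !E in H1; exact H1.
  - intros k x; apply resolvent1_eq.
    pose proof (Res_lincomb _ k (RtoC 0) _ _ _ _ (H x) (H x)) as H1.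
    assert (E : forall a b : Y X, plus (scal k a) (scal (RtoC 0) b) = scal k a)
      by (intros; vring (Y X)).
    rewrite !E in H1; exact H1.
  - exists 1; split; [lra|]; intros x; rewrite Rmult_1_l.
    pose proof (Res_bound _ _ _ (H x)) as Hb; unfold Re in Hb; simpl in Hb.
    rewrite Rabs_R1, Rmult_1_r in Hb; exact Hb.
Qed.

(** (l - Dtilde) x = y amounts to (1 - Dtilde) x = y + (1 - l) x. This connects the abstract local
    resolvent with the differential operator. *)
Lemma Sol_Res (l : C) (y x : Y X) : Sol (Y X) resolvent1 l y x <-> Res l y x.
Proof.
  unfold Sol; split.
  - intros H; symmetry in H; apply resolvent1_eq in H; destruct H as [z [H1 H2]].
    exists z; split; [exact H1|].
    transitivity (minus (minus (scal (RtoC 1) x) z) (scal (1 - l)%C x)); [vring (Y X)|].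
    etransitivity; [apply (f_equal (fun w => minus w (scal (1 - l)%C x))), H2|vring (Y X)].
  - intros [z [H1 H2]]; symmetry; apply resolvent1_eq; exists z; split; [exact H1|].
    rewrite <- H2; vring (Y X).
Qed.

(** If the solution is represented by u in C0, then its derivative is in C0 as well, so the
    right-hand side is zero in the quotient. *)
Lemma resolvent1_injective (y : Y X) : resolvent1 y = zero -> y = zero.
Proof.
  intros H; apply resolvent1_eq in H; destruct H as [z [[u [v [Hu [HD <-]]]] <-]].
  apply tilde_zero in Hu; pose proof (proj2 (tilde_zero v) (C0_derivative X cX u v HD Hu)) as Hv.
  rewrite Hv; vring (Y X).
Qed.

(** * The Bloch operator on the quotient *)

Definition BUC_shift (f : BUC X) : BUC X.
Proof.
  exists (fun t => f (nn_add1 t)).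
  - destruct (buc_bounded f) as [M HM]; exists M; intros t; apply HM.
  - intros eps; destruct (buc_ucont f eps) as [d Hd]; exists d; intros s t Hst; apply Hd.
    simpl; replace (s + 1 - (t + 1)) with (s - t) by ring; exact Hst.
Defined.

Lemma C0_shift (f : BUC X) : C0 f -> C0 (BUC_shift f).
Proof.
  intros H; apply C0_eps; intros eps; destruct (proj1 (C0_eps f) H eps) as [T HT].
  exists T; intros t Ht; apply HT; simpl; lra.
Qed.

Lemma is_D_shift (u v : BUC X) : is_D u v -> is_D (BUC_shift u) (BUC_shift v).
Proof.
  intros H; apply is_D_iff; intros t e He.
  destruct (proj1 (is_D_iff X u v) H (nn_add1 t) e He) as [d [Hd K]].
  exists d; split; [exact Hd|]; intros s Hs; specialize (K (nn_add1 s)); simpl in K.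
  replace (s + 1 - (t + 1)) with (s - t) in K by ring; exact (K Hs).
Qed.

Variable p : R.

Definition bloch_factor : C := (cos p, sin p).

Lemma Cmod_bloch_factor : Cmod bloch_factor = 1.
Proof.
  transitivity (sqrt 1); [|apply sqrt_1].
  unfold Cmod, bloch_factor; simpl; f_equal.
  pose proof (sin2_cos2 p) as H; unfold Rsqr in H; replace (cos p * (cos p * 1) + sin p * (sin p * 1)) with (sin p * sin p + cos p * cos p) by ring; exact H.
Qed.

Definition bloch_diff (f : BUC X) : BUC X :=
  BUC_plus (BUC_shift f) (BUC_scal (- bloch_factor)%C f).

Definition bloch_op (y : Y X) : Y X := tilde (bloch_diff (qrepr y)).

Lemma C0_bloch_diff (f : BUC X) : C0 f -> C0 (bloch_diff f).
Proof. intros H; apply C0_plus; [apply C0_shift, H|apply C0_scal, H]. Qed.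

Lemma bloch_diff_lincomb (k m : C) (f h : BUC X) :
  bloch_diff (BUC_plus (BUC_scal k f) (BUC_scal m h)) =
  BUC_plus (BUC_scal k (bloch_diff f)) (BUC_scal m (bloch_diff h)).
Proof. apply BUC_ext; intros t; simpl; vring X. Qed.

(** The representative chosen in [bloch_op] is immaterial: two of them differ by an element of C0,
    and [bloch_diff] preserves C0. *)
Lemma bloch_op_tilde (f : BUC X) : bloch_op (tilde f) = tilde (bloch_diff f).
Proof.
  unfold bloch_op; apply tilde_eq.
  set (h := qrepr (tilde f)).
  assert (E : tilde h = tilde f) by apply qreprK.
  apply tilde_eq in E; apply C0_bloch_diff in E.
  refine (eq_ind _ (@C0 X) E _ _); apply BUC_ext; intros t.
  change (bloch_diff (minus (G := BUC_NormedModule X) h f) t) with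
    (plus (buc_fun (minus (G := BUC_NormedModule X) h f) (nn_add1 t))
      (scal (- bloch_factor : C_AbsRing)%C (buc_fun (minus (G := BUC_NormedModule X) h f) t))).
  rewrite !BUC_minus_eval; simpl; vring X.
Qed.

Lemma bloch_op_lincomb (k m : C) (y z : Y X) :
  bloch_op (plus (scal k y) (scal m z)) = plus (scal k (bloch_op y)) (scal m (bloch_op z)).
Proof.
  destruct (tilde_surj X y) as [f <-], (tilde_surj X z) as [h <-].
  transitivity (bloch_op (tilde (BUC_plus (BUC_scal k f) (BUC_scal m h)))).
  - apply (f_equal bloch_op); rewrite tilde_plus, !tilde_scal; reflexivity.
  - rewrite !bloch_op_tilde, bloch_diff_lincomb, tilde_plus, !tilde_scal; reflexivity.
Qed.

Lemma sup_norm_bloch_diff (f : BUC X) : sup_norm (bloch_diff f) <= 2 * sup_norm f.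
Proof.
  apply sup_norm_le; intros t; simpl.
  replace (2 * sup_norm f) with (sup_norm f + 1 * sup_norm f) by ring.
  apply (norm_plus_le X); [apply sup_norm_ub|].
  apply norm_scal_le; [rewrite Cmod_opp, Cmod_bloch_factor; lra|apply sup_norm_ub].
Qed.

Lemma bloch_op_linear : is_linear (K := C_AbsRing) bloch_op.
Proof.
  split.
  - intros x y; pose proof (bloch_op_lincomb (RtoC 1) (RtoC 1) x y) as H1.
    assert (E : forall a b : Y X, plus (scal (RtoC 1) a) (scal (RtoC 1) b) = plus a b)
      by (intros; vring (Y X)).
    rewrite !E in H1; exact H1.
  - intros k x; pose proof (bloch_op_lincomb k (RtoC 0) x x) as H1.
    assert (E : forall a b : Y X, plus (scal k a) (scal (RtoC 0) b) = scal k a)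
      by (intros; vring (Y X)).
    rewrite !E in H1; exact H1.
  - exists 2; split; [lra|]; intros y; apply le_epsilon; intros e He.
    destruct (tilde_approx X y (e / 2)) as [f [<- Hf]]; [lra|].
    rewrite bloch_op_tilde; pose proof (norm_tilde X (bloch_diff f)).
    pose proof (sup_norm_bloch_diff f); lra.
Qed.

(** Translation commutes with differentiation. *)
Lemma bloch_op_Res (l : C) (y x : Y X) : Res l y x -> Res l (bloch_op y) (bloch_op x).
Proof.
  intros [z [[u [v [<- [HD <-]]]] <-]]; exists (bloch_op (tilde v)); split.
  - exists (bloch_diff u), (bloch_diff v); rewrite !bloch_op_tilde; split; [reflexivity|split; [|reflexivity]].
    pose proof (is_D_lincomb (RtoC 1) (- bloch_factor)%C _ _ _ _ (is_D_shift u v HD) HD) as H.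
    assert (E : forall w, BUC_plus (BUC_scal (RtoC 1) (BUC_shift w)) (BUC_scal (- bloch_factor)%C w) =
      bloch_diff w) by (intros w; apply BUC_ext; intros t; simpl; vring X).
    rewrite !E in H; exact H.
  - pose proof (bloch_op_lincomb l (RtoC (-1)) (tilde u) (tilde v)) as H.
    transitivity (bloch_op (plus (scal l (tilde u)) (scal (RtoC (-1)) (tilde v)))).
    + rewrite H; generalize (bloch_op (tilde u)) (bloch_op (tilde v)); intros; vring (Y X).
    + apply (f_equal bloch_op); generalize (tilde u) (tilde v); intros; vring (Y X).
Qed.

(* If [u' - l u] tends to 0 and [Re l = 0], then so do the derivative of
   [e^{-lt} u(t)] and its increments over unit intervals. *)
Lemma bloch_op_eigen (xi : R) (Q : Y X) :
  cos xi = cos p -> sin xi = sin p -> Res (iaxis xi) zero Q -> bloch_op Q = zero.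
Proof.
  intros Hcos Hsin [z [[u [v [<- [HD <-]]]] E]].
  rewrite bloch_op_tilde; apply tilde_zero, C0_eps; intros eps.
  set (l := iaxis xi) in *.
  assert (HC : C0 (BUC_plus (BUC_scal l u) (BUC_scal (opp (one : C_AbsRing)) v))).
  { apply tilde_zero; rewrite tilde_plus, !tilde_scal; etransitivity; [|exact E]; vring (Y X). }
  destruct (proj1 (C0_eps _) HC (pos_div_2 eps)) as [T HT]; simpl in HT.
  exists (Rmax 0 T); intros t Ht; pose proof (Rmax_l 0 T); pose proof (Rmax_r 0 T).
  assert (Hinc : norm (minus (twist X l (ext X u) (t + 1)) (twist X l (ext X u) t)) <=
    (t + 1 - t) * (eps / 2)).
  { apply (increment_bound X cX _ (fun t => scal (cexp (- l * RtoC t)%C)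
      (minus (ext X v t) (scal l (ext X u t))))); [lra| | |].
    - intros s Hs; apply twist_derive, is_D_derive; [exact HD|lra].
    - intros s Hs; apply (twist_continuous X l (fun t => minus (ext X v t) (scal l (ext X u t)))).
      apply (continuous_minus (V := RSN X) (ext X v) (fun t => scal l (ext X u t)));
        [apply ext_continuous|].
      change (continuous (ext X (BUC_scal l u)) s); apply ext_continuous.
    - intros s Hs.
      pose proof (norm_twist X l (fun t => minus (ext X v t) (scal l (ext X u t))) s) as E'.
      unfold twist in E'; rewrite E'; unfold l at 1, iaxis, Re; simpl.
      rewrite Ropp_0, Rmult_0_l, exp_0, Rmult_1_l, norm_minus_sym; left.
      specialize (HT (nn s)); rewrite nn_pos in HT by lra.
      refine (norm_eq_lt X _ _ _ _ (HT ltac:(lra))); vring X. }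
  (* By the choice of xi, e^{-lt} = w e^{ip}, so the twisted increment over [t, t + 1] is w times
     [bloch_diff u t], with |w| = 1. *)
  set (w := cexp (- l * RtoC (t + 1))%C).
  assert (Hw : Cmod w = 1).
  { unfold w; rewrite Cmod_cexp, <- exp_0; f_equal; unfold l, iaxis, Re; simpl; ring. }
  assert (Hwt : cexp (- l * RtoC t) = (w * bloch_factor)%C).
  { assert (El : bloch_factor = cexp l).
    { unfold bloch_factor, cexp, l, iaxis, Re, Im; simpl; rewrite exp_0, Hcos, Hsin; f_equal; ring. }
    rewrite El; unfold w; rewrite <- cexp_plus; f_equal; rewrite RtoC_plus; ring. }
  apply Rle_lt_trans with (1 * norm (bloch_diff u t)); [lra|]; rewrite <- Hw, <- norm_scalC.
  pose proof (cond_pos eps).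
  apply Rle_lt_trans with ((t + 1 - t) * (eps / 2)); [|lra].
  refine (norm_eq_le X _ _ _ _ Hinc); unfold twist; fold w; rewrite Hwt, ext_nonneg.
  assert (Et : ext X u (t + 1) = u (nn_add1 t)).
  { unfold ext; f_equal; apply nonnegreal_eq; simpl; apply Rmax_right.
    pose proof (cond_nonneg t); lra. }
  rewrite Et; simpl; vring X.
Qed.

(* The bounded solution is [k e^{lt} \int_t^{t+1} e^{-ls} f(s) ds] with
   [k = 1 / (1 - e^{ip - l})]. *)
Lemma bloch_resolvent (xi : R) (f : BUC X) : cexp (iaxis xi) <> bloch_factor ->
  C0 (bloch_diff f) -> exists u : BUC X,
    Res (iaxis xi) (tilde f) (tilde u) /\ C0 (bloch_diff u) /\
    sup_norm u <= / Cmod (1 - bloch_factor * cexp (- iaxis xi)) * sup_norm f.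
Proof.
  intros Hne Hf; set (l := iaxis xi) in *.
  assert (Hcl : cexp l <> 0) by apply cexp_neq_0.
  set (d := (1 - bloch_factor * cexp (- l))%C).
  assert (Hd : d <> 0).
  { unfold d; rewrite cexp_opp; intros E; apply Hne.
    replace (cexp l) with (bloch_factor + cexp l * (1 - bloch_factor * / cexp l))%C
      by (field; exact Hcl).
    rewrite E; ring. }
  set (I := fun t => minus (prim X cX l f (t + 1)) (prim X cX l f t)).
  set (U := fun t => scal (/ d)%C (twist X (- l)%C I t)).
  (* Since f(t + 1) is asymptotically e^{ip} f(t), the last bracket is asymptotically d f(t); thus
     U' = l U - f up to C0. *)
  set (W := fun t => minus (scal l (U t))
    (scal (/ d)%C (minus (ext X f t) (scal (cexp (- l)) (ext X f (t + 1)))))).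
  assert (Hone : forall t r, (cexp (- - l * RtoC t) * cexp (- l * RtoC (t + r)))%C = cexp (- l * RtoC r)).
  { intros t r; rewrite <- cexp_plus; f_equal; rewrite RtoC_plus; ring. }
  assert (Hl0 : forall t, exp (- Re l * t) = 1).
  { intros t; rewrite <- exp_0; f_equal; unfold l, iaxis, Re; simpl; ring. }
  assert (Hl0' : forall t, exp (- Re (- l) * t) = 1).
  { intros t; rewrite <- exp_0; f_equal; unfold l, iaxis, Re; simpl; ring. }
  assert (HpI : forall (h : BUC X) t M, 0 <= t -> (forall s, t <= s <= t + 1 -> norm (ext X h s) <= M) ->
    norm (minus (prim X cX l h (t + 1)) (prim X cX l h t)) <= M).
  { intros h t M Ht HM; replace M with ((t + 1 - t) * M) by ring.
    apply (increment_bound X cX _ (twist X l (ext X h))); [lra| | |].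
    - intros s _; apply prim_derive.
    - intros s _; apply twist_ext_continuous.
    - intros s Hs; rewrite norm_twist, Hl0, Rmult_1_l; apply HM, Hs. }
  assert (Hsh : forall t, is_derive (V := RSN X) (fun t => prim X cX l f (t + 1)) t
    (twist X l (ext X f) (t + 1))).
  { intros t.
    pose proof (is_derive_comp (V := RSN X) (prim X cX l f) (fun t : R => t + 1) t _ 1
      (prim_derive X cX l f (t + 1))) as H1.
    assert (H2 : is_derive (fun t : R => t + 1) t 1) by (auto_derive; auto).
    specialize (H1 H2); refine (eq_ind _ (fun w => is_derive (V := RSN X) _ t w) H1 _ _).
    apply (scal_one (V := X)). }
  assert (HD : forall t, is_derive (V := RSN X) U t (W t)).
  { intros t.
    assert (H1 : is_derive (V := RSN X) I t
      (minus (twist X l (ext X f) (t + 1)) (twist X l (ext X f) t))).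
    { apply (is_derive_minus (V := RSN X) (fun t => prim X cX l f (t + 1)) (prim X cX l f));
        [apply Hsh|apply prim_derive]. }
    pose proof (twist_derive X (- l)%C I t _ H1) as H2.
    assert (H3 : is_derive (V := RSN X) U t (scal (/ d)%C (scal (cexp (- - l * RtoC t)%C)
      (minus (minus (twist X l (ext X f) (t + 1)) (twist X l (ext X f) t)) (scal (- l)%C (I t)))))).
    { apply (proj2 (is_derive_R_iff X U t _)); intros e He.
      assert (Hm : 0 < Cmod (/ d)) by (rewrite Cmod_inv by exact Hd;
        apply Rinv_0_lt_compat, Cmod_gt_0, Hd).
      destruct (proj1 (is_derive_R_iff X _ t _) H2 (e / Cmod (/ d)))
        as [r [Hr K]]; [apply Rdiv_lt_0_compat; assumption|].
      exists r; split; [exact Hr|]; intros s Hs; specialize (K s Hs).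
      apply (Rmult_le_compat_l (Cmod (/ d))) in K; [|lra].
      rewrite <- norm_scalC in K.
      replace (Cmod (/ d) * (e / Cmod (/ d) * Rabs (s - t))) with (e * Rabs (s - t)) in K
        by (field; lra).
      refine (norm_eq_le X _ _ _ _ K); unfold U; vring X. }
    refine (eq_ind _ (fun w => is_derive (V := RSN X) U t w) H3 _ _).
    pose proof (Hone t 1) as E1; pose proof (Hone t 0) as E0.
    rewrite Rplus_0_r in E0.
    replace (- l * RtoC 0)%C with (RtoC 0) in E0 by ring; rewrite cexp_0 in E0.
    rewrite Cmult_1_r in E1.
    unfold W, U, twist.
    transitivity (minus (scal l (scal (/ d)%C (scal (cexp (- - l * RtoC t)%C) (I t))))
      (scal (/ d)%C (minus (scal (cexp (- - l * RtoC t) * cexp (- l * RtoC t))%C (ext X f t))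
        (scal (cexp (- - l * RtoC t) * cexp (- l * RtoC (t + 1)))%C (ext X f (t + 1)))))).
    - vring X.
    - rewrite E0, E1; vring X. }
  pose proof (Cmod_ge_0 l) as Pl; pose proof (sup_norm_ge_0 X f) as Pf.
  assert (Hdi : Cmod (/ d) = / Cmod d) by (apply Cmod_inv, Hd).
  assert (Hdp : 0 < / Cmod d) by (apply Rinv_0_lt_compat, Cmod_gt_0, Hd).
  assert (HU : forall t, 0 <= t -> norm (U t) <= / Cmod d * sup_norm f).
  { intros t Ht; unfold U; rewrite <- Hdi; apply norm_scal_le; [lra|].
    rewrite norm_twist, Hl0', Rmult_1_l; apply HpI; [exact Ht|]; intros; apply ext_norm. }
  destruct (BUC_of_derive X cX U W (/ Cmod d * sup_norm f)
    (Cmod l * (/ Cmod d * sup_norm f) + / Cmod d * (sup_norm f + 1 * sup_norm f)))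
    as [u [Hu1 Hu2]].
  - intros t _; apply HD.
  - intros t Ht.
    assert (HUc : continuous U t) by exact (is_derive_continuous_R X _ _ _ (HD t)).
    apply (continuous_minus (V := RSN X) (fun t => scal l (U t))
      (fun t => scal (/ d)%C (minus (ext X f t) (scal (cexp (- l)) (ext X f (t + 1))))));
      [apply scal_continuous, HUc|].
    apply scal_continuous, (continuous_minus (V := RSN X) (ext X f)); [apply ext_continuous|].
    apply scal_continuous, (continuous_comp (fun t => t + 1) (ext X f)); [|apply ext_continuous].
    apply (ex_derive_continuous (V := R_NormedModule)); auto_derive; trivial.
  - exact HU.
  - intros t Ht; unfold W; eapply Rle_trans; [apply norm_minus_le|].
    apply Rplus_le_compat; [apply norm_scal_le; [lra|apply HU, Ht]|].
    rewrite <- Hdi; apply norm_scal_le; [lra|]; eapply Rle_trans; [apply norm_minus_le|].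
    apply Rplus_le_compat; [apply ext_norm|].
    apply norm_scal_le; [|apply ext_norm].
    rewrite Cmod_cexp; replace (Re (- l)) with 0; [rewrite exp_0; lra|].
    unfold l, iaxis, Re; simpl; ring.
  - set (v := BUC_plus (BUC_scal l u) (BUC_plus (BUC_scal (- / d)%C f)
      (BUC_scal (/ d * cexp (- l))%C (BUC_shift f)))).
    assert (Hext : forall (h : BUC X) (t : nonnegreal), ext X h (t + 1) = h (nn_add1 t)).
    { intros h t; unfold ext; f_equal; apply nonnegreal_eq; simpl; apply Rmax_right.
      pose proof (cond_nonneg t); lra. }
    exists u; split; [|split].
    + exists (tilde v); split.
      * exists u, v; repeat split; apply (derive_is_D X u v U W); [exact Hu1| |intros; apply HD].
        intros t; unfold v, W; simpl; rewrite Hu1, ext_nonneg, Hext; vring X.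
      * etransitivity; [apply tilde_resolvent|]; apply tilde_eq.
        (* The defect l u - u' - f is exactly this multiple of [bloch_diff f]. *)
        apply (C0_scal (- (/ d) * cexp (- l))%C) in Hf.
        refine (eq_ind _ (@C0 X) Hf _ _); apply BUC_ext; intros t.
        rewrite !BUC_minus_eval; unfold v; simpl; vreduce X; unfold d; field; exact Hd.
    (* The solution must again lie in the kernel of the Bloch operator, so that the construction can
       be iterated. *)
    + apply C0_eps; intros eps; pose proof (cond_pos eps) as He.
      assert (He' : 0 < eps / (/ Cmod d) / 2).
      { apply Rdiv_lt_0_compat; [apply Rdiv_lt_0_compat|]; lra. }
      destruct (proj1 (C0_eps _) Hf (mkposreal _ He')) as [T HT]; simpl in HT.
      exists (Rmax 0 T); intros t Ht; pose proof (Rmax_l 0 T); pose proof (Rmax_r 0 T).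
      assert (Hkey : norm (minus (prim X cX l (bloch_diff f) (t + 1)) (prim X cX l (bloch_diff f) t)) <=
        eps / (/ Cmod d) / 2).
      { apply HpI; [lra|]; intros s Hs; left; unfold ext.
        apply (HT (nn s)); rewrite nn_pos; lra. }
      assert (Hprim : minus (prim X cX l (bloch_diff f) (t + 1)) (prim X cX l (bloch_diff f) t) =
        minus (scal (cexp l) (I (t + 1))) (scal bloch_factor (I t))).
      (* Both e^l prim f (s + 1) - e^{ip} prim f (s) and the primitive of [bloch_diff f] have the
         derivative e^{-ls} [bloch_diff f](s), so the increments of Z vanish. *)
      { set (Z := fun s => minus (minus (scal (cexp l) (prim X cX l f (s + 1)))
          (scal bloch_factor (prim X cX l f s))) (prim X cX l (bloch_diff f) s)).
        assert (HZ : norm (minus (Z (t + 1)) (Z t)) <= (t + 1 - t) * 0).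
        { apply (increment_bound X cX Z (fun _ => zero)); [lra| | |].
          - intros s Hs.
            assert (Hc : forall (k : C) (h : R -> X) (h' : X), is_derive (V := RSN X) h s h' ->
              is_derive (V := RSN X) (fun r => scal k (h r)) s (scal k h')).
            { intros k h h' Hh.
              pose proof (is_derive_scal_fct X (fun _ => k) h s zero h'
                (is_derive_const (V := RSN C_NormedModule) k s) Hh) as H1.
              refine (eq_ind _ (fun w => is_derive (V := RSN X) _ s w) H1 _ _); vring X. }
            pose proof (is_derive_minus (V := RSN X) _ _ _ _ _
              (is_derive_minus (V := RSN X) _ _ _ _ _ (Hc (cexp l) _ _ (Hsh s))
                (Hc bloch_factor _ _ (prim_derive X cX l f s))) (prim_derive X cX l (bloch_diff f) s)) as H1.
            refine (eq_ind _ (fun w => is_derive (V := RSN X) Z s w) H1 _ _).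
            change (@minus (RSN X)) with (@minus X).
            assert (Es : ext X (bloch_diff f) s = minus (ext X f (s + 1)) (scal bloch_factor (ext X f s))).
            { pose proof (Hext f (nn s)) as E; rewrite nn_pos in E by lra; rewrite E.
              unfold ext; simpl; vring X. }
            unfold twist; rewrite Es.
            assert (Ec : (cexp l * cexp (- l * RtoC (s + 1)))%C = cexp (- l * RtoC s)).
            { rewrite <- cexp_plus; f_equal; rewrite RtoC_plus; ring. }
            transitivity (minus (minus (scal (cexp l * cexp (- l * RtoC (s + 1)))%C (ext X f (s + 1)))
              (scal bloch_factor (scal (cexp (- l * RtoC s)%C) (ext X f s))))
              (scal (cexp (- l * RtoC s)%C) (minus (ext X f (s + 1)) (scal bloch_factor (ext X f s))))).
            + vring X.
            + rewrite Ec; vring X.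
          - intros s _; apply continuous_const.
          - intros s _; right; apply norm_zero_eq; reflexivity. }
        assert (HZ0 : minus (Z (t + 1)) (Z t) = zero).
        { apply (norm_eq_zero (V := X)), Rle_antisym; [rewrite Rmult_0_r in HZ; exact HZ|apply (norm_ge_0 (V := X))]. }
        symmetry; apply minus_zero_eq; etransitivity; [|exact HZ0]; unfold Z, I; vring X. }
      rewrite Hprim in Hkey.
      set (w := cexp (- - l * RtoC t)).
      assert (Ew : cexp (- - l * RtoC (t + 1)) = (w * cexp l)%C).
      { unfold w; rewrite <- cexp_plus; f_equal; rewrite RtoC_plus; ring. }
      assert (Hwn : Cmod w = 1).
      { unfold w; rewrite Cmod_cexp, <- exp_0; f_equal; unfold l, iaxis, Re; simpl; ring. }
      apply Rle_lt_trans with (/ Cmod d * (eps / (/ Cmod d) / 2)).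
      * apply (norm_eq_le X _ (scal (/ d * w)%C (minus (scal (cexp l) (I (t + 1))) (scal bloch_factor (I t))))).
        { simpl; rewrite !Hu1; unfold U, twist; simpl; rewrite Ew; fold w; vring X. }
        apply norm_scal_le; [rewrite Cmod_mult, Hwn, Hdi; lra|exact Hkey].
      * replace (/ Cmod d * (eps / (/ Cmod d) / 2)) with (eps / 2); [lra|].
        assert (0 < Cmod d) by (apply Cmod_gt_0, Hd); field; lra.
    + exact Hu2.
Qed.

End Quotient.

(** * The spectrum *)

Lemma Cmod_iaxis (a b : R) : Cmod (iaxis a - iaxis b) = Rabs (a - b).
Proof.
  replace (iaxis a - iaxis b)%C with (RtoC (a - b) * Ci)%C.
  - rewrite Cmod_mult, Cmod_Ci, Cmod_R; ring.
  - unfold iaxis, Ci, RtoC, Cmult, Cminus, Cplus, Copp; simpl; f_equal; ring.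
Qed.

Lemma iaxis_Im (z : C) : Re z = 0 -> z = iaxis (Im z).
Proof. destruct z as [x y]; unfold iaxis, Re, Im; simpl; intros ->; reflexivity. Qed.

Lemma cos_eq_1 (a : R) : cos a = 1 -> exists k : Z, a = 2 * PI * IZR k.
Proof.
  intros E; assert (H2 : sin (a / 2) = 0).
  { pose proof (cos_2a_sin (a / 2)) as H; replace (2 * (a / 2)) with a in H by field.
    rewrite E in H; apply Rsqr_0_uniq; unfold Rsqr; lra. }
  apply sin_eq_0_0 in H2; destruct H2 as [k Hk]; exists k; lra.
Qed.

Lemma cos_sin_periodic (a b : R) (k : Z) : a = b + 2 * PI * IZR k ->
  cos a = cos b /\ sin a = sin b.
Proof.
  intros ->; assert (H : forall n b, cos (b + 2 * PI * IZR (Z.of_nat n)) = cos b /\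
    sin (b + 2 * PI * IZR (Z.of_nat n)) = sin b).
  { intros n c; rewrite <- INR_IZR_INZ; replace (2 * PI * INR n) with (2 * INR n * PI) by ring.
    split; [apply cos_period|apply sin_period]. }
  destruct (Z_le_dec 0 k) as [Hk|Hk].
  - rewrite <- (Z2Nat.id k Hk); apply H.
  - destruct (H (Z.to_nat (- k)) (b + 2 * PI * IZR k)) as [E1 E2].
    rewrite Z2Nat.id, opp_IZR in E1, E2 by lia.
    replace (b + 2 * PI * IZR k + 2 * PI * - IZR k) with b in E1, E2 by ring; auto.
Qed.

Section Spectrum.

Variables (X : NormedModule C_AbsRing) (cX : CompleteSpace.mixin_of X).

Local Notation YX := (Y X).
Local Notation cY := (Y_complete X cX).
Local Notation Rl := (resolvent1 X).
Local Notation hatY := (fun (y : YX) (l : C) => resolvent l y).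

Lemma Sol_norm (l : C) (y x : YX) : Sol YX Rl l y x -> norm x * Rabs (Re l) <= norm y.
Proof. intros H; apply (Res_bound X cX l), (Sol_Res X cX), H. Qed.

Lemma Sol_resolvent (y : YX) (l : C) : Re l <> 0 -> Sol YX Rl l y (hatY y l).
Proof. intros H; apply (Sol_Res X cX), (Res_resolvent X cX), H. Qed.

Local Notation Rlin := (resolvent1_linear X cX).

(** One function on the whole plane that serves as the extension near every regular point; where no
    right limit exists its value is arbitrary. *)
Definition hat_ext (g : BUC X) : C -> YX := Gl YX hatY (tilde g).

Definition regular (g : BUC X) (z : C) : Prop := Reg YX Rl (tilde g) z.

Lemma hat_ext_off_axis (g : BUC X) (z : C) : Re z <> 0 -> hat_ext g z = hat g z.
Proof. apply (Gl_off_axis YX cY Rl Rlin Sol_norm hatY Sol_resolvent (tilde g) z). Qed.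

Lemma regular_off_axis (g : BUC X) (z : C) : Re z <> 0 -> regular g z.
Proof. apply (Reg_off_axis YX Rl Sol_norm hatY Sol_resolvent). Qed.

Lemma regular_analytic (g : BUC X) (z : C) : regular g z -> analytic_at (hat_ext g) z.
Proof.
  intros [x [M [rho Hd]]]; pose proof Hd as [Hr _].
  exists (fun n => scal ((- (1)) ^ n)%C (x n)).
  apply locally_Cmod; exists (1 / 4 / rho); split; [apply Rdiv_lt_0_compat; lra|].
  intros w Hw; change (ser YX (fun n => scal ((- (1)) ^ n)%C (x n)) (w - z)%C (hat_ext g w)).
  replace (w - z)%C with (- (z - w))%C by ring; apply ser_opp.
  apply (regdata_Gl_ser YX cY Rl Rlin Sol_norm hatY Sol_resolvent _ z w x M rho Hd).
  apply (Rmult_lt_compat_r rho) in Hw; [|lra].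
  replace (1 / 4 / rho * rho) with (1 / 4) in Hw by (field; lra); exact Hw.
Qed.

Lemma open_disc (c : C) (r : R) : open (fun z : C => Cmod (z - c) < r).
Proof.
  intros z Hz; apply locally_Cmod; exists (r - Cmod (z - c)); split; [lra|]; intros w Hw.
  replace (w - c)%C with ((w - z) + (z - c))%C by ring.
  pose proof (Cmod_triangle (w - z) (z - c)); lra.
Qed.

Lemma regular_not_sp (g : BUC X) (xi r : R) : 0 < r ->
  (forall z, Cmod (z - iaxis xi) < r -> regular g z) -> ~ sp g xi.
Proof.
  intros Hr H Hsp; apply Hsp; exists (fun z => Cmod (z - iaxis xi) < r), (hat_ext g).
  split; [apply open_disc|split; [|split]].
  - rewrite Cmod_iaxis, Rminus_diag, Rabs_R0; exact Hr.
  - intros z Hz; apply regular_analytic, H, Hz.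
  - intros z _ Hz; apply hat_ext_off_axis, Hz.
Qed.

Lemma analytic_cdiff (f : C -> YX) (z : C) : analytic_at f z -> ex_derive (K := C_AbsRing) f z.
Proof.
  intros [a Ha]; apply locally_Cmod in Ha; destruct Ha as [r [Hr H]].
  exists (a 1%nat); apply (ser_cdiff YX cY f a z r Hr); exact H.
Qed.

(** An analytic extension is complex differentiable on a disc and agrees with [hat] off the axis,
    which is what [cdiff_Reg] requires. *)
Lemma not_sp_regular (g : BUC X) (xi : R) : ~ sp g xi -> regular g (iaxis xi).
Proof.
  intros H; apply NNPP in H; destruct H as [U [G [HU [HUx [HA HG]]]]].
  apply HU in HUx; apply locally_Cmod in HUx; destruct HUx as [r [Hr HUr]].
  apply (cdiff_Reg YX cY Rl Rlin Sol_norm hatY Sol_resolvent G (tilde g) (iaxis xi) r eq_refl Hr).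
  - intros z Hz; apply analytic_cdiff, HA, HUr, Hz.
  - intros z Hz Hz0; apply HG; [apply HUr, Hz|exact Hz0].
Qed.

(** A point of the punctured disc is either off the axis or an axis point outside the spectrum. *)
Lemma isolated_regular (g : BUC X) (xi : R) : locally' xi (fun y => ~ sp g y) ->
  exists r, 0 < r /\ forall z, 0 < Cmod (z - iaxis xi) < r -> regular g z.
Proof.
  intros [r H]; exists r; split; [apply cond_pos|]; intros z [Hz1 Hz2].
  destruct (Req_dec (Re z) 0) as [E|E]; [|apply regular_off_axis, E].
  rewrite (iaxis_Im z E) in *; rewrite Cmod_iaxis in Hz1, Hz2; apply not_sp_regular.
  apply H; [exact Hz2|]; intros E'; rewrite E', Rminus_diag, Rabs_R0 in Hz1; lra.
Qed.

(** The alternative is whether the residue Q vanishes. *)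
Lemma isolated_singularity (g : BUC X) (xi : R) : locally' xi (fun y => ~ sp g y) ->
  removable_singularity (hat_ext g) (iaxis xi) \/ pole_of_order (hat_ext g) (iaxis xi) 1.
Proof.
  intros H; destruct (isolated_regular g xi H) as [r [Hr Hreg]]; set (c := iaxis xi) in *.
  destruct (isolated_expansion YX cY Rl Rlin Sol_norm hatY Sol_resolvent (tilde g) c r eq_refl Hr Hreg)
    as [Q [x [M [rho [d [HQ [Hd [Hd0 Hs]]]]]]]].
  fold (hat_ext g) in Hs.
  assert (Hne : forall z, z <> c -> 0 < Cmod (z - c)).
  { intros z Hz; apply Cmod_gt_0; intros E; apply Hz; replace z with (z - c + c)%C by ring.
    rewrite E; ring. }
  assert (Hser : forall z, z <> c -> Cmod (z - c) < d ->
    ser YX (fun n => scal ((- (1)) ^ n)%C (x n)) (z - c)%C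
      (minus (hat_ext g z) (scal (/ (z - c))%C Q))).
  { intros z Hz Hzd; replace (z - c)%C with (- (c - z))%C at 1 by ring; apply ser_opp.
    apply Hs; split; [apply Hne, Hz|exact Hzd]. }
  assert (Hloc : forall P : C -> Prop, (forall z, z <> c -> P z) -> locally' c P).
  { intros P HP; exists (mkposreal 1 Rlt_0_1); intros z _ Hz; apply HP, Hz. }
  destruct (classic (Q = zero)) as [EQ|HQ0].
  - left.
    (* The value at the centre is replaced by the constant coefficient of the regular part. *)
    exists (fun z => match excluded_middle_informative (z = c) with
      | left _ => x O | right _ => hat_ext g z end); split.
    + exists (fun n => scal ((- (1)) ^ n)%C (x n)); apply locally_Cmod; exists d; split; [exact Hd0|].
      intros z Hz; destruct (excluded_middle_informative (z = c)) as [->|Hzc].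
      * refine (eq_ind _ (fun w => ser YX _ w (x O)) _ _ (eq_sym (Cplus_opp_r c))).
        refine (eq_ind _ (fun w => ser YX _ _ w) (ser_at_0 YX (fun n => scal ((- (1)) ^ n)%C (x n))) _ _).
        change ((- (1)) ^ 0)%C with (RtoC 1); generalize (x O); intros; vring (Y X).
      * refine (eq_ind _ (fun w => ser YX _ _ w) (Hser z Hzc Hz) _ _); rewrite EQ.
        generalize (hat_ext g z); intros; vring (Y X).
    + apply Hloc; intros z Hz; destruct (excluded_middle_informative (z = c)); tauto.
  - right; split; [constructor|].
    (* (z - c) [hat_ext] extended by Q at c: the coefficients of the regular part move up by one
       index and Q takes index 0. *)
    set (h := fun z => match excluded_middle_informative (z = c) with
      | left _ => Q | right _ => scal (z - c)%C (hat_ext g z) end).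
    assert (Hhc : h c = Q) by (unfold h; destruct (excluded_middle_informative (c = c)); tauto).
    exists h; split; [|split].
    + exists (fun n => match n with O => Q | S n => scal ((- (1)) ^ n)%C (x n) end).
      apply locally_Cmod; exists d; split; [exact Hd0|]; intros z Hz.
      change (ser YX (fun n => match n with O => Q | S n => scal ((- (1)) ^ n)%C (x n) end) (z - c)%C (h z)).
      unfold h; destruct (excluded_middle_informative (z = c)) as [->|Hzc].
      * refine (eq_ind _ (fun w => ser YX _ w Q) _ _ (eq_sym (Cplus_opp_r c))).
        exact (ser_at_0 YX (fun n => match n with O => Q | S n => scal ((- (1)) ^ n)%C (x n) end)).
      * pose proof (is_series_scalC YX (z - c)%C _ _ (Hser z Hzc Hz)) as H1.
        refine (eq_ind _ (fun w => ser YX _ _ w) (is_series_cons YX _ _ (is_series_ext _ _ _ _ H1)) _ _).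
        -- intros n; rewrite Cpow_S; generalize (x n); intros; vring (Y X).
        -- change ((z - c) ^ 0)%C with (RtoC 1).
           assert (Hn : (z - c)%C <> 0) by (apply Cmod_gt_0, Hne, Hzc).
           generalize (hat_ext g z) Q; intros; vreduce (Y X); field; exact Hn.
    + rewrite Hhc; exact HQ0.
    + apply Hloc; intros z Hz; unfold h; destruct (excluded_middle_informative (z = c)) as [E|_]; [tauto|].
      assert (Hn : (z - c)%C <> 0) by (apply Cmod_gt_0, Hne, Hz).
      change (pow_n (Cinv (Cminus z c) : C_AbsRing) 1) with (Cmult (/ (z - c)) 1).
      generalize (hat_ext g z); intros; vreduce (Y X); field; exact Hn.
Qed.

Lemma regular_everywhere_C0 (y : YX) : (forall xi, Reg YX Rl y (iaxis xi)) -> y = zero.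
Proof.
  intros H; apply (resolvent1_injective X cX).
  apply (Reg_everywhere YX cY Rl Rlin Sol_norm hatY Sol_resolvent).
  intros z Hz; rewrite (iaxis_Im z Hz); apply H.
Qed.

Lemma sp_empty_C0 (g : BUC X) : (forall xi, ~ sp g xi) -> C0 g.
Proof.
  intros H; apply tilde_zero, regular_everywhere_C0; intros xi; apply not_sp_regular, H.
Qed.

(** A neighbourhood with its extension at one axis point serves all nearby axis points. *)
Lemma sp_closed (g : BUC X) : closed (sp g).
Proof.
  intros xi H; apply NNPP; intros Hn; apply H; clear H.
  assert (Hn' : exists (U : C -> Prop) (G : C -> YX), open U /\ U (iaxis xi) /\ extends_hat g U G).
  { apply NNPP; intros K; apply Hn; exact K. }
  destruct Hn' as [U [G [HU [HUx HG]]]].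
  pose proof (proj1 (locally_Cmod _ _) (HU _ HUx)) as [r [Hr HUr]].
  exists (mkposreal r Hr); intros eta Heta Hsp; apply Hsp; exists U, G.
  split; [exact HU|split; [|exact HG]]; apply HUr; rewrite Cmod_iaxis; exact Heta.
Qed.

(** * The spectrum of asymptotic Bloch functions *)

Variable p : R.

Lemma asymptotic_bloch1_iff (g : BUC X) : asymptotic_bloch1 g p <-> C0 (bloch_diff X p g).
Proof.
  assert (E : (fun t => minus (g (nn_add1 t)) (scal ((cos p, sin p) : C_AbsRing) (g t))) =
    buc_fun (bloch_diff X p g)).
  { apply functional_extensionality; intros t; simpl; unfold bloch_factor; vring X. }
  unfold asymptotic_bloch1, C0; rewrite E; tauto.
Qed.

(** [bloch_resolvent] returns a function of the same kind with its norm controlled by the fixed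
    factor k, so iterating it produces the chain and its geometric bound. *)
Lemma bloch_regular (g : BUC X) (xi : R) : C0 (bloch_diff X p g) ->
  ~ (cos xi = cos p /\ sin xi = sin p) -> regular g (iaxis xi).
Proof.
  intros Hg Hxi.
  assert (Hne : cexp (iaxis xi) <> bloch_factor p).
  { intros E; apply Hxi; unfold cexp, iaxis, bloch_factor, Re, Im in E; simpl in E.
    rewrite exp_0, !Rmult_1_l in E; injection E; auto. }
  set (k := / Cmod (1 - bloch_factor p * cexp (- iaxis xi))).
  assert (Hd : (1 - bloch_factor p * cexp (- iaxis xi))%C <> 0).
  { rewrite cexp_opp; intros E; apply Hne; pose proof (cexp_neq_0 (iaxis xi)) as Hc.
    replace (cexp (iaxis xi)) with
      (bloch_factor p + cexp (iaxis xi) * (1 - bloch_factor p * / cexp (iaxis xi)))%C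
      by (field; exact Hc).
    rewrite E; ring. }
  assert (Hk : 0 < k) by (apply Rinv_0_lt_compat, Cmod_gt_0, Hd).
  (* The subtype carries the condition along, as needed to iterate the choice function. *)
  assert (Hstep : forall f : {f : BUC X | C0 (bloch_diff X p f)}, exists u : {f : BUC X | C0 (bloch_diff X p f)},
    Res X (iaxis xi) (tilde (proj1_sig f)) (tilde (proj1_sig u)) /\
    sup_norm (proj1_sig u) <= k * sup_norm (proj1_sig f)).
  { intros [f Hf]; destruct (bloch_resolvent X cX p xi f Hne Hf) as [u [H1 [H2 H3]]].
    exists (exist _ u H2); split; assumption. }
  apply choice in Hstep; destruct Hstep as [S HS].
  set (f := fun n => Nat.iter n S (exist _ g Hg)).
  exists (fun n => tilde (proj1_sig (f (Datatypes.S n)))), (k * sup_norm g), k.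
  split; [exact Hk|split; [|split]].
  - intros n; eapply Rle_trans; [apply norm_tilde|].
    induction n as [|n IH].
    + rewrite pow_O, Rmult_1_r; apply (HS (exist _ g Hg)).
    + eapply Rle_trans; [apply (HS (f (Datatypes.S n)))|].
      apply (Rmult_le_compat_l k) in IH; [|lra].
      replace (k * sup_norm g * k ^ Datatypes.S n) with (k * (k * sup_norm g * k ^ n)) by (simpl; ring).
      exact IH.
  - apply (Sol_Res X cX), (HS (exist _ g Hg)).
  - intros n; apply (Sol_Res X cX), (HS (f (Datatypes.S n))).
Qed.

(** Regularity is needed on a whole disc around i xi; it is available because cos (eta - p) <> 1
    persists for eta near xi. *)
Lemma bloch_sp (g : BUC X) : C0 (bloch_diff X p g) ->
  forall xi, sp g xi -> exists k : Z, xi = p + 2 * PI * IZR k.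
Proof.
  intros Hg xi Hsp; apply NNPP; intros Hn.
  assert (Hc : cos (xi - p) <> 1).
  { intros E; apply Hn; destruct (cos_eq_1 _ E) as [k Hk]; exists k; lra. }
  assert (Hcont : continuity_pt (fun x => cos (x - p)) xi) by reg.
  assert (He : 0 < Rabs (cos (xi - p) - 1)) by (apply Rabs_pos_lt; lra).
  destruct (proj1 (continuity_pt_locally _ _) Hcont (mkposreal _ He)) as [r Hr]; simpl in Hr.
  revert Hsp; apply (regular_not_sp g xi r (cond_pos r)); intros z Hz.
  destruct (Req_dec (Re z) 0) as [E|E]; [|apply regular_off_axis, E].
  rewrite (iaxis_Im z E) in *; rewrite Cmod_iaxis in Hz.
  apply bloch_regular; [exact Hg|]; intros [E1 E2].
  specialize (Hr (Im z) Hz); rewrite cos_minus, E1, E2 in Hr.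
  pose proof (sin2_cos2 p) as Hp; unfold Rsqr in Hp.
  rewrite (Rabs_minus_sym (cos (xi - p)) 1) in Hr.
  replace (cos p * cos p + sin p * sin p) with 1 in Hr by lra; lra.
Qed.

(** The image of g under the Bloch operator A is shown to be regular at every axis point. At a
    spectral point A g = A (g - Q), as the residue Q is annihilated, and g - Q is regular there. *)
Lemma sp_bloch (g : BUC X) :
  (forall xi, sp g xi -> exists k : Z, xi = p + 2 * PI * IZR k) -> C0 (bloch_diff X p g).
Proof.
  intros H; apply tilde_zero; rewrite <- bloch_op_tilde; apply regular_everywhere_C0; intros xi.
  assert (Hmap : forall y, Reg YX Rl y (iaxis xi) -> Reg YX Rl (bloch_op X p y) (iaxis xi)).
  { intros y; apply Reg_map; [apply bloch_op_linear|].
    intros l a b Hab; apply (Sol_Res X cX), bloch_op_Res, (Sol_Res X cX), Hab. }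
  destruct (classic (sp g xi)) as [Hsp|Hsp]; [|apply Hmap, not_sp_regular, Hsp].
  destruct (H xi Hsp) as [k Hk].
  assert (Hiso : locally' xi (fun y => ~ sp g y)).
  (* Radius 1 is enough, since distinct points of p + 2 pi Z are at least 2 pi apart. *)
  { exists (mkposreal 1 Rlt_0_1); intros eta Heta Hne Hs; apply Hne.
    destruct (H eta Hs) as [m Hm]; change (Rabs (eta - xi) < 1) in Heta.
    pose proof PI_RGT_0; pose proof PI2_3_2.
    assert (E : m = k); [|rewrite Hm, Hk, E; reflexivity].
    replace (eta - xi) with (2 * PI * IZR (m - k)) in Heta by (rewrite Hm, Hk, minus_IZR; ring).
    apply Rabs_def2 in Heta.
    assert (IZR (m - k) < 1) by nra; assert (-1 < IZR (m - k)) by nra.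
    apply lt_IZR in H2; apply lt_IZR in H3; lia. }
  destruct (isolated_regular g xi Hiso) as [r [Hr Hreg]].
  destruct (isolated_expansion YX cY Rl Rlin Sol_norm hatY Sol_resolvent (tilde g) (iaxis xi) r eq_refl Hr Hreg)
    as [Q [x [M [rho [d [HQ [Hd _]]]]]]].
  destruct (cos_sin_periodic xi p k Hk) as [Ecos Esin].
  assert (HAQ : bloch_op X p Q = zero).
  { apply (bloch_op_eigen X cX p xi Q Ecos Esin), (Sol_Res X cX), HQ. }
  assert (HR : Reg YX Rl (minus (tilde g) Q) (iaxis xi)) by (exists x, M, rho; exact Hd).
  apply Hmap in HR; refine (eq_ind _ (fun w => Reg YX Rl w (iaxis xi)) HR _ _).
  pose proof (bloch_op_lincomb X p (RtoC 1) (RtoC (-1)) (tilde g) Q) as E; rewrite HAQ in E.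
  transitivity (bloch_op X p (plus (scal (RtoC 1) (tilde g)) (scal (RtoC (-1)) Q))).
  - apply f_equal; generalize (tilde g) Q; intros; vring (Y X).
  - etransitivity; [exact E|]; generalize (bloch_op X p (tilde g)); intros; vring (Y X).
Qed.

End Spectrum.

Theorem theorem3p5 (X : CompleteNormedModule C_AbsRing) (g : BUC X) :
  (forall xi0 : R, isolated_point (sp g) xi0 ->
     exists (U : C -> Prop) (G : C -> Y X),
       open U /\ U (iaxis xi0) /\
       extends_hat g (fun z => U z /\ z <> iaxis xi0) G /\
       (removable_singularity G (iaxis xi0) \/
        exists n : nat, (n <= 1)%nat /\ pole_of_order G (iaxis xi0) n)) /\
  ((forall xi : R, ~ sp g xi) -> C0 g) /\
  closed (sp g) /\
  (forall p : R, 0 <= p < 2 * PI ->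
     (asymptotic_bloch1 g p <->
      forall xi : R, sp g xi -> exists k : Z, xi = p + 2 * PI * IZR k)).
Proof.
  pose (cX := CompleteNormedModule.mixin C_AbsRing X (CompleteNormedModule.class C_AbsRing X)
    : CompleteSpace.mixin_of (CompleteNormedModule.NormedModule C_AbsRing X)).
  split; [|split; [|split]].
  - intros xi [_ Hiso]; destruct (isolated_regular _ cX g xi Hiso) as [r [Hr Hreg]].
    (* A disc whose other points are all regular. *)
    exists (fun z => Cmod (z - iaxis xi) < r), (hat_ext _ g).
    split; [apply open_disc|split; [|split; [split|]]].
    + rewrite Cmod_iaxis, Rminus_diag, Rabs_R0; exact Hr.
    + intros z [Hz Hne]; apply (regular_analytic _ cX), Hreg; split; [|exact Hz].
      apply Cmod_gt_0; intros E; apply Hne; replace z with (z - iaxis xi + iaxis xi)%C by ring.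
      rewrite E; ring.
    + intros z _ Hz; apply (hat_ext_off_axis _ cX), Hz.
    + destruct (isolated_singularity _ cX g xi Hiso) as [H|H]; [left; exact H|right].
      exists 1%nat; split; [constructor|exact H].
  - apply (sp_empty_C0 _ cX).
  - apply sp_closed.
  - intros p _; split.
    + intros H; apply (bloch_sp _ cX), asymptotic_bloch1_iff, H.
    + intros H; apply asymptotic_bloch1_iff, (sp_bloch _ cX), H.
Qed.
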